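(* If $M$ is a compact manifold over a locally compact field $\mathbf K$ of characteristic $char(\mathbf K)=p>1$, $1\le t\in\mathbf N$, $\alpha\in\{t,[t]\}$, then there exists a clopen subgroup $W$ in $Diff^{\alpha}(M)$ such that each element $g\in W$ lies on a local one-parameter subgroup $g^x$, continuous in $x$, relative to the multiplicative group $(\mathbf K^*,\times)$, $x\in\mathbf K^*$.
   Context: $\mathbf K$ is an infinite locally compact field with a nontrivial non-Archimedean multiplicative norm $|\cdot|$, $\mathbf K^*=\mathbf K\setminus\{0\}$. For $U\subset X$ open and $f:U\to Y$ ($X,Y$ topological vector spaces over $\mathbf K$), put $U^{[1]}=\{(x,v,t): x\in U,x+tv\in U\}$, $f^{[1]}(x,v,t)=(f(x+tv)-f(x))/t$ for $t\neq 0$; $f$ is $C^{[1]}$ if it is continuous and $f^{[1]}$ extends continuously to $U^{[1]}$; inductively $U^{[n+1]}=(U^{[n]})^{[1]}$, $f^{[n+1]}=(f^{[n]})^{[1]}$, $\Upsilon^nf=f^{[n]}$, defining class $C^{[n]}$. Similarly $f$ is $C^n$ if it is continuous and the iterated difference quotients in the variable $x$ only, $\Phi^1f=f^{[1]}$, $\Phi^{k+1}f(x;v_1,\dots,v_{k+1};t_1,\dots,t_{k+1})=\Phi^1(\Phi^kf(x;v_1,\dots,v_k;t_1,\dots,t_k))(x;v_{k+1};t_{k+1})$, have continuous extensions $\bar\Phi^kf$, $k\le n$, to $U^{(k)}=\{(x;v_1,\dots,v_k;t_1,\dots,t_k): x\in U,x+v_1t_1\in U,\dots,x+v_1t_1+\dots+v_kt_k\in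 U\}$. Put $S^k=\bar\Phi^k$ for $\alpha=n$, $S^k=\Upsilon^k$ for $\alpha=[n]$. The manifold $M$ is modelled on $\mathbf K^d$ with transition maps of class at least $C^\alpha$. $Diff^\alpha(M)$ is the group of all homeomorphisms $M\to M$ of class $C^\alpha$ in charts, with the topology inherited from $C^\alpha(M,M)$, i.e. given through charts by uniform convergence of $S^kf$, $0\le k\le t$, at arguments with $x$ in bounded open subsets, vector increments bounded, scalar arguments of norm $\le1$. A local one-parameter subgroup relative to $(\mathbf K^*,\times)$ on which $g$ lies: a family $\{g^x: x\in B(\mathbf K,1,|\pi|^s)\}\subset Diff^\alpha(M)$, where $\pi\in\mathbf K$, $0<|\pi|<1$, $1\le s\in\mathbf N$, $B(\mathbf K,1,r)=\{x\in\mathbf K:|x-1|\le r\}$, such that $g^1=id$; $g^{x_1}g^{x_2}=g^{x_1x_2}$ for all $x_1,x_2\in B(\mathbf K,1,|\pi|^s)$; and $g^{x_0}=g$ for some $x_0\in B(\mathbf K,1,|\pi|^s)$. *)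

(* Defs.v *)
From HB Require Import structures.
From mathcomp Require Import all_boot all_order all_algebra.
From mathcomp Require Import all_classical all_reals all_analysis.

Set Implicit Arguments.
Unset Strict Implicit.
Unset Printing Implicit Defensive.

Import Order.TTheory GRing.Theory Num.Theory.
Local Open Scope classical_set_scope.
Local Open Scope ring_scope.

(* Fields with a nontrivial non-Archimedean multiplicative norm. The library's
   normed structures do not apply: there the norm takes its values in the field
   of scalars itself, which forces characteristic 0. Nontriviality of the norm
   makes the field infinite. *)
HB.mixin Record isNonArchNormed (R : realType) K of GRing.Field K := {
  nabs : K -> R;
  nabs_ge0 : forall x : K, 0 <= nabs x;
  nabs_eq0 : forall x : K, nabs x = 0 <-> x = 0;
  nabsM : forall x y : K, nabs (x * y) = nabs x * nabs y;
  nabs_ultra : forall x y : K, nabs (x + y) <= Num.max (nabs x) (nabs y);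
  nabs_nontriv : exists x : K, x != 0 /\ nabs x != 1
}.

#[short(type="nonArchFieldType")]
HB.structure Definition NonArchField (R : realType) :=
  {K of GRing.Field K & isNonArchNormed R K}.

Section NormTopology.
Context (R : realType) (K : nonArchFieldType R).
Implicit Types (x y z : K) (e : R).

Definition nball x e y := nabs (x - y) < e.

Lemma nball_center x e : 0 < e -> nball x e x.
Proof. by move=> e0; rewrite /nball subrr (nabs_eq0 (0 : K)).2. Qed.

Lemma nabsN x : nabs (- x) = nabs x.
Proof.
have n1 : nabs (- (1 : K)) = 1.
  have n11 : nabs (1 : K) = 1.
    have := nabsM (1 : K) 1; rewrite mulr1 -{1}[nabs _]mulr1 => /mulfI -> //.
    by apply/negP => /eqP/nabs_eq0/eqP; rewrite oner_eq0.
  have : nabs (- (1 : K)) ^+ 2 = 1 by rewrite expr2 -nabsM mulrNN mulr1.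
  by move/eqP; rewrite sqrp_eq1 ?nabs_ge0// => /eqP.
by rewrite -mulN1r nabsM n1 mul1r.
Qed.

Lemma nball_sym x y e : nball x e y -> nball y e x.
Proof. by rewrite /nball -nabsN opprB. Qed.

Lemma nball_triangle x y z e1 e2 :
  nball x e1 y -> nball y e2 z -> nball x (e1 + e2) z.
Proof.
rewrite /nball => xy yz; rewrite -(subrK y x) -addrA.
apply: le_lt_trans (nabs_ultra _ _) _.
rewrite gt_max; apply/andP; split.
  by apply: lt_le_trans xy _; rewrite lerDl (le_trans _ (ltW yz)) ?nabs_ge0.
by apply: lt_le_trans yz _; rewrite lerDr (le_trans _ (ltW xy)) ?nabs_ge0.
Qed.

HB.instance Definition _ := hasNbhs.Build (NonArchField.sort K)
  (nbhs_ (entourage_ nball)).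
HB.instance Definition _ := Nbhs_isPseudoMetric.Build R (NonArchField.sort K)
  erefl nball_center nball_sym nball_triangle erefl.

End NormTopology.

(* The smoothness classes C^n and C^[n]. *)
Inductive smoothness := Citer of nat | Cbrack of nat.

Section DifferenceQuotients.
Context {R : realType} {K : nonArchFieldType R}.

Definition vnorm d (v : 'rV[K]_d) : R := \big[Num.max/0]_i nabs (v 0 i).

(* F is a continuous extension to D of a map q given on D `&` D0. Below, D0 is
   the set of arguments with nonzero scalars and U is open, so that D `&` D0 is
   dense in D and F is determined on D by q. *)
Definition cont_ext (X Y : topologicalType) (D D0 : set X) (q F : X -> Y) :=
  {within D, continuous F} /\ (forall y, D y -> D0 y -> F y = q y).

Section Bracketed.
Variable d : nat.

(* The vector space containing U^[k] for U in K^d: X |-> X * X * K iterated,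
   with points (x, v, t). *)
Fixpoint brarg (k : nat) : topologicalType :=
  if k is k'.+1 then (brarg k' * brarg k' * K)%type else 'rV[K]_d.

(* y + s w in the vector space [brarg k] *)
Fixpoint brshift (k : nat) (s : K) : brarg k -> brarg k -> brarg k :=
  match k with
  | 0%N => fun y w => y + s *: w
  | k'.+1 => fun y w => (brshift s y.1.1 w.1.1, brshift s y.1.2 w.1.2,
                         y.2 + s * w.2)
  end.

Fixpoint brdom (U : set 'rV[K]_d) (k : nat) : set (brarg k) :=
  match k with
  | 0%N => U
  | k'.+1 => [set y | brdom U y.1.1 /\ brdom U (brshift y.2 y.1.1 y.1.2)]
  end.

Definition brquot e k (g : brarg k -> 'rV[K]_e) (y : brarg k.+1) : 'rV[K]_e :=
  y.2^-1 *: (g (brshift y.2 y.1.1 y.1.2) - g y.1.1).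

Definition is_brext e (U : set 'rV[K]_d) k (g : brarg k -> 'rV[K]_e)
    (F : brarg k.+1 -> 'rV[K]_e) :=
  cont_ext (brdom U (k := k.+1)) [set y : brarg k.+1 | y.2 != 0] (brquot g) F.

(* f^[k], continuously extended to U^[k] at each step; junk off U^[k], or if
   there is no extension *)
Fixpoint Upsilon e (U : set 'rV[K]_d) (f : 'rV[K]_d -> 'rV[K]_e) (k : nat) :
    brarg k -> 'rV[K]_e :=
  match k with
  | 0%N => f
  | k'.+1 => xget (fun=> 0) (is_brext U (Upsilon U f (k := k')))
  end.

Fixpoint brclass e (U : set 'rV[K]_d) (f : 'rV[K]_d -> 'rV[K]_e) (n : nat) :=
  if n is n'.+1 then
    brclass U f n' /\ exists F, is_brext U (Upsilon U f (k := n')) F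
  else {within U, continuous f}.

(* Bounds on increments, resp. arguments other than the base point x: the
   components in K^d have norm at most rho, those in K norm at most 1. *)
Fixpoint brincr (rho : R) (k : nat) : set (brarg k) :=
  match k with
  | 0%N => [set w | vnorm w <= rho]
  | k'.+1 => [set w | [/\ brincr rho w.1.1, brincr rho w.1.2 & nabs w.2 <= 1]]
  end.

Fixpoint brbound (rho : R) (k : nat) : set (brarg k) :=
  match k with
  | 0%N => setT
  | k'.+1 => [set y | [/\ brbound rho y.1.1, brincr rho y.1.2 & nabs y.2 <= 1]]
  end.

End Bracketed.

Section Iterated.
Variable d : nat.

(* (x; v_1, ..., v_k; t_1, ..., t_k) is encoded as
   (... ((x, v_1, t_1), v_2, t_2) ..., v_k, t_k). *)
Fixpoint itarg (k : nat) : topologicalType :=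
  if k is k'.+1 then (itarg k' * 'rV[K]_d * K)%type else 'rV[K]_d.

(* adds v to the base point x only *)
Fixpoint itshift (k : nat) (v : 'rV[K]_d) : itarg k -> itarg k :=
  match k with
  | 0%N => fun y => y + v
  | k'.+1 => fun y => (itshift v y.1.1, y.1.2, y.2)
  end.

(* The arguments at which the k-th iterated quotient makes sense: all the
   partial sums x + \sum_(i in I) t_i v_i, for I a set of indices, are in U.
   When U is a ball this amounts to x, x + t_1 v_1, ...,
   x + t_1 v_1 + ... + t_k v_k being in U. *)
Fixpoint itdom (U : set 'rV[K]_d) (k : nat) : set (itarg k) :=
  match k with
  | 0%N => U
  | k'.+1 => [set y | itdom U y.1.1 /\ itdom U (itshift (y.2 *: y.1.2) y.1.1)]
  end.

Fixpoint itregular (k : nat) : set (itarg k) :=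
  match k with
  | 0%N => setT
  | k'.+1 => [set y | itregular y.1.1 /\ y.2 != 0]
  end.

Fixpoint Phi e (f : 'rV[K]_d -> 'rV[K]_e) (k : nat) : itarg k -> 'rV[K]_e :=
  match k with
  | 0%N => f
  | k'.+1 => fun y =>
      y.2^-1 *: (Phi f (itshift (y.2 *: y.1.2) y.1.1) - Phi f y.1.1)
  end.

Definition is_Phibar e (U : set 'rV[K]_d) (f : 'rV[K]_d -> 'rV[K]_e) k
    (F : itarg k -> 'rV[K]_e) :=
  cont_ext (itdom U (k := k)) (itregular (k := k)) (Phi f (k := k)) F.

Definition Phibar e (U : set 'rV[K]_d) (f : 'rV[K]_d -> 'rV[K]_e) k :
    itarg k -> 'rV[K]_e :=
  xget (fun=> 0) (is_Phibar U f (k := k)).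

Definition itclass e (U : set 'rV[K]_d) (f : 'rV[K]_d -> 'rV[K]_e) (n : nat) :=
  {within U, continuous f} /\
  forall k, (k <= n)%N -> exists F, is_Phibar U f (k := k) F.

Fixpoint itbound (rho : R) (k : nat) : set (itarg k) :=
  match k with
  | 0%N => setT
  | k'.+1 => [set y | [/\ itbound rho y.1.1, vnorm y.1.2 <= rho & nabs y.2 <= 1]]
  end.

End Iterated.

Definition smooth_order (alpha : smoothness) : nat :=
  match alpha with Citer n => n | Cbrack n => n end.

Definition smooth d e (alpha : smoothness) (U : set 'rV[K]_d)
    (f : 'rV[K]_d -> 'rV[K]_e) : Prop :=
  match alpha with
  | Citer n => itclass U f n
  | Cbrack n => brclass U f n
  end.

(* The S^k f and S^k g, for f and g on U, are within eps of each other at all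
   arguments with vector increments of norm at most rho and scalars of norm at
   most 1. *)
Definition close_on d e (alpha : smoothness) (k : nat) (U : set 'rV[K]_d)
    (rho eps : R) (f g : 'rV[K]_d -> 'rV[K]_e) : Prop :=
  match alpha with
  | Citer _ => forall y : itarg d k, itdom U y -> itbound rho y ->
      ball (Phibar U f y) eps (Phibar U g y)
  | Cbrack _ => forall y : brarg d k, brdom U y -> brbound rho y ->
      ball (Upsilon U f y) eps (Upsilon U g y)
  end.

Definition vbounded d (U : set 'rV[K]_d) :=
  exists rho : R, forall x, U x -> vnorm x <= rho.

End DifferenceQuotients.

Section Manifolds.
Context {R : realType} (K : nonArchFieldType R) (d : nat).

(* A homeomorphism [cfun], with inverse [cinv], of an open set [cdom] of M onto
   an open set of K^d; the values outside these sets are irrelevant. *)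
Record chart (M : topologicalType) := Chart {
  cdom : set M;
  cfun : M -> 'rV[K]_d;
  cinv : 'rV[K]_d -> M;
  cdom_open : open cdom;
  cimg_open : open (cfun @` cdom);
  cfunK : forall x, cdom x -> cinv (cfun x) = x;
  cfun_cont : {within cdom, continuous cfun};
  cinv_cont : {within cfun @` cdom, continuous cinv}
}.

Record atlas (alpha : smoothness) (M : topologicalType) := Atlas {
  cidx : Type;
  achart :> cidx -> chart M;
  acover : forall x, exists i, cdom (achart i) x;
  atrans : forall i j,
    smooth alpha (cfun (achart i) @` (cdom (achart i) `&` cdom (achart j)))
           (cfun (achart j) \o cinv (achart i))
}.

Section Diffeomorphisms.
Context (alpha : smoothness) (M : topologicalType) (A : atlas alpha M).

Definition in_charts (i j : cidx A) (f : M -> M) : 'rV[K]_d -> 'rV[K]_d :=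
  cfun (A j) \o f \o cinv (A i).

Definition smooth_map (f : M -> M) := forall i j : cidx A,
  smooth alpha (cfun (A i) @` (cdom (A i) `&` f @^-1` cdom (A j)))
         (in_charts i j f).

(* Diff^alpha(M); the condition on the inverse makes it a group. *)
Record diffeo := Diffeo {
  dfun :> M -> M;
  dfunP : exists g : M -> M, [/\ cancel dfun g, cancel g dfun,
    continuous dfun /\ continuous g & smooth_map dfun /\ smooth_map g]
}.

(* The topology of C^alpha(M, M) is read in charts: on a bounded open set O
   whose closure lies in (the image of) the chart i and is mapped by f0 into the
   chart j, the k-th difference quotients, k <= t, are eps-close to those of
   f0. *)
Definition diffeo_subbase : set (set diffeo) := [set N |
  exists (f0 : diffeo) (i j : cidx A) (O : set 'rV[K]_d) (k : nat) (rho eps : R),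
  [/\ [/\ open O, vbounded O & closure O `<=` cfun (A i) @` cdom (A i)],
      f0 @` (cinv (A i) @` closure O) `<=` cdom (A j),
      (k <= smooth_order alpha)%N,
      0 < eps &
      N = [set f : diffeo | f @` (cinv (A i) @` closure O) `<=` cdom (A j) /\
             close_on alpha k O rho eps (in_charts i j f0) (in_charts i j f)]]].

HB.instance Definition _ := gen_eqMixin diffeo.
HB.instance Definition _ := gen_choiceMixin diffeo.
HB.instance Definition _ := isSubBaseTopological.Build diffeo diffeo_subbase id.

Definition is_subgroup (W : set diffeo) :=
  [/\ exists2 e, W e & dfun e = idfun,
      forall f g, W f -> W g -> exists2 h, W h & dfun h = f \o g &
      forall f, W f -> exists2 h, W h & cancel f h /\ cancel h f].

(* B(K, 1, |pi|^s) *)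
Definition unit_ball (pi : K) (s : nat) : set K :=
  [set x | nabs (x - 1) <= nabs pi ^+ s].

(* The family (g^x), x in B(K, 1, |pi|^s), is given by a function on K whose
   values outside the ball are irrelevant. *)
Definition local_one_param (pi : K) (s : nat) (gx : K -> diffeo) :=
  [/\ 0 < nabs pi < 1, (1 <= s)%N, dfun (gx 1) = idfun &
      forall x1 x2, unit_ball pi s x1 -> unit_ball pi s x2 ->
        dfun (gx (x1 * x2)) = gx x1 \o gx x2].

Definition lies_on (g : diffeo) (pi : K) (s : nat) (gx : K -> diffeo) :=
  exists2 x0, unit_ball pi s x0 & gx x0 = g.

End Diffeomorphisms.
End Manifolds.

(* Main.v *)
Require Import Defs.
From HB Require Import structures.
From mathcomp Require Import all_boot all_order all_algebra.
From mathcomp Require Import all_classical all_reals all_analysis.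
From mathcomp Require Import finmap ring lra zify.

Set Implicit Arguments.
Unset Strict Implicit.
Unset Printing Implicit Defensive.

Import Order.TTheory GRing.Theory Num.Theory.
Local Open Scope classical_set_scope.
Local Open Scope ring_scope.

(** In characteristic p every diffeomorphism g near the identity has p-adic powers g^z,
    and the multiplicative group 1 + pi O maps onto the p-adic integers; the
    one-parameter subgroup is x |-> g^(zeta x), where zeta (1 + pi) = 1.

    Cover M by finitely many balls in charts, and let W consist of the diffeomorphisms
    g that preserve each of these balls, with a displacement u = g - id in the chart
    which is c-Lipschitz and at most c times the radius, for some c < 1. By the
    ultrametric inequality W is stable under composition, and under inversion because g
    is onto on each ball by recurrence ([near_id_subgroup]). It is open because the
    quotients of order 0 and 1 control u ([near_id_open]), and closed because it is
    defined by closed conditions on values ([near_id_closed]).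

    For g in W the displacement of g^p is a sum of p terms u(g^i y), whose differences
    are c times smaller than u(y); as p u(y) = 0, the displacement contracts by the
    factor c ([nearid_pow]), and g^n depends on n in a p-adically uniformly continuous
    way. Hence g^z exists for z in Z_p. For the smoothness of g^z, jointly with the
    parameter z, the difference quotients are treated as maps too: the prolongation
    (x, v, t) |-> (g x, dg (x, v, t), t) has powers which are the prolongations of the
    powers of g, and it is a skew product whose fibre maps are again perturbations of
    the identity, with the same c ([triangular_prolong]). An argument for skew products
    over a p-adic odometer ([odometer]) then applies to prolongations of all orders
    ([triangular_family]). For C^[n] the prolongation moves x, v and t; for C^n one
    shows first that the quotients exist with variable vectors and fixed scalars
    ([iterated_full]). In both cases the chain rule is the functoriality of
    prolongations, and smoothness is local ([Br_local]), which lets the powers be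
    compared in charts ([family_local]).

    The homomorphism zeta is built from characters of 1 + pi O with values in Q/Z
    ([padic_logarithm]). Characters extend from open subgroups as Q/Z is divisible, and
    a character chi can be divided by p as the p-th power is injective on 1 + pi O;
    starting from a character with value 1/p at 1 + pi, one finds compatible characters
    with values 1/p^m at 1 + pi. *)

(** * Ultrametric vector spaces *)

Section Power.
Import numFieldNormedType.Exports.

Lemma small_power (R : realType) (c e : R) :
  0 <= c -> c < 1 -> 0 < e -> exists n : nat, c ^+ n < e.
Proof.
move=> c0 c1 e0.
have cv : (fun n => c ^+ n) @ \oo --> (0 : R).
  by apply: cvg_expr; rewrite ger0_norm.
have /(_ _ e e0) := (@cvgrPdist_lt _ _ _ _ _ (fun n => c ^+ n) 0).1 cv.
move=> [n _ /(_ n (leqnn n))]; rewrite sub0r normrN ger0_norm ?exprn_ge0 //.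
by exists n.
Qed.

End Power.

Section Ultrametric.
Context {R : realType} {K : nonArchFieldType R}.
Implicit Types (x y s t : K) (r e : R).

Lemma nabs0 : nabs (0 : K) = 0.
Proof. exact/nabs_eq0. Qed.

Lemma nabs_gt0 t : (0 < nabs t) = (t != 0).
Proof.
rewrite lt_neqAle nabs_ge0 andbT eq_sym; congr negb.
by apply/eqP/eqP => [/nabs_eq0|->]; rewrite ?nabs0.
Qed.

Lemma nabs1 : nabs (1 : K) = 1.
Proof.
have := nabsM (1 : K) 1; rewrite mulr1 -{1}[nabs _]mulr1 => /mulfI -> //.
by rewrite gt_eqF // nabs_gt0 oner_neq0.
Qed.

Lemma nabsX t n : nabs (t ^+ n) = nabs t ^+ n.
Proof. by elim: n => [|n IH]; rewrite ?expr0 ?nabs1// !exprS nabsM IH. Qed.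

Lemma nabsV t : nabs t^-1 = (nabs t)^-1.
Proof.
have [->|t0] := eqVneq t 0; first by rewrite invr0 nabs0 invr0.
have nt0 : nabs t != 0 by rewrite gt_eqF // nabs_gt0.
by apply: (mulfI nt0); rewrite -nabsM !divff // nabs1.
Qed.

Lemma nabsD_le x y r : nabs x <= r -> nabs y <= r -> nabs (x + y) <= r.
Proof.
by move=> xr yr; apply: le_trans (nabs_ultra _ _) _; rewrite ge_max xr.
Qed.

Lemma nabsD_lt x y r : nabs x < r -> nabs y < r -> nabs (x + y) < r.
Proof.
by move=> xr yr; apply: le_lt_trans (nabs_ultra _ _) _; rewrite gt_max xr.
Qed.

(** The ultrametric triangle is isosceles. *)
Lemma nabsDl x y : nabs y < nabs x -> nabs (x + y) = nabs x.
Proof.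
move=> yx; apply/eqP; rewrite eq_le nabsD_le ?(ltW yx) //=.
rewrite leNgt; apply/negP => xyx.
have : nabs ((x + y) - y) < nabs x by rewrite nabsD_lt // nabsN.
by rewrite addrK ltxx.
Qed.

Lemma small_scalar : exists2 t : K, t != 0 & nabs t < 1.
Proof.
have [t [t0 t1]] := @nabs_nontriv R K.
have [tl|tg|/eqP] := ltgtP (nabs t) 1; [by exists t| |by rewrite (negbTE t1)].
by exists t^-1; rewrite ?invr_eq0 // nabsV invf_lt1 // nabs_gt0.
Qed.

Lemma small_scalar_lt e : 0 < e -> exists2 t : K, t != 0 & nabs t < e.
Proof.
move=> e0; have [t t0 t1] := small_scalar.
have [n tn] := small_power (nabs_ge0 t) t1 e0.
by exists (t ^+ n); rewrite ?expf_neq0 ?nabsX.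
Qed.

Lemma nbhs_nabsP x (A : set K) :
  nbhs x A <-> exists2 e : R, 0 < e & forall y, nabs (x - y) < e -> A y.
Proof. by rewrite nbhs_ballP. Qed.

Lemma nbhs0_neq0 (A : set K) : nbhs (0 : K) A -> exists2 t, t != 0 & A t.
Proof.
move=> /nbhs_nabsP [e e0 eA]; have [t t0 te] := small_scalar_lt e0.
by exists t => //; apply: eA; rewrite sub0r nabsN.
Qed.

(** ** Norm of vectors *)
Section Vector.
Variable d : nat.
Implicit Types u v w : 'rV[K]_d.

Lemma vnorm_ge0 v : 0 <= vnorm v.
Proof. by rewrite /vnorm; elim/big_ind: _ => // [a b a0 _|i _]; rewrite ?le_max ?a0 ?nabs_ge0. Qed.

Lemma nabs_vnorm v i : nabs (v 0 i) <= vnorm v.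
Proof. by rewrite /vnorm (bigD1 i) //= le_max lexx. Qed.

Lemma vnorm_leP v r : 0 <= r -> (forall i, nabs (v 0 i) <= r) -> vnorm v <= r.
Proof. by move=> r0 vr; rewrite /vnorm; elim/big_ind: _ => // a b; rewrite ge_max => -> ->. Qed.

Lemma vnorm_ltP v r : 0 < r -> (forall i, nabs (v 0 i) < r) -> vnorm v < r.
Proof. by move=> r0 vr; rewrite /vnorm; elim/big_ind: _ => // a b; rewrite gt_max => -> ->. Qed.

Lemma vnorm0 : vnorm (0 : 'rV[K]_d) = 0.
Proof. by apply/eqP; rewrite eq_le vnorm_ge0 andbT vnorm_leP // => i; rewrite mxE nabs0. Qed.

Lemma vnorm0_eq0 v : vnorm v <= 0 -> v = 0.
Proof.
move=> v0; apply/rowP => i; rewrite mxE; apply/nabs_eq0/eqP.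
by rewrite eq_le nabs_ge0 andbT (le_trans (nabs_vnorm v i)).
Qed.

Lemma vnormN v : vnorm (- v) = vnorm v.
Proof. by rewrite /vnorm; apply: eq_bigr => i _; rewrite mxE nabsN. Qed.

Lemma vnorm_distC v w : vnorm (v - w) = vnorm (w - v).
Proof. by rewrite -vnormN opprB. Qed.

Lemma vnormZ t v : vnorm (t *: v) = nabs t * vnorm v.
Proof.
apply/eqP; rewrite eq_le; apply/andP; split.
  apply: vnorm_leP => [|i]; first by rewrite mulr_ge0 ?nabs_ge0 ?vnorm_ge0.
  by rewrite mxE nabsM ler_wpM2l ?nabs_ge0 ?nabs_vnorm.
have [->|t0] := eqVneq t 0; first by rewrite nabs0 mul0r vnorm_ge0.
have t_gt0 : 0 < nabs t by rewrite nabs_gt0.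
rewrite mulrC -ler_pdivlMr //; apply: vnorm_leP => [|i].
  by rewrite divr_ge0 ?vnorm_ge0 ?nabs_ge0.
by rewrite ler_pdivlMr // mulrC -nabsM (le_trans _ (nabs_vnorm _ i)) // mxE.
Qed.

Lemma vnormD_le v w r : vnorm v <= r -> vnorm w <= r -> vnorm (v + w) <= r.
Proof.
move=> vr wr; apply: vnorm_leP => [|i]; first exact: le_trans (vnorm_ge0 v) vr.
by rewrite mxE nabsD_le ?(le_trans (nabs_vnorm _ i)).
Qed.

Lemma vnormD_lt v w r : vnorm v < r -> vnorm w < r -> vnorm (v + w) < r.
Proof.
move=> vr wr; apply: vnorm_ltP => [|i]; first exact: le_lt_trans (vnorm_ge0 v) vr.
by rewrite mxE nabsD_lt ?(le_lt_trans (nabs_vnorm _ i)).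
Qed.

Lemma vnormB_le v w r : vnorm v <= r -> vnorm w <= r -> vnorm (v - w) <= r.
Proof. by move=> vr wr; rewrite vnormD_le // vnormN. Qed.

Lemma vdist_lt v w u r : vnorm (v - w) < r -> vnorm (w - u) < r -> vnorm (v - u) < r.
Proof. by move=> vw wx; rewrite -(subrK w v) -addrA vnormD_lt. Qed.

Lemma vdist_le v w u r : vnorm (v - w) <= r -> vnorm (w - u) <= r -> vnorm (v - u) <= r.
Proof. by move=> vw wx; rewrite -(subrK w v) -addrA vnormD_le. Qed.

Lemma ball_vnormP v w e : 0 < e -> ball v e w <-> vnorm (v - w) < e.
Proof.
move=> e0; split=> [[_ vw]|vw].
  by apply: vnorm_ltP => // i; rewrite !mxE; exact: (vw 0 i).
split=> // i j; rewrite (ord1 i); change (nabs (v 0 j - w 0 j) < e).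
by apply: le_lt_trans vw; rewrite (le_trans _ (nabs_vnorm _ j)) // !mxE.
Qed.

Lemma nbhs_vnormP v (A : set 'rV[K]_d) :
  nbhs v A <-> exists2 e : R, 0 < e & forall w, vnorm (v - w) < e -> A w.
Proof.
rewrite nbhs_ballP; split=> [[e /= e0 eA]|[e e0 eA]]; exists e => // w.
  by move=> vw; apply: eA; exact/ball_vnormP.
by move=> /ball_vnormP-/(_ e0); exact: eA.
Qed.

End Vector.
End Ultrametric.

Section UltrametricTopology.
Context {R : realType} {K : nonArchFieldType R}.

Lemma cvg_vnormP (T : Type) (F : set_system T) {FF : Filter F} d
    (f : T -> 'rV[K]_d) (v : 'rV[K]_d) :
  f @ F --> v <-> forall e : R, 0 < e -> \forall x \near F, vnorm (v - f x) < e.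
Proof.
split=> [fv e e0|fv].
  have : nbhs v [set w | vnorm (v - w) < e] by apply/nbhs_vnormP; exists e.
  exact: fv.
move=> A /nbhs_vnormP [e e0 eA]; near=> x; apply: eA; near: x; exact: fv.
Unshelve. all: end_near. Qed.

Lemma cvg_nabsP (T : Type) (F : set_system T) {FF : Filter F} (f : T -> K) (v : K) :
  f @ F --> v <-> forall e : R, 0 < e -> \forall x \near F, nabs (v - f x) < e.
Proof.
split=> [fv e e0|fv].
  have : nbhs v [set w | nabs (v - w) < e] by apply/nbhs_nabsP; exists e.
  exact: fv.
move=> A /nbhs_nabsP [e e0 eA]; near=> x; apply: eA; near: x; exact: fv.
Unshelve. all: end_near. Qed.

Lemma nabs_hausdorff : hausdorff_space K.
Proof.
move=> x y xy; apply/eqP; apply: contraT => neq.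
have e0 : 0 < nabs (x - y) by rewrite nabs_gt0 subr_eq0.
have nx (z : K) : nbhs z [set w : K | nabs (z - w) < nabs (x - y)].
  by apply/nbhs_nabsP; exists (nabs (x - y)).
have [z [/= xz yz]] := xy _ _ (nx x) (nx y).
suff : nabs (x - y) < nabs (x - y) by rewrite ltxx.
by rewrite -{1}(subrK z x) -addrA nabsD_lt // -nabsN opprB.
Qed.

Lemma vnorm_hausdorff d : hausdorff_space 'rV[K]_d.
Proof.
move=> x y xy; apply/eqP; apply: contraT => neq.
have e0 : 0 < vnorm (x - y).
  by rewrite ltNge; apply: contra neq => /vnorm0_eq0/eqP; rewrite subr_eq0.
have nx (z : 'rV[K]_d) : nbhs z [set w : 'rV[K]_d | vnorm (z - w) < vnorm (x - y)].
  by apply/nbhs_vnormP; exists (vnorm (x - y)).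
have [z [/= xz yz]] := xy _ _ (nx x) (nx y).
suff : vnorm (x - y) < vnorm (x - y) by rewrite ltxx.
by apply: (vdist_lt xz); rewrite vnorm_distC.
Qed.

Lemma near_fst (T U : topologicalType) (x : T) (y : U) (A : set T) :
  nbhs x A -> nbhs (x, y) [set z : T * U | A z.1].
Proof. exact: (@cvg_fst T U (nbhs x) (nbhs y) _ A). Qed.

Lemma near_snd (T U : topologicalType) (x : T) (y : U) (A : set U) :
  nbhs y A -> nbhs (x, y) [set z : T * U | A z.2].
Proof. exact: (@cvg_snd T U (nbhs x) (nbhs y) _ A). Qed.

Lemma cvg_op2 (T A B C : topologicalType) (h : A * B -> C) (f : T -> A)
    (g : T -> B) (x : T) :
  f @ x --> f x -> g @ x --> g x -> h @ (f x, g x) --> h (f x, g x) ->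
  (fun y => h (f y, g y)) @ x --> h (f x, g x).
Proof.
move=> fx gx hx.
apply: (@cvg_comp _ _ _ (fun y => (f y, g y)) h (nbhs x) (nbhs (f x, g x))) => //.
exact: cvg_pair.
Qed.

Lemma cvg_const (T U : topologicalType) (x : T) (c : U) : (fun=> c) @ x --> c.
Proof. by move=> A /nbhs_singleton Ac; exact: (@filterS _ (nbhs x) _ setT _ (fun y _ => Ac) filterT). Qed.

Lemma near_nabs (x : K) e : 0 < e -> nbhs x [set y | nabs (x - y) < e].
Proof. by move=> e0; apply/nbhs_nabsP; exists e. Qed.

Lemma near_vnorm d (x : 'rV[K]_d) e : 0 < e -> nbhs x [set y | vnorm (x - y) < e].
Proof. by move=> e0; apply/nbhs_vnormP; exists e. Qed.

Lemma nabs_addC : continuous (fun xy : K * K => xy.1 + xy.2).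
Proof.
move=> [x y]; apply/cvg_nabsP => e e0.
apply: filterS2 (near_fst y (near_nabs x e0)) (near_snd x (near_nabs y e0)).
by move=> z /= zx zy; rewrite opprD addrACA nabsD_lt.
Qed.

Lemma vnorm_addC d : continuous (fun xy : 'rV[K]_d * 'rV[K]_d => xy.1 + xy.2).
Proof.
move=> [x y]; apply/cvg_vnormP => e e0.
apply: filterS2 (near_fst y (near_vnorm x e0)) (near_snd x (near_vnorm y e0)).
by move=> z /= zx zy; rewrite opprD addrACA vnormD_lt.
Qed.

Lemma vnorm_scaleC d : continuous (fun xy : K * 'rV[K]_d => xy.1 *: xy.2).
Proof.
move=> [x y]; apply/cvg_vnormP => e e0.
have y1 : 0 < vnorm y + 1 by rewrite ltr_wpDl // vnorm_ge0.
have x1 : 0 < nabs x + 1 by rewrite ltr_wpDl // nabs_ge0.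
have e1 : 0 < Num.min 1 (e / (vnorm y + 1)) by rewrite lt_min ltr01 divr_gt0.
apply: filterS2 (near_fst y (near_nabs x e1))
  (near_snd x (near_vnorm y (divr_gt0 e0 x1))) => z /=.
rewrite lt_min => /andP [zx1 zx] zy.
have -> : x *: y - z.1 *: z.2 = (x - z.1) *: y + z.1 *: (y - z.2).
  by rewrite scalerBl scalerBr addrA subrK.
rewrite vnormD_lt // vnormZ.
  rewrite ltr_pdivlMr // in zx; apply: le_lt_trans zx.
  by rewrite ler_wpM2l ?nabs_ge0 // lerDl.
have z1 : nabs z.1 <= nabs x + 1.
  rewrite -(subrK x z.1); apply: nabsD_le; last by rewrite lerDl.
  by rewrite -nabsN opprB (le_trans (ltW zx1)) // lerDr nabs_ge0.
rewrite ltr_pdivlMr // mulrC in zy; apply: le_lt_trans zy.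
by rewrite ler_wpM2r // vnorm_ge0.
Qed.

Lemma nabs_mulC : continuous (fun xy : K * K => xy.1 * xy.2).
Proof.
move=> [x y]; apply/cvg_nabsP => e e0.
have y1 : 0 < nabs y + 1 by rewrite ltr_wpDl // nabs_ge0.
have x1 : 0 < nabs x + 1 by rewrite ltr_wpDl // nabs_ge0.
have e1 : 0 < Num.min 1 (e / (nabs y + 1)) by rewrite lt_min ltr01 divr_gt0.
apply: filterS2 (near_fst y (near_nabs x e1))
  (near_snd x (near_nabs y (divr_gt0 e0 x1))) => z /=.
rewrite lt_min => /andP [zx1 zx] zy.
have -> : x * y - z.1 * z.2 = (x - z.1) * y + z.1 * (y - z.2).
  by rewrite mulrBl mulrBr addrA subrK.
rewrite nabsD_lt // nabsM.
  rewrite ltr_pdivlMr // in zx; apply: le_lt_trans zx.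
  by rewrite ler_wpM2l ?nabs_ge0 // lerDl.
have z1 : nabs z.1 <= nabs x + 1.
  rewrite -(subrK x z.1); apply: nabsD_le; last by rewrite lerDl.
  by rewrite -nabsN opprB (le_trans (ltW zx1)) // lerDr nabs_ge0.
rewrite ltr_pdivlMr // mulrC in zy; apply: le_lt_trans zy.
by rewrite ler_wpM2r // nabs_ge0.
Qed.

Lemma nabs_near_eq (x : K) : x != 0 -> \forall y \near x, nabs y = nabs x.
Proof.
move=> x0; apply/nbhs_nabsP; exists (nabs x); rewrite ?nabs_gt0 // => y xy.
by rewrite -[y](subrK x) addrC nabsDl // -nabsN opprB.
Qed.

Lemma nabs_invC (x : K) : x != 0 -> {for x, continuous (fun y : K => y^-1)}.
Proof.
move=> x0; apply/(@cvg_nabsP _ (nbhs x)) => e e0; near=> y.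
have yx : nabs y = nabs x by near: y; exact: nabs_near_eq.
have y0 : y != 0 by rewrite -nabs_gt0 yx nabs_gt0.
have -> : x^-1 - y^-1 = (y - x) / (x * y) by field; rewrite x0 y0.
rewrite nabsM nabsV nabsM yx -nabsN opprB ltr_pdivrMr ?mulr_gt0 ?nabs_gt0 //.
near: y; apply/nbhs_nabsP; exists (e * (nabs x * nabs x)) => //.
by rewrite !mulr_gt0 ?nabs_gt0.
Unshelve. all: end_near. Qed.

Lemma closed_nabs_le (r : R) : closed [set x : K | nabs x <= r].
Proof.
move=> x xr /=; rewrite leNgt; apply/negP => rx.
have x0 : x != 0.
  apply: contraTneq rx => ->; rewrite -leNgt.
  by have [y [/= yr _]] := xr _ filterT; rewrite nabs0 (le_trans (nabs_ge0 y)).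
have [y [/= yr yx]] := xr _ (nabs_near_eq x0).
by move: rx; rewrite -yx ltNge yr.
Qed.

Lemma cvg_coord (T : Type) (F : set_system T) {FF : Filter F} d
    (f : T -> 'rV[K]_d) (v : 'rV[K]_d) i : f @ F --> v -> (fun x => f x 0 i) @ F --> v 0 i.
Proof.
move=> /cvg_vnormP fv; apply/cvg_nabsP => e e0; apply: filterS (fv e e0) => x.
by apply: le_lt_trans; rewrite (le_trans _ (nabs_vnorm _ i)) // !mxE.
Qed.

Lemma closed_vnorm_le d (r : R) : closed [set x : 'rV[K]_d | vnorm x <= r].
Proof.
move=> x xr /=; have r0 : 0 <= r.
  by have [y [/= yr _]] := xr _ filterT; exact: le_trans (vnorm_ge0 y) yr.
apply: vnorm_leP => // i; apply: (@closed_nabs_le r) => A xA.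
have : nbhs x [set y : 'rV[K]_d | A (y 0 i)].
  by have := @cvg_coord _ (nbhs x) _ d id x i (@cvg_id _ _); apply.
move=> /xr [y [/= yr yA]]; exists (y 0 i); split=> //=.
exact: le_trans (nabs_vnorm y i) yr.
Qed.

Hypothesis K_lc : locally_compact [set: K].

Lemma compact_nabs_le (r : R) : compact [set x : K | nabs x <= r].
Proof.
have [B] := K_lc (I : [set: K] 0); rewrite withinET => B0 [cB clB].
have [e e0 eB] := (@nbhs_nabsP _ _ _ _).1 B0.
have [t t0 te] : exists2 t : K, t != 0 & nabs t * r < e.
  have r1 : 0 < Num.max r 1 by rewrite lt_max ltr01 orbT.
  have [t t0 te] := @small_scalar_lt _ K _ (divr_gt0 e0 r1).
  exists t => //; rewrite ltr_pdivlMr // in te; apply: le_lt_trans te.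
  by rewrite ler_wpM2l ?nabs_ge0 // le_max lexx.
have cimg : compact ((fun x => t^-1 * x) @` B).
  apply: continuous_compact => //; apply: continuous_subspaceT => x.
  apply: (@cvg_op2 _ _ _ _ (fun xy : K * K => xy.1 * xy.2) (fun=> t^-1) id).
  - exact: cvg_const.
  - exact: cvg_id.
  - exact: nabs_mulC.
apply: (subclosed_compact _ cimg); first exact: closed_nabs_le.
move=> x /= xr; exists (t * x); rewrite ?mulKf //; apply: eB.
rewrite sub0r nabsN nabsM; apply: le_lt_trans te.
by rewrite ler_wpM2l ?nabs_ge0.
Qed.

Lemma compact_vnorm_le d (r : R) : compact [set x : 'rV[K]_d | vnorm x <= r].
Proof.
pose pK : ptopologicalType := HB.pack (NonArchField.sort K) (isPointed.Build K 0).
have cube := @rV_compact pK d _ (fun=> @compact_nabs_le r).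
apply: (subclosed_compact _ cube); first exact: closed_vnorm_le.
by move=> x /= xr i; exact: le_trans (nabs_vnorm x i) xr.
Qed.

Lemma compact_vbounded d (A : set 'rV[K]_d) (r : R) :
  closed A -> (forall x, A x -> vnorm x <= r) -> compact A.
Proof. by move=> cA Ar; apply: (subclosed_compact cA (@compact_vnorm_le d r)). Qed.

End UltrametricTopology.

Section ProductTopology.

Lemma hausdorff_prod (A B : topologicalType) :
  hausdorff_space A -> hausdorff_space B -> hausdorff_space (A * B)%type.
Proof.
move=> hA hB [a b] [a' b'] cl; congr pair.
  apply: hA => U V Ua Va; have [[x y] [/= Ux Vx]] := cl _ _ (near_fst b Ua) (near_fst b' Va).
  by exists x.
apply: hB => U V Ub Vb; have [[x y] [/= Ux Vx]] := cl _ _ (near_snd a Ub) (near_snd a' Vb).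
by exists y.
Qed.

Lemma cvg_pair2 (T A B : topologicalType) (f : T -> A) (g : T -> B) (x : T) :
  f @ x --> f x -> g @ x --> g x -> (fun y => (f y, g y)) @ x --> (f x, g x).
Proof. by move=> fx gx; exact: cvg_pair. Qed.

Lemma cont_fst (A B : topologicalType) : continuous (@fst A B).
Proof. by move=> [x y]; exact: cvg_fst. Qed.

Lemma cont_snd (A B : topologicalType) : continuous (@snd A B).
Proof. by move=> [x y]; exact: cvg_snd. Qed.

Lemma cont_comp (A B C : topologicalType) (f : A -> B) (g : B -> C) :
  continuous f -> continuous g -> continuous (g \o f).
Proof. by move=> cf cg x; apply: continuous_comp; [exact: cf|exact: cg]. Qed.

Lemma cont_pair (T A B : topologicalType) (f : T -> A) (g : T -> B) :
  continuous f -> continuous g -> continuous (fun y => (f y, g y)).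
Proof. by move=> cf cg x; apply: cvg_pair2; [exact: cf|exact: cg]. Qed.

Lemma cont_op2 (T A B C : topologicalType) (h : A -> B -> C) (f : T -> A) (g : T -> B) :
  continuous (fun z : A * B => h z.1 z.2) -> continuous f -> continuous g ->
  continuous (fun y => h (f y) (g y)).
Proof. by move=> ch cf cg; exact: (cont_comp (cont_pair cf cg) ch). Qed.

Lemma cont_fstc (T A B : topologicalType) (f : T -> A * B) :
  continuous f -> continuous (fun x => (f x).1).
Proof. by move=> cf; exact: (cont_comp cf (@cont_fst _ _)). Qed.

Lemma cont_sndc (T A B : topologicalType) (f : T -> A * B) :
  continuous f -> continuous (fun x => (f x).2).
Proof. by move=> cf; exact: (cont_comp cf (@cont_snd _ _)). Qed.

End ProductTopology.

Ltac cont_proj :=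
  repeat first [exact: cont_fst | exact: cont_snd | apply: cont_pair |
    apply: cont_fstc | apply: cont_sndc].

(** * Spaces with increments *)

Section Objects.
Context {R : realType} {K : nonArchFieldType R}.

(** A topological module, with its operations as fields: the spaces of arguments of
    the difference quotients are iterated products, to be modules up to conversion. *)
Record tmod (V : topologicalType) := TMod {
  tz : V; ta : V -> V -> V; ts : K -> V -> V;
  taA : associative ta; taC : commutative ta; ta0 : left_id tz ta;
  tsDr : forall t, {morph ts t : v w / ta v w};
  tsDl : forall s t v, ts (s + t) v = ta (ts s v) (ts t v);
  tsA : forall s t v, ts s (ts t v) = ts (s * t) v;
  ts1 : forall v, ts 1 v = v; ts0 : forall v, ts 0 v = tz;
  ta_cont : continuous (fun vw : V * V => ta vw.1 vw.2);
  ts_cont : continuous (fun tv : K * V => ts tv.1 tv.2);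
  t_haus : hausdorff_space V }.

Lemma ta_inj V (m : tmod V) v : injective (ta m v).
Proof.
have vv : ta m (ts m (-1) v) v = tz m by rewrite -{2}(ts1 m v) -tsDl addNr ts0.
by move=> w u /(congr1 (ta m (ts m (-1) v))); rewrite !taA vv !ta0.
Qed.

Lemma tsz V (m : tmod V) t : ts m t (tz m) = tz m.
Proof. by rewrite -(ts0 m (tz m)) tsA mulr0. Qed.

Lemma ta0r V (m : tmod V) v : ta m v (tz m) = v.
Proof. by rewrite taC ta0. Qed.

Definition rV_tmod d : tmod 'rV[K]_d.
Proof.
refine (@TMod 'rV[K]_d 0 (fun v w => v + w) (fun t v => t *: v)
  (@addrA _) (@addrC _) (@add0r _) _ _ _ _ _ _ _ _).
- abstract (by move=> t v w; rewrite scalerDr).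
- abstract (by move=> s t v; rewrite scalerDl).
- abstract (by move=> s t v; rewrite scalerA).
- abstract (exact: scale1r).
- abstract (exact: scale0r).
- abstract (exact: vnorm_addC).
- abstract (exact: vnorm_scaleC).
- abstract (exact: vnorm_hausdorff).
Defined.

Definition K_tmod : tmod K.
Proof.
refine (@TMod K 0 (fun v w => v + w) (fun t v => t * v)
  (@addrA _) (@addrC _) (@add0r _) _ _ _ _ _ _ _ _).
- abstract (by move=> t v w; rewrite mulrDr).
- abstract (by move=> s t v; rewrite mulrDl).
- abstract (by move=> s t v; rewrite mulrA).
- abstract (exact: mul1r).
- abstract (exact: mul0r).
- abstract (exact: nabs_addC).
- abstract (exact: nabs_mulC).
- abstract (exact: nabs_hausdorff).
Defined.

Definition prod_tmod A B (m : tmod A) (n : tmod B) : tmod (A * B)%type.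
Proof.
refine (@TMod (A * B)%type (tz m, tz n) (fun v w => (ta m v.1 w.1, ta n v.2 w.2))
  (fun t v => (ts m t v.1, ts n t v.2)) _ _ _ _ _ _ _ _ _ _ _).
- abstract (by move=> v w u; rewrite !taA).
- abstract (by move=> v w; rewrite (taC m) (taC n)).
- abstract (by move=> [v w]; rewrite !ta0).
- abstract (by move=> t v w; rewrite !tsDr).
- abstract (by move=> s t v; rewrite !tsDl).
- abstract (by move=> s t v; rewrite !tsA).
- abstract (by move=> [v w]; rewrite !ts1).
- abstract (by move=> v; rewrite !ts0).
- abstract (by apply: cont_pair; [apply: (cont_op2 (@ta_cont _ m))|
    apply: (cont_op2 (@ta_cont _ n))]; cont_proj).
- abstract (by apply: cont_pair; [apply: (cont_op2 (@ts_cont _ m))|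
    apply: (cont_op2 (@ts_cont _ n))]; cont_proj).
- abstract (by apply: hausdorff_prod; exact: t_haus).
Defined.

(** A space on which a module of increments acts freely. The increments may be a
    proper part of the space: the other variables are then frozen, and behave as
    parameters in all difference quotients. *)
Record obj := Obj {
  pt :> topologicalType; inc : topologicalType; im : tmod inc;
  ac : pt -> inc -> pt;
  acA : forall x v w, ac x (ta im v w) = ac (ac x v) w;
  ac0 : forall x, ac x (tz im) = x;
  ac_inj : forall x, injective (ac x);
  ac_cont : continuous (fun xv : pt * inc => ac xv.1 xv.2);
  pt_haus : hausdorff_space pt }.

Definition sh (X : obj) (x : X) (v : inc X) (t : K) : X := ac x (ts (im X) t v).

Lemma sh0 (X : obj) (x : X) v : sh x v 0 = x.
Proof. by rewrite /sh ts0 ac0. Qed.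

Lemma acAC (X : obj) (x : X) v w : ac (ac x v) w = ac (ac x w) v.
Proof. by rewrite -!acA taC. Qed.

Definition vec V (m : tmod V) : obj.
Proof.
refine (@Obj V V m (ta m) _ _ _ _ _).
- abstract (by move=> x v w; rewrite taA).
- abstract (exact: ta0r).
- abstract (exact: ta_inj).
- abstract (exact: ta_cont).
- abstract (exact: t_haus m).
Defined.

Lemma rV0_eq (v w : 'rV[K]_0) : v = w.
Proof. by apply/rowP => -[]. Qed.

Definition prodo (X Y : obj) : obj.
Proof.
refine (@Obj (X * Y)%type (inc X * inc Y)%type (prod_tmod (im X) (im Y))
  (fun x v => (ac x.1 v.1, ac x.2 v.2)) _ _ _ _ _).
- abstract (by move=> x v w; rewrite !acA).
- abstract (by move=> [x y]; rewrite !ac0).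
- abstract (by move=> [x y] [v w] [v' w'] [/= /ac_inj-> /ac_inj->]).
- abstract (by apply: cont_pair; [apply: (cont_op2 (@ac_cont X))|
    apply: (cont_op2 (@ac_cont Y))]; cont_proj).
- abstract (by apply: hausdorff_prod; exact: pt_haus).
Defined.

(** A product with a space of parameters. *)
Definition paro (S : topologicalType) (hS : hausdorff_space S) (X : obj) : obj.
Proof.
refine (@Obj (S * X)%type (inc X) (im X) (fun x v => (x.1, ac x.2 v)) _ _ _ _ _).
- abstract (by move=> x v w; rewrite !acA).
- abstract (by move=> [x y]; rewrite !ac0).
- abstract (by move=> [x y] v w [/= /ac_inj]).
- abstract (by apply: cont_pair; [cont_proj|apply: (cont_op2 (@ac_cont X)); cont_proj]).
- abstract (by apply: hausdorff_prod => //; exact: pt_haus).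
Defined.

(** Maps which send increments linearly to increments. By the last condition the
    linear part does not vary along increments, so that it is the difference quotient
    of the map and is again a map of this kind. *)
Record lin (X Y : obj) (f : X -> Y) (l : X -> inc X -> inc Y) : Prop := Lin {
  lin_cont : continuous f;
  lin_dcont : continuous (fun xv : X * inc X => l xv.1 xv.2);
  lin_ac : forall x v, f (ac x v) = ac (f x) (l x v);
  lin_add : forall x v w, l x (ta (im X) v w) = ta (im Y) (l x v) (l x w);
  lin_sc : forall x t v, l x (ts (im X) t v) = ts (im Y) t (l x v);
  lin_inv : forall x v w, l (ac x v) w = l x w }.

Lemma lin_sh (X Y : obj) (f : X -> Y) l : lin f l ->
  forall x v t, f (sh x v t) = sh (f x) (l x v) t.
Proof. by move=> lf x v t; rewrite /sh (lin_ac lf) (lin_sc lf). Qed.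

Lemma lin_comp (X Y Z : obj) (f : X -> Y) l (g : Y -> Z) m : lin f l -> lin g m ->
  lin (g \o f) (fun x v => m (f x) (l x v)).
Proof.
move=> lf lg; split.
- exact: (cont_comp (lin_cont lf) (lin_cont lg)).
- apply: (cont_op2 (lin_dcont lg)); last exact: (lin_dcont lf).
  by apply: cont_comp; [exact: cont_fst|exact: (lin_cont lf)].
- by move=> x v; rewrite /= (lin_ac lf) (lin_ac lg).
- by move=> x v w; rewrite (lin_add lf) (lin_add lg).
- by move=> x t v; rewrite (lin_sc lf) (lin_sc lg).
- by move=> x v w; rewrite (lin_inv lf) (lin_ac lf) (lin_inv lg).
Qed.

Lemma lin_pair (X Y Z : obj) (f : X -> Y) l (g : X -> Z) m : lin f l -> lin g m ->
  @lin X (prodo Y Z) (fun x => (f x, g x)) (fun x v => (l x v, m x v)).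
Proof.
move=> lf lg; split => /=.
- exact: (cont_pair (lin_cont lf) (lin_cont lg)).
- exact: (cont_pair (lin_dcont lf) (lin_dcont lg)).
- by move=> x v; rewrite (lin_ac lf) (lin_ac lg).
- by move=> x v w; rewrite (lin_add lf) (lin_add lg).
- by move=> x t v; rewrite (lin_sc lf) (lin_sc lg).
- by move=> x v w; rewrite (lin_inv lf) (lin_inv lg).
Qed.

Lemma lin_id (X : obj) : @lin X X id (fun _ v => v).
Proof. by split => //; [move=> x; exact: cvg_id|exact: cont_snd]. Qed.

Lemma lin_fst (X Y : obj) : @lin (prodo X Y) X fst (fun _ v => v.1).
Proof.
by split => //; [exact: cont_fst|apply: cont_comp; [exact: cont_snd|exact: cont_fst]].
Qed.

Lemma lin_snd (X Y : obj) : @lin (prodo X Y) Y snd (fun _ v => v.2).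
Proof. by split => //; [exact: cont_snd|apply: cont_comp; exact: cont_snd]. Qed.

(** The action of the increments is itself a morphism, on variable increments. *)
Lemma lin_act (X : obj) :
  @lin (prodo X (vec (im X))) X (fun y => ac y.1 y.2) (fun _ w => ta (im X) w.1 w.2).
Proof.
split => //=.
- exact: ac_cont.
- by apply: (cont_op2 (@ta_cont _ (im X))); apply: cont_comp;
    try exact: cont_snd; exact: cont_fst.
- by move=> [x v] [w u] /=; rewrite !acA (acAC x).
- by move=> _ [v v'] [w w'] /=; rewrite -!taA (taA _ w) (taC _ w) -!taA.
- by move=> _ t [v w] /=; rewrite tsDr.
Qed.

End Objects.

(** * Prolongations and classes of maps *)

Section Rules.
Context {R : realType} {K : nonArchFieldType R}.
Notation obj := (@obj R K).

(** The space of arguments (x, v, t) of the difference quotients on X; the rules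
    differ by the increments that they allow in these arguments. *)
Record rule := Rule {
  To : obj -> obj;
  rb : forall X : obj, To X -> X;
  rv : forall X : obj, To X -> inc X;
  rt : forall X : obj, To X -> K;
  rmk : forall X : obj, X -> inc X -> K -> To X;
  rbK : forall (X : obj) (x : X) v t, rb (rmk x v t) = x;
  rvK : forall (X : obj) (x : X) v t, rv (rmk x v t) = v;
  rtK : forall (X : obj) (x : X) v t, rt (rmk x v t) = t;
  rmkK : forall (X : obj) (y : To X), rmk (rb y) (rv y) (rt y) = y;
  rb_cont : forall X : obj, continuous (@rb X);
  rv_cont : forall X : obj, continuous (@rv X);
  rt_cont : forall X : obj, continuous (@rt X);
  rmk_cont : forall X : obj, continuous (fun z : X * inc X * K => rmk z.1.1 z.1.2 z.2) }.

Section Classes.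
Variable r : rule.
Local Notation T := (To r).
Local Notation rb := (rb (r := r)).
Local Notation rv := (rv (r := r)).
Local Notation rt := (rt (r := r)).

Definition Tset (X : obj) (D : set X) : set (T X) :=
  [set y | D (rb y) /\ D (sh (rb y) (rv y) (rt y))].

(** The prolongation of f by its difference quotient df; a composite prolongs to the
    composite of the prolongations. *)
Definition Tmap (X Y : obj) (f : X -> Y) (df : T X -> inc Y) (y : T X) : T Y :=
  rmk r (f (rb y)) (df y) (rt y).

Definition cont_on (A B : topologicalType) (D : set A) (f : A -> B) :=
  forall x, D x -> f @ x --> f x.

(** Continuity of the iterated prolongations up to order n. As whole prolongations are
    iterated, and not only quotients, this class is stable under composition by
    functoriality. *)
Fixpoint Cr (n : nat) (X Y : obj) (D : set X) (f : X -> Y) : Prop :=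
  if n is n'.+1 then
    cont_on D f /\ exists df : T X -> inc Y,
     (forall y, Tset D y -> f (sh (rb y) (rv y) (rt y)) = sh (f (rb y)) (df y) (rt y)) /\
     Cr n' (X := T X) (Y := T Y) (Tset D) (Tmap f df)
  else cont_on D f.

(** For vector valued maps it is enough to iterate the quotient itself, as in the
    definitions of C^n and C^[n]. *)
Fixpoint Br (n : nat) (X : obj) e (D : set X) (f : X -> 'rV[K]_e) : Prop :=
  if n is n'.+1 then
    cont_on D f /\ exists df : T X -> 'rV[K]_e,
     (forall y, Tset D y -> f (sh (rb y) (rv y) (rt y)) = f (rb y) + (rt y) *: df y) /\
     Br n' (X := T X) (Tset D) df
  else cont_on D f.

Lemma cont_sh (X : obj) : continuous (fun y : T X => sh (rb y) (rv y) (rt y)).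
Proof.
apply: (cont_op2 (@ac_cont _ _ X)); first exact: rb_cont.
by apply: (cont_op2 (@ts_cont _ _ _ (im X))); [exact: rt_cont|exact: rv_cont].
Qed.

Lemma Tset_map (X Y : obj) (D : set X) (E : set Y) (f : X -> Y) (df : T X -> inc Y) :
  (forall x, D x -> E (f x)) ->
  (forall y, Tset D y -> f (sh (rb y) (rv y) (rt y)) = sh (f (rb y)) (df y) (rt y)) ->
  forall y, Tset D y -> Tset E (Tmap f df y).
Proof.
move=> DE fE y Dy; rewrite /Tset /Tmap /= !(rbK, rvK, rtK) -fE //.
by split; apply: DE; case: Dy.
Qed.

Lemma Tset_open (X : obj) (D : set X) : open D -> open (Tset D).
Proof.
move=> oD; apply: openI.
  by apply: (@open_comp _ _ (fun y : T X => rb y)) => // y _; exact: rb_cont.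
by apply: (@open_comp _ _ (fun y : T X => sh (rb y) (rv y) (rt y))) => // y _; exact: cont_sh.
Qed.

Lemma cont_on_sub (A B : topologicalType) (D E : set A) (f : A -> B) :
  E `<=` D -> cont_on D f -> cont_on E f.
Proof. by move=> ED cf x /ED /cf. Qed.

Lemma cont_on_comp (A B C : topologicalType) (D : set A) (E : set B)
    (f : A -> B) (g : B -> C) : (forall x, D x -> E (f x)) ->
  cont_on D f -> cont_on E g -> cont_on D (g \o f).
Proof. by move=> DE cf cg x Dx; apply: continuous_comp; [exact: cf|exact/cg/DE]. Qed.

Lemma cont_on_pair (T A B : topologicalType) (D : set T) (f : T -> A) (g : T -> B) :
  cont_on D f -> cont_on D g -> cont_on D (fun y => (f y, g y)).
Proof. by move=> cf cg x Dx; apply: cvg_pair2; [exact: cf|exact: cg]. Qed.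

Lemma cont_on_eq (A B : topologicalType) (D : set A) (f g : A -> B) : open D ->
  (forall x, D x -> f x = g x) -> cont_on D f -> cont_on D g.
Proof.
move=> oD fg cf x Dx; rewrite -(fg x Dx); apply: cvg_trans (cf x Dx).
apply: near_eq_cvg; near=> y; apply: fg; near: y.
exact: open_nbhs_nbhs.
Unshelve. all: end_near. Qed.

Lemma Tset_sub (X : obj) (D E : set X) : E `<=` D -> Tset E `<=` Tset D.
Proof. by move=> ED y [/ED ? /ED ?]. Qed.

Lemma Cr_cont n (X Y : obj) D (f : X -> Y) : Cr n D f -> cont_on D f.
Proof. by case: n => [|n] // []. Qed.

Lemma Br_cont n (X : obj) e D (f : X -> 'rV[K]_e) : Br n D f -> cont_on D f.
Proof. by case: n => [|n] // []. Qed.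

Lemma BrW n (X : obj) e D (f : X -> 'rV[K]_e) : Br n.+1 D f -> Br n D f.
Proof.
elim: n X D f => [|n IH] X D f; first exact: Br_cont.
by move=> [cf [df [fE /IH cdf]]]; split=> //; exists df.
Qed.

Lemma Cr_sub n (X Y : obj) (D E : set X) (f : X -> Y) :
  E `<=` D -> Cr n D f -> Cr n E f.
Proof.
elim: n X Y D E f => [|n IH] X Y D E f ED; first exact: cont_on_sub.
move=> [cf [df [fE cdf]]]; split; first exact: cont_on_sub cf.
exists df; split; first by move=> y /(Tset_sub ED) /fE.
by apply: IH cdf; exact: Tset_sub.
Qed.

Lemma Br_sub n (X : obj) e (D E : set X) (f : X -> 'rV[K]_e) :
  E `<=` D -> Br n D f -> Br n E f.
Proof.
elim: n X D E f => [|n IH] X D E f ED; first exact: cont_on_sub.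
move=> [cf [df [fE cdf]]]; split; first exact: cont_on_sub cf.
exists df; split; first by move=> y /(Tset_sub ED) /fE.
by apply: IH cdf; exact: Tset_sub.
Qed.

Lemma Cr_eq n (X Y : obj) (D : set X) (f g : X -> Y) : open D ->
  (forall x, D x -> f x = g x) -> Cr n D f -> Cr n D g.
Proof.
elim: n X Y D f g => [|n IH] X Y D f g oD fg; first exact: cont_on_eq.
move=> [cf [df [fE cdf]]]; split; first exact: cont_on_eq cf.
exists df; split; first by move=> y [Dx Dy]; rewrite -!fg // fE.
by apply: IH cdf; [exact: Tset_open|move=> y [Dx _]; rewrite /Tmap fg].
Qed.

Lemma Br_eq n (X : obj) e (D : set X) (f g : X -> 'rV[K]_e) : open D ->
  (forall x, D x -> f x = g x) -> Br n D f -> Br n D g.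
Proof.
case: n => [|n] oD fg; first exact: cont_on_eq.
move=> [cf [df [fE cdf]]]; split; first exact: cont_on_eq cf.
by exists df; split => // y [Dx Dy]; rewrite -!fg // fE.
Qed.

(** The chain rule: the quotient of g o f at y is the quotient of g at the prolonged
    point (f, df, t). *)
Lemma Cr_comp n (X Y Z : obj) (D : set X) (E : set Y) (f : X -> Y) (g : Y -> Z) :
  (forall x, D x -> E (f x)) -> Cr n D f -> Cr n E g -> Cr n D (g \o f).
Proof.
elim: n X Y Z D E f g => [|n IH] X Y Z D E f g DE; first exact: cont_on_comp.
move=> [cf [df [fE cdf]]] [cg [dg [gE cdg]]]; split.
  exact: cont_on_comp cf cg.
have TDE := Tset_map DE fE.
exists (dg \o Tmap f df); split.
  move=> y Dy /=; rewrite fE //.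
  by have := gE _ (TDE _ Dy); rewrite /Tmap !(rbK, rvK, rtK).
have -> : Tmap (g \o f) (dg \o Tmap f df) = Tmap g dg \o Tmap f df.
  by apply/funext => y; rewrite /Tmap /= !(rbK, rvK, rtK).
exact: IH TDE cdf cdg.
Qed.

Definition functorial := forall (X Y : obj) (f : X -> Y) l, lin f l ->
  exists m, @lin _ _ (T X) (T Y) (Tmap f (fun y => l (rb y) (rv y))) m.

Hypothesis Tlin : functorial.

Lemma Cr_lin n (X Y : obj) (f : X -> Y) l D : lin f l -> Cr n D f.
Proof.
elim: n X Y f l D => [|n IH] X Y f l D lf; first by move=> x _; exact: (lin_cont lf).
split; first by move=> x _; exact: (lin_cont lf).
have [m lTf] := Tlin lf.
exists (fun y => l (rb y) (rv y)); split; last exact: IH lTf.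
by move=> y _; rewrite (lin_sh lf).
Qed.

Lemma Br_lin n (X Y : obj) e (D : set X) (E : set Y) (f : X -> Y) l (g : Y -> 'rV[K]_e) :
  (forall x, D x -> E (f x)) -> lin f l -> Br n E g -> Br n D (g \o f).
Proof.
elim: n X Y D E f l g => [|n IH] X Y D E f l g DE lf.
  by apply: cont_on_comp DE _ => x _; exact: (lin_cont lf).
move=> [cg [dg [gE cdg]]]; split.
  by apply: cont_on_comp DE _ cg => x _; exact: (lin_cont lf).
have [m lTf] := Tlin lf.
have TDE := Tset_map (df := fun y => l (rb y) (rv y)) DE (fun y _ => lin_sh lf _ _ _).
exists (dg \o Tmap f (fun y => l (rb y) (rv y))); split; last exact: IH TDE lTf cdg.
move=> y Dy /=; rewrite (lin_sh lf).
by have := gE _ (TDE _ Dy); rewrite /Tmap !(rbK, rvK, rtK).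
Qed.

Lemma Br_add n (X : obj) e (D : set X) (f g : X -> 'rV[K]_e) :
  Br n D f -> Br n D g -> Br n D (fun x => f x + g x).
Proof.
have cont_add (A : topologicalType) (D' : set A) (u v : A -> 'rV[K]_e) :
    cont_on D' u -> cont_on D' v -> cont_on D' (fun x => u x + v x).
  move=> cu cv x Dx.
  apply: (@cvg_op2 _ _ _ _ (fun z : 'rV[K]_e * 'rV[K]_e => z.1 + z.2)).
  - exact: cu.
  - exact: cv.
  - exact: vnorm_addC.
elim: n X D f g => [|n IH] X D f g; first exact: cont_add.
move=> [cf [df [fE cdf]]] [cg [dg [gE cdg]]]; split; first exact: cont_add.
exists (fun y => df y + dg y); split; last exact: IH.
by move=> y Dy; rewrite fE // gE // scalerDr addrACA.
Qed.

Definition has_proj := forall X : obj, exists l, @lin _ _ (T X) X (fun y => (rb y)) l.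

Hypothesis Tproj : has_proj.

(** A factor which is invariant under increments comes out of the quotient. *)
Lemma Br_scale_inv n (X : obj) e (D : set X) (c : X -> K) (f : X -> 'rV[K]_e) :
  cont_on D c -> (forall x v, c (ac x v) = c x) -> Br n D f ->
  Br n D (fun x => c x *: f x).
Proof.
have cont_scale (A : topologicalType) (D' : set A) (u : A -> K) (v : A -> 'rV[K]_e) :
    cont_on D' u -> cont_on D' v -> cont_on D' (fun x => u x *: v x).
  move=> cu cv x Dx.
  apply: (@cvg_op2 _ _ _ _ (fun z : K * 'rV[K]_e => z.1 *: z.2)).
  - exact: cu.
  - exact: cv.
  - exact: vnorm_scaleC.
elim: n X D c f => [|n IH] X D c f cc ci; first exact: cont_scale.
move=> [cf [df [fE cdf]]]; split; first exact: cont_scale.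
exists (fun y => c (rb y) *: df y); split.
  by move=> y Dy; rewrite fE // {1}/sh ci scalerDr !scalerA mulrC.
have [l lpr] := Tproj X.
apply: IH cdf => [|x v]; last by have := lin_ac lpr x v => /= ->; rewrite ci.
apply: (@cont_on_comp _ _ _ _ D (fun y : T X => rb y)) cc; first by move=> y [].
by move=> y _; exact: (lin_cont lpr).
Qed.

End Classes.

End Rules.

(** * The difference quotients of the classes C^[n] and C^n *)

Section ConcreteRules.
Context {R : realType} {K : nonArchFieldType R}.
Notation obj := (@obj R K).

Definition scal_inc (b : bool) : topologicalType :=
  if b then (K : topologicalType) else ('rV[K]_0 : topologicalType).

Definition scal_mod (b : bool) : @tmod R K (scal_inc b) :=
  match b with true => K_tmod | false => rV_tmod 0 end.

Definition scal_ac (b : bool) : K -> scal_inc b -> K :=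
  match b with true => fun x v => x + v | false => fun x _ => x end.

(** The scalar of a difference quotient: a variable for the bracketed classes,
    a parameter for the iterated ones. *)
Definition scal (b : bool) : obj.
Proof.
refine (@Obj R K K (scal_inc b) (scal_mod b) (@scal_ac b) _ _ _ _ _).
- abstract (by case: b => //= x v w; rewrite addrA).
- abstract (by case: b => //= x; rewrite addr0).
- abstract (by case: b => /= x v w; [exact: addrI|move=> _; exact: rV0_eq]).
- abstract (by case: b; [exact: nabs_addC|exact: cont_fst]).
- abstract (exact: nabs_hausdorff).
Defined.

Definition Tprod b (X : obj) := prodo (prodo X (vec (im X))) (scal b).

(** Quotients in which the vectors are variables, and the scalars are variables
    (b = true) or parameters (b = false). *)
Definition drule (b : bool) : @rule R K.
Proof.
refine (@Rule R K (Tprod b) (fun X y => y.1.1) (fun X y => y.1.2) (fun X y => y.2)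
  (fun X x v t => (x, v, t)) _ _ _ _ _ _ _ _) => //.
- abstract (by move=> X [[]]).
- abstract (by move=> X; cont_proj).
- abstract (by move=> X; cont_proj).
- abstract (by move=> X; cont_proj).
- abstract (by move=> X; cont_proj).
Defined.

Definition Titer (X : obj) : obj.
Proof.
refine (@Obj R K (X * inc X * K)%type (inc X) (im X)
  (fun y w => (ac y.1.1 w, y.1.2, y.2)) _ _ _ _ _).
- abstract (by move=> y v w; rewrite acA).
- abstract (by move=> [[x v] t]; rewrite ac0).
- abstract (by move=> [[x v] t] w u [/= /ac_inj]).
- abstract (by apply: cont_pair; [apply: cont_pair|];
    first (apply: (cont_op2 (@ac_cont _ _ X))); cont_proj).
- abstract (by apply: hausdorff_prod; [apply: hausdorff_prod;
    [exact: pt_haus|exact: t_haus (im X)]|exact: nabs_hausdorff]).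
Defined.

(** Quotients in which only the base point is a variable. *)
Definition irule : @rule R K.
Proof.
refine (@Rule R K Titer (fun X y => y.1.1) (fun X y => y.1.2) (fun X y => y.2)
  (fun X x v t => (x, v, t)) _ _ _ _ _ _ _ _) => //.
- abstract (by move=> X [[]]).
- abstract (by move=> X; cont_proj).
- abstract (by move=> X; cont_proj).
- abstract (by move=> X; cont_proj).
- abstract (by move=> X; cont_proj).
Defined.

Lemma lin_deriv (X Y : obj) (f : X -> Y) l : lin f l ->
  @lin _ _ (prodo X (vec (im X))) (vec (im Y)) (fun y => l y.1 y.2)
    (fun y w => l y.1 w.2).
Proof.
move=> lf; split => /=.
- exact: (lin_dcont lf).
- by apply: (cont_op2 (lin_dcont lf)); cont_proj.
- by move=> [x v] [w u] /=; rewrite (lin_inv lf) (lin_add lf).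
- by move=> [x v] [w u] [w' u'] /=; rewrite (lin_add lf).
- by move=> [x v] t [w u] /=; rewrite (lin_sc lf).
- by move=> [x v] [w u] [w' u'] /=; rewrite (lin_inv lf).
Qed.

Lemma drule_functorial b : functorial (drule b).
Proof.
move=> X Y f l lf.
have base := lin_fst (prodo X (vec (im X))) (scal b).
have lt := lin_snd (prodo X (vec (im X))) (scal b).
have lTf := lin_pair (lin_pair (lin_comp (lin_comp base (lin_fst _ _)) lf)
  (lin_comp base (lin_deriv lf))) lt.
eexists; exact: lTf.
Qed.

Lemma irule_functorial : functorial irule.
Proof.
move=> X Y f l lf; exists (fun y w => l y.1.1 w); split => /=.
- apply: cont_pair; last exact: cont_snd.
  apply: cont_pair; last by apply: (cont_op2 (lin_dcont lf)); cont_proj.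
  by apply: (cont_comp _ (lin_cont lf)); cont_proj.
- by apply: (cont_op2 (lin_dcont lf)); cont_proj.
- by move=> [[x v] t] w; rewrite /Tmap /= (lin_ac lf) (lin_inv lf).
- by move=> y v w; rewrite (lin_add lf).
- by move=> y t v; rewrite (lin_sc lf).
- by move=> y v w; rewrite (lin_inv lf).
Qed.

Lemma lin_Tbase b (X : obj) : @lin _ _ (To (drule b) X) X (fun y => y.1.1) (fun _ w => w.1.1).
Proof. exact: (lin_comp (lin_fst (prodo X (vec (im X))) (scal b)) (lin_fst _ _)). Qed.

Lemma lin_Tincr b (X : obj) :
  @lin _ _ (To (drule b) X) (vec (im X)) (fun y => y.1.2) (fun _ w => w.1.2).
Proof. exact: (lin_comp (lin_fst (prodo X (vec (im X))) (scal b)) (lin_snd _ _)). Qed.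

Lemma lin_Tscal b (X : obj) :
  @lin _ _ (To (drule b) X) (scal b) (fun y => y.2) (fun _ w => w.2).
Proof. exact: (lin_snd (prodo X (vec (im X))) (scal b)). Qed.

Lemma drule_proj b : has_proj (drule b).
Proof. by move=> X; eexists; exact: lin_Tbase. Qed.

Lemma irule_proj : has_proj irule.
Proof.
move=> X; exists (fun _ w => w); split => //=; last exact: cont_snd.
by cont_proj.
Qed.

Lemma lin_vec_pair (Z : obj) V W (m : @tmod R K V) (n : @tmod R K W)
    (f : Z -> vec m) l (g : Z -> vec n) k : lin f l -> lin g k ->
  @lin _ _ Z (vec (prod_tmod m n)) (fun z => (f z, g z)) (fun z v => (l z v, k z v)).
Proof.
move=> lf lg; have [c dc a ad s i] := lin_pair lf lg.
by split; [exact: c|exact: dc|exact: a|exact: ad|exact: s|exact: i].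
Qed.

Section Drule.
Variable b : bool.
Notation r := (drule b).
Notation T := (To r).
Let Tlin := @drule_functorial b.

Lemma lin_Tpair (X Y : obj) : exists l, @lin _ _ (prodo (T X) (T Y)) (T (prodo X Y))
  (fun z => ((z.1.1.1, z.2.1.1), (z.1.1.2, z.2.1.2), z.1.2)) l.
Proof.
have lX := lin_fst (T X) (T Y); have lY := lin_snd (T X) (T Y).
have base := lin_pair (lin_comp lX (lin_Tbase b X)) (lin_comp lY (lin_Tbase b Y)).
have incr := lin_vec_pair (lin_comp lX (lin_Tincr b X)) (lin_comp lY (lin_Tincr b Y)).
have all := lin_pair (lin_pair base incr) (lin_comp lX (lin_Tscal b X)).
eexists; exact: all.
Qed.

(** The prolongation of a pair is the pair of prolongations with a common scalar. *)
Lemma Cr_pair n (X Y Z : obj) D (f : X -> Y) (g : X -> Z) :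
  Cr r n D f -> Cr r n D g -> Cr r n (Y := prodo Y Z) D (fun x => (f x, g x)).
Proof.
elim: n X Y Z D f g => [|n IH] X Y Z D f g; first exact: cont_on_pair.
move=> [cf [df [fE cdf]]] [cg [dg [gE cdg]]]; split; first exact: cont_on_pair.
exists (fun y => (df y, dg y)); split.
  by move=> y Dy; rewrite fE // gE.
have [l lr] := lin_Tpair Y Z.
have cdfg := IH _ _ _ _ _ _ cdf cdg.
have cT := Cr_comp (E := setT) (fun _ _ => I) cdfg (Cr_lin Tlin n setT lr).
exact cT.
Qed.

Lemma Cr_mkT n (Z Y : obj) D (f : Z -> Y) (g : Z -> vec (im Y)) (c : Z -> scal b) :
  Cr r n D f -> Cr r n D g -> Cr r n D c ->
  Cr r n (Y := T Y) D (fun z => (f z, g z, c z)).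
Proof. by move=> cf cg cc; exact: (Cr_pair (Cr_pair cf cg) cc). Qed.

Lemma Cr_compl n (X Y Z : obj) D (f : X -> Y) (g : Y -> Z) l :
  Cr r n D f -> lin g l -> Cr r n D (g \o f).
Proof.
move=> cf lg.
have cfg := Cr_comp (E := setT) (fun _ _ => I) cf (Cr_lin Tlin n setT lg).
exact cfg.
Qed.

Lemma lin_ta V (m : @tmod R K V) :
  @lin _ _ (prodo (vec m) (vec m)) (vec m) (fun y => ta m y.1 y.2) (fun _ w => ta m w.1 w.2).
Proof. exact: (@lin_act _ _ (vec m)). Qed.

Lemma Cr_ta n (X : obj) V (m : @tmod R K V) D (f g : X -> vec m) :
  Cr r n D f -> Cr r n D g -> Cr r n (Y := vec m) D (fun x => ta m (f x) (g x)).
Proof.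
move=> cf cg; have cfg := Cr_compl (Cr_pair cf cg) (lin_ta m).
exact cfg.
Qed.

End Drule.

(** A map that is constant along increments has quotient zero. *)
Lemma Cr_invariant n (X Y : obj) D (f : X -> Y) :
  (forall x v, f (ac x v) = f x) -> cont_on D f -> Cr (drule false) n D f.
Proof.
elim: n X Y D f => [|n IH] X Y D f fi cf //; split => //.
exists (fun=> tz (im Y)); split; first by move=> y _; rewrite {1}/sh fi /sh tsz ac0.
apply: IH; first by move=> y v; rewrite /Tmap /= fi.
apply: cont_on_pair; last by move=> y _; exact: cont_snd.
apply: cont_on_pair; last by move=> y _; exact: cvg_const.
apply: (@cont_on_comp _ _ _ _ D (fun y : To (drule false) X => y.1.1)) cf; first by move=> y [].
by move=> y _; exact: (lin_cont (lin_Tbase false X)).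
Qed.

(** The scalar multiplication is bilinear if the scalar is a variable; its quotient is
    a sum of scalar multiplications. *)
Lemma Cr_ts_setT b n V (m : @tmod R K V) :
  Cr (drule b) n (X := prodo (scal b) (vec m)) (Y := vec m) setT (fun y => ts m y.1 y.2).
Proof.
case: b; last first.
  suff lts : @lin _ _ (prodo (scal false) (vec m)) (vec m) (fun y => ts m y.1 y.2)
      (fun y w => ts m y.1 w.2) by exact (Cr_lin (@drule_functorial false) n setT lts).
  split => //=.
  - exact: ts_cont.
  - by apply: (cont_op2 (@ts_cont _ _ _ m)); cont_proj.
  - by move=> [t v] [_ w] /=; rewrite tsDr.
  - by move=> [t v] [_ w] [_ w'] /=; rewrite tsDr.
  - by move=> [t v] s [_ w] /=; rewrite !tsA mulrC.
set X := prodo _ _.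
have cts : cont_on [set: X] (fun y : X => ts m y.1 y.2).
  by move=> y _; exact: ts_cont.
elim: n => [|n IH] //; split => //.
have Cts (Z : obj) (f : Z -> scal true) (g : Z -> vec m) : Cr (drule true) n setT f ->
    Cr (drule true) n setT g -> Cr (drule true) n (Y := vec m) setT (fun z => ts m (f z) (g z)).
  move=> cf cg; have cfg := Cr_comp (E := setT) (fun _ _ => I) (Cr_pair cf cg) IH.
  exact cfg.
exists (fun y : To (drule true) X => ta m (ta m (ts m y.1.1.1 y.1.2.2) (ts m y.1.2.1 y.1.1.2))
  (ts m y.2 (ts m y.1.2.1 y.1.2.2))); split.
  move=> [[[t v] [t' v']] s] _ /=; rewrite /sh /=.
  rewrite !tsDr !tsDl !tsA (mulrC t s) -!taA; congr (ta m _ _).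
  rewrite taA (taC _ (ts m (s * t') v)) -taA; congr (ta m _ (ta m _ (ts m _ _))).
  by rewrite -[RHS]mulrA [LHS]mulrC.
have CL (Z : obj) (f : To (drule true) X -> Z) l : lin f l -> Cr (drule true) n setT f.
  by move=> lf; exact (Cr_lin (@drule_functorial true) n setT lf).
have lb := lin_Tbase true X; have li := lin_Tincr true X; have lt := lin_Tscal true X.
apply: (Cr_sub (D := setT)) => //.
have t1 := CL _ _ _ (lin_comp lb (lin_fst _ _)).
have v1 := CL _ _ _ (lin_comp lb (lin_snd _ _)).
have lt2 : @lin R K (vec (im X)) (scal true) (fun w => w.1) (fun _ w => w.1).
  by split => //; [exact: cont_fst|cont_proj].
have lv2 : @lin R K (vec (im X)) (vec m) (fun w => w.2) (fun _ w => w.2).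
  by split => //; [exact: cont_snd|cont_proj].
have t2 := CL _ _ _ (lin_comp li lt2); have v2 := CL _ _ _ (lin_comp li lv2).
have s1 := CL _ _ _ lt.
apply: (Cr_mkT _ _ s1); first exact: (Cts _ _ _ t1 v1).
exact: Cr_ta (Cr_ta (Cts _ _ _ t1 v2) (Cts _ _ _ t2 v1)) (Cts _ _ _ s1 (Cts _ _ _ t2 v2)).
Qed.

End ConcreteRules.

(** * Locality *)

Section Locality.
Context {R : realType} {K : nonArchFieldType R}.
Notation obj := (@obj R K).
Notation vecR e := (vec (@rV_tmod R K e)).

Lemma Cr_fun2 b n (X : obj) V (m : @tmod R K V) D (f : X -> scal b) (g : X -> vec m) :
  Cr (drule b) n D f -> Cr (drule b) n D g ->
  Cr (drule b) n (Y := vec m) D (fun x => ts m (f x) (g x)).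
Proof.
move=> cf cg.
have cfg := Cr_comp (E := setT) (fun _ _ => I) (Cr_pair cf cg) (Cr_ts_setT b n m).
exact cfg.
Qed.

(** The quotient of the inversion is -v (x + t v)^-1 x^-1, again built from inverses. *)
Lemma Cr_inv b n : Cr (drule b) n (X := scal b) (Y := scal b) [set t | t != 0 :> K]
  (fun t : K => t^-1).
Proof.
have ci : @cont_on K K [set t | t != 0 :> K] (fun t => t^-1).
  by move=> t t0; exact: nabs_invC.
case: b; last by apply: Cr_invariant.
elim: n => [|n IH] //; split => //.
pose X : obj := @scal R K true.
exists (fun y : To (drule true) X =>
  ts K_tmod (-1) (ts K_tmod y.1.2 (ts K_tmod (sh y.1.1 y.1.2 y.2)^-1 y.1.1^-1))); split.
  move=> [[t t'] s] [/= t0]; rewrite /sh /= => ts0.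
  have {}ts0 : (t : K) + s * t' != 0 by exact: ts0.
  have {}t0 : (t : K) != 0 by exact: t0.
  change (((t : K) + s * t')^-1 = (t : K)^-1 + (s : K) * (-1 * ((t' : K) * (((t : K) + s * t')^-1 * (t : K)^-1)))).
  by field; rewrite ts0 t0.
set D := Tset _.
have D1 y : D y -> [set t | t != 0 :> K] (y.1.1 : K) by case.
have D2 y : D y -> [set t | t != 0 :> K] (sh y.1.1 y.1.2 y.2 : K) by case.
have CL (Z : obj) (f : To (drule true) X -> Z) l : lin f l -> Cr (drule true) n D f.
  by move=> lf; exact (Cr_lin (@drule_functorial R K true) n D lf).
have cb := CL _ _ _ (lin_Tbase true X).
have ci' := CL _ _ _ (lin_Tincr true X).
have ct := CL _ _ _ (lin_Tscal true X).
have cst c : Cr (drule true) n D (Y := X) (fun=> c).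
  have lc : @lin _ _ (To (drule true) X) X (fun=> c) (fun _ _ => 0).
    split => //=; try by move=> x; exact: cvg_const.
    - by move=> _ _; rewrite addr0.
    - by move=> _ _ _; rewrite addr0.
    - by move=> _ t _; rewrite mulr0.
  exact: CL lc.
have toX (Z : obj) E (f : Z -> vec K_tmod) : Cr (drule true) n E f ->
    Cr (drule true) n (Y := X) E f.
  have lX : @lin _ _ (vec K_tmod) X id (fun _ v => v).
    by split => //=; [move=> x; exact: cvg_id|exact: cont_snd].
  by move=> cf; exact (Cr_compl cf lX).
have toV (Z : obj) E (f : Z -> X) : Cr (drule true) n E f ->
    Cr (drule true) n (Y := vec K_tmod) E f.
  have lX : @lin _ _ X (vec K_tmod) id (fun _ v => v).
    by split => //=; [move=> x; exact: cvg_id|exact: cont_snd].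
  by move=> cf; exact (Cr_compl cf lX).
have cinv1 : Cr (drule true) n D (Y := X) (fun y => (y.1.1 : K)^-1).
  exact (Cr_comp D1 cb IH).
have cs : Cr (drule true) n D (Y := X) (fun y => sh y.1.1 y.1.2 y.2).
  exact (toX _ _ _ (Cr_ta (m := K_tmod) (toV _ _ _ cb) (Cr_fun2 ct ci'))).
have cinv2 : Cr (drule true) n D (Y := X) (fun y => (sh y.1.1 y.1.2 y.2 : K)^-1).
  exact (Cr_comp D2 cs IH).
apply: (@Cr_mkT R K true n (To (drule true) X) X D _ _ _ cinv1 _ ct).
apply: (Cr_fun2 (m := K_tmod) (cst _)).
by apply: (Cr_fun2 (m := K_tmod) (toX _ _ _ ci')); apply: (Cr_fun2 cinv2); exact: toV.
Qed.

Lemma Cr_Br b n (X : obj) e D (f : X -> vecR e) : Cr (drule b) n D f -> Br (drule b) n D f.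
Proof.
elim: n X D f => [|n IH] X D f //= [cf [df [fE cdf]]]; split => //.
exists df; split; first by move=> y /fE.
apply: IH; have := lin_Tincr b (vecR e) => lT.
by have cT := Cr_compl cdf lT; exact cT.
Qed.

(** The prolongation of f is made of f, of its quotient and of the scalar, which are all
    of order n. *)
Lemma Br_Cr b n (X : obj) e D (f : X -> vecR e) : Br (drule b) n D f -> Cr (drule b) n D f.
Proof.
elim: n X D f => [|n IH] X D f // /[dup] /BrW Bf [cf [df [fE /IH cdf]]]; split => //.
exists df; split; first by move=> y /fE.
have cT := Cr_lin (@drule_functorial R K b) n (Tset D) (lin_Tscal b X).
have cB : Cr (drule b) n (Tset (r := drule b) D) (fun y => f y.1.1).
  have cpr := Cr_lin (@drule_functorial R K b) n (Tset D) (lin_Tbase b X).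
  have cfp := Cr_comp (E := D) (fun y (Dy : Tset D y) => proj1 Dy) cpr (IH _ _ _ Bf).
  exact cfp.
exact (@Cr_mkT R K b n _ _ _ _ _ _ cB cdf cT).
Qed.

Section Rule.
Variable r : @rule R K.

(** Difference quotients at nonzero scalars inherit the class of the map, even when
    the two ends of the increment lie in different pieces of the domain. *)
Definition has_quotients := forall n (X : obj) e (D E : set X) (f : X -> 'rV[K]_e),
  Br r n D f -> Br r n E f ->
  Br r n (X := To r X) [set y | [/\ D (rb y), E (sh (rb y) (rv y) (rt y)) & rt y != 0]]
    (fun y => (rt y)^-1 *: (f (sh (rb y) (rv y) (rt y)) - f (rb y))).

Lemma cvg_uniq (A B : topologicalType) (u v : A -> B) (x : A) : hausdorff_space B ->
  u @ x --> u x -> v @ x --> v x ->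
  (forall N, nbhs x N -> exists2 y, N y & u y = v y) -> u x = v x.
Proof.
move=> hB cu cv uv; apply: hB => U V xU xV.
have Ux : nbhs x (u @^-1` U) by exact: cu.
have Vx : nbhs x (v @^-1` V) by exact: cv.
have [y [/= Uy Vy] uvy] := uv _ (filterI Ux Vx).
by exists (u y); split; rewrite // uvy.
Qed.

(** The norm is not trivial: there are arbitrarily small nonzero scalars. *)
Lemma dense_scalar (X : obj) (y : To r X) N : nbhs y N ->
  exists2 t, t != 0 & N (rmk r (rb y) (rv y) t).
Proof.
have [y0|y0] := eqVneq (rt y) 0; last first.
  by move=> /nbhs_singleton Ny; exists (rt y); rewrite // rmkK.
rewrite -{1}(rmkK y) y0 => yN.
have cm : (fun t : K => rmk r (rb y) (rv y) t) @ (0 : K) --> rmk r (rb y) (rv y) 0.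
  apply: (@cont_comp _ _ _ (fun t : K => (rb y, rv y, t)) _ _ (@rmk_cont _ _ r X)).
  by apply: cont_pair => t; [exact: cvg_const|exact: cvg_id].
by have [t t0 Nt] := nbhs0_neq0 (cm _ yN); exists t.
Qed.

(** A difference quotient is determined by its values at nonzero scalars. *)
Lemma quotient_uniq (X : obj) e (D E : set (To r X)) (u v : To r X -> 'rV[K]_e) y :
  open D -> open E -> D y -> E y -> cont_on D u -> cont_on E v ->
  (forall z, D z -> E z -> rt z != 0 -> u z = v z) -> u y = v y.
Proof.
move=> oD oE Dy Ey cu cv uv.
apply: (cvg_uniq (@vnorm_hausdorff _ _ _) (cu _ Dy) (cv _ Ey)) => N yN.
have yND : nbhs y [set z | [/\ N z, D z & E z]].
  near=> z; split; near: z => //; exact: open_nbhs_nbhs.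
have [t t0 [Nt Dt Et]] := dense_scalar yND.
by eexists; first exact: Nt; apply: uv; rewrite // rtK.
Unshelve. all: end_near. Qed.

Lemma Qset_open (X : obj) (D E : set X) : open D -> open E ->
  open [set y : To r X | [/\ D (rb y), E (sh (rb y) (rv y) (rt y)) & rt y != 0]].
Proof.
move=> oD oE; rewrite openE => y [Dy Ey y0].
have D1 : nbhs y [set z : To r X | D (rb z)].
  exact: (rb_cont (open_nbhs_nbhs (conj oD Dy))).
have E1 : nbhs y [set z : To r X | E (sh (rb z) (rv z) (rt z))].
  exact: (cont_sh (open_nbhs_nbhs (conj oE Ey))).
have t1 : nbhs y [set z : To r X | nabs (rt z) = nabs (rt y)].
  exact: (rt_cont (nabs_near_eq y0)).
apply: filterS2 D1 (filterI E1 t1) => z Dz [Ez tz]; split => //.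
by rewrite -nabs_gt0 tz nabs_gt0.
Qed.

Hypotheses (Tq : has_quotients).

(** At nonzero scalars the quotient is the explicit one; near the zero scalar both ends
    of the increment lie in one of the small open sets. The quotients of the local
    classes agree by density of the nonzero scalars, and give a quotient on D. *)
Theorem Br_local n (X : obj) e (D : set X) (f : X -> 'rV[K]_e) :
  open D -> (forall x, D x -> exists E, [/\ open E, E x & Br r n E f]) -> Br r n D f.
Proof.
elim: n X e D f => [|n IH] X e D f oD fl.
  by move=> x /fl [E [_ Ex cf]]; exact: cf.
split; first by move=> x /fl [E [_ Ex /Br_cont cf]]; exact: cf.
pose nb x := xget setT [set E | [/\ open E, E x & Br r n.+1 E f]].
have nbP x : D x -> [/\ open (nb x), nb x x & Br r n.+1 (nb x) f].
  by move=> /fl [E EP]; rewrite /nb; case: xgetP => [E' _ //|/(_ E)].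
pose dv E := xget (fun=> 0) [set df : To r X -> 'rV[K]_e |
  (forall y, Tset E y -> f (sh (rb y) (rv y) (rt y)) = f (rb y) + rt y *: df y) /\
  Br r n (X := To r X) (Tset E) df].
have dvP E : Br r n.+1 E f ->
    (forall y, Tset E y -> f (sh (rb y) (rv y) (rt y)) = f (rb y) + rt y *: dv E y) /\
    Br r n (X := To r X) (Tset E) (dv E).
  by move=> [_ [df dfP]]; rewrite /dv; case: xgetP => [df' _ //|/(_ df)].
have dvE E y : Br r n.+1 E f -> Tset E y -> rt y != 0 ->
    dv E y = (rt y)^-1 *: (f (sh (rb y) (rv y) (rt y)) - f (rb y)).
  by move=> /dvP [fE _] Ey y0; rewrite fE // addrC addKr scalerA mulVf // scale1r.
pose df (y : To r X) := if rt y == 0 then dv (nb (rb y)) y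
  else (rt y)^-1 *: (f (sh (rb y) (rv y) (rt y)) - f (rb y)).
exists df; split.
  move=> y [Dy _]; rewrite /df; case: eqVneq => [y0|y0].
    by rewrite y0 sh0 scale0r addr0.
  by rewrite scalerA mulfV // scale1r addrC subrK.
apply: IH; first exact: Tset_open.
move=> y [Dx Dy]; have [op1 n1 B1] := nbP _ Dx; have [op2 n2 B2] := nbP _ Dy.
have [y0|y0] := eqVneq (rt y) 0.
  exists (Tset (nb (rb y) `&` D)); split.
  - by apply: Tset_open; exact: openI.
  - by rewrite /Tset /= y0 sh0.
  have [fE Bdv] := dvP _ B1; apply: (@Br_eq _ _ r n _ _ _ (dv (nb (rb y)))).
  - by apply: Tset_open; exact: openI.
  - move=> z [[z1 Dz] [z2 _]]; rewrite /df; case: eqVneq => [z0|z0]; last exact: dvE.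
    have [op3 n3 B3] := nbP _ Dz; have [_ Bdv3] := dvP _ B3.
    apply: (quotient_uniq (Tset_open r op1) (Tset_open r op3) _ _
      (Br_cont Bdv) (Br_cont Bdv3)) => //; first by rewrite /Tset /= z0 sh0.
    by move=> u Eu Eu3 u0; rewrite !dvE.
  - by apply: Br_sub Bdv; apply: Tset_sub => z [].
exists [set z | [/\ nb (rb y) (rb z), nb (sh (rb y) (rv y) (rt y))
    (sh (rb z) (rv z) (rt z)) & rt z != 0]]; split => //.
  exact: Qset_open.
apply: Br_eq (Tq (BrW B1) (BrW B2)); first exact: Qset_open.
by move=> z [_ _ z0]; rewrite /df (negbTE z0).
Qed.

End Rule.
Lemma Br_diff (r : @rule R K) n (X : obj) e (D : set X) (f g : X -> 'rV[K]_e) :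
  has_proj r -> Br r n D f -> Br r n D g -> Br r n D (fun x => f x - g x).
Proof.
move=> Tp cf cg; rewrite (_ : (fun x => _) = fun x => f x + (-1) *: g x).
  apply: Br_add => //; apply: (@Br_scale_inv _ _ r Tp n X e D (fun=> -1)) => //.
  by move=> x _; exact: cvg_const.
by apply/funext => x; rewrite scaleN1r.
Qed.

Lemma Cr_sh b n (X : obj) S :
  Cr (drule b) n (X := To (drule b) X) S (fun y => sh y.1.1 y.1.2 y.2).
Proof.
have cb := Cr_lin (@drule_functorial R K b) n S (lin_Tbase b X).
have ci := Cr_lin (@drule_functorial R K b) n S (lin_Tincr b X).
have ct := Cr_lin (@drule_functorial R K b) n S (lin_Tscal b X).
have cs := Cr_compl (Cr_pair cb (Cr_fun2 ct ci)) (@lin_act _ _ X).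
exact cs.
Qed.

Lemma drule_quotients b : has_quotients (drule b).
Proof.
move=> n X e D E f BD BE; set S := mkset _.
have Bd : Br (drule b) n S (fun y => f (sh y.1.1 y.1.2 y.2) - f y.1.1).
  apply: Br_diff; first exact: drule_proj.
    have cfs := Cr_comp (E := E) (fun y (Sy : S y) => let: And3 _ Ey _ := Sy in Ey)
      (Cr_sh n S) (Br_Cr BE).
    exact (Cr_Br cfs).
  have cfb := Br_lin (@drule_functorial R K b)
    (fun y (Sy : S y) => let: And3 Dy _ _ := Sy in Dy) (lin_Tbase b X) BD.
  exact cfb.
have ct := Cr_lin (@drule_functorial R K b) n S (lin_Tscal b X).
have cinv := Cr_comp (E := [set t : scal b | (t : K) != 0])
  (fun y (Sy : S y) => let: And3 _ _ ty := Sy in ty) ct (Cr_inv b n).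
exact (Cr_Br (Cr_fun2 cinv (Br_Cr Bd))).
Qed.

Lemma lin_sh_iter (X : obj) :
  @lin _ _ (To irule X) X (fun y => sh y.1.1 y.1.2 y.2) (fun _ w => w).
Proof.
split => //=; [exact: (@cont_sh _ _ irule X)|exact: cont_snd|].
by move=> [[x v] t] w; rewrite /sh /= acAC.
Qed.

Lemma lin_base_iter (X : obj) : @lin _ _ (To irule X) X (fun y => y.1.1) (fun _ w => w).
Proof. by split => //=; [cont_proj|exact: cont_snd]. Qed.

Lemma irule_quotients : has_quotients irule.
Proof.
move=> n X e D E f BD BE; set S := mkset _.
apply: (@Br_scale_inv _ _ irule irule_proj n (To irule X) e S (fun y => y.2^-1)
  (fun y => f (sh y.1.1 y.1.2 y.2) - f y.1.1)) => //.
  move=> y [_ _ y0]; have ci := @nabs_invC R K y.2 y0.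
  exact: (@continuous_comp _ _ _ (fun y : To irule X => y.2) (fun t : K => t^-1) y
    (@cont_snd _ _ y) ci).
apply: Br_diff; first exact: irule_proj.
  have cfs := Br_lin irule_functorial
    (fun y (Sy : S y) => let: And3 _ Ey _ := Sy in Ey) (lin_sh_iter X) BE.
  exact cfs.
have cfb := Br_lin irule_functorial
  (fun y (Sy : S y) => let: And3 Dy _ _ := Sy in Dy) (lin_base_iter X) BD.
exact cfb.
Qed.

(** Freezing the vectors restricts the increments of a prolongation to those of the
    base point. *)
Lemma Br_full_iter n (X : obj) e (D : set X) (f : X -> 'rV[K]_e) :
  Br (drule false) n D f -> Br irule n D f.
Proof.
elim: n X D f => [|n IH] X D f // [cf [df [fE cdf]]]; split => //.
exists df; split; first by move=> y /fE.
have l : @lin R K (To irule X) (To (drule false) X) id (fun _ w => (w, tz (im X), 0)).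
  split => //=.
  - by move=> y; exact: cvg_id.
  - apply: cont_pair; [apply: cont_pair|]; try by move=> x; exact: cvg_const.
    exact: cont_snd.
  - by move=> [[x v] t] w /=; rewrite ta0r.
  - by move=> y v w; rewrite ta0 addr0.
  - by move=> y t v; rewrite tsz scaler0.
have cdi := Br_lin irule_functorial (E := Tset (r := drule false) D)
  (fun y (Dy : Tset (r := irule) D y) => Dy) l (IH _ _ _ cdf).
exact cdi.
Qed.

End Locality.

(** * The bracketed classes *)

Section Bracketed.
Context {R : realType} {K : nonArchFieldType R}.
Notation obj := (@obj R K).
Variables (d e : nat).
Notation brarg := (@brarg R K d).

(** The linear structure of [brarg k] behind [brshift]; the space [brarg k.+1] is the
    space of arguments of the quotients on [brarg k]. *)
Fixpoint brtm (k : nat) : @tmod R K (brarg k) :=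
  match k with
  | 0%N => rV_tmod d
  | k'.+1 => prod_tmod (prod_tmod (brtm k') (brtm k')) K_tmod
  end.

Lemma brshiftE k s (y w : brarg k) : brshift s y w = ta (brtm k) y (ts (brtm k) s w).
Proof. by elim: k y w => [|k IH] //= [[y y'] t] [[w w'] u] /=; rewrite !IH. Qed.

Definition brobj k : obj := vec (brtm k).

Lemma lin_brobjV k : @lin _ _ (To (drule true) (brobj k)) (brobj k.+1) id (fun _ w => w).
Proof. by split => //=; [move=> y; exact: cvg_id|exact: cont_snd]. Qed.

Lemma brdomS (U : set 'rV[K]_d) k :
  brdom U (k := k.+1) = Tset (r := drule true) (X := brobj k) (brdom U (k := k)).
Proof. by apply/seteqP; split=> y [y1 y2]; split=> //; move: y2; rewrite /= brshiftE. Qed.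

Lemma brdom_open (U : set 'rV[K]_d) k : open U -> open (brdom U (k := k)).
Proof. by move=> oU; elim: k => [|k IH] //; rewrite brdomS; exact (@Tset_open _ _ (drule true) (brobj k) _ IH). Qed.

Lemma brdom_sub (U V : set 'rV[K]_d) k : U `<=` V -> brdom U (k := k) `<=` brdom V (k := k).
Proof. by move=> UV; elim: k => [|k IH] //= y [/IH y1 /IH]. Qed.

Lemma within_cont_on (A B : topologicalType) (D : set A) (f : A -> B) : open D ->
  {within D, continuous f} <-> cont_on D f.
Proof.
move=> oD; rewrite continuous_open_subspace //; split=> cf x Dx.
  by apply: cf; exact: mem_set.
by apply: cf; exact: set_mem.
Qed.

Variables (U : set 'rV[K]_d) (f : 'rV[K]_d -> 'rV[K]_e).
Hypothesis oU : open U.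

Lemma brext_uniq k (g : brarg k -> 'rV[K]_e) F G : is_brext U g F -> is_brext U g G ->
  forall y, brdom U (k := k.+1) y -> F y = G y.
Proof.
move=> [/(within_cont_on _ (brdom_open k.+1 oU)) cF FE].
move=> [/(within_cont_on _ (brdom_open k.+1 oU)) cG GE] y Dy.
have oD := @brdom_open U k.+1 oU.
apply: (@quotient_uniq _ _ (drule true) (brobj k) e _ _ F G y oD oD Dy Dy cF cG).
by move=> z Dz _ z0; rewrite FE // GE.
Qed.

Lemma Upsilon_brext k F : is_brext U (Upsilon U f (k := k)) F ->
  is_brext U (Upsilon U f (k := k)) (Upsilon U f (k := k.+1)).
Proof. by move=> extF; rewrite /=; case: xgetP => [G _ //|/(_ F)]. Qed.

Lemma brclass_le n k : (k <= n)%N -> brclass U f n -> brclass U f k.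
Proof. by move=> /subnK <-; elim: (n - k)%N => [|m IH] //; rewrite addSn => -[/IH]. Qed.

Lemma brclass_brext n k : (k < n)%N -> brclass U f n ->
  is_brext U (Upsilon U f (k := k)) (Upsilon U f (k := k.+1)).
Proof. by move=> kn /(brclass_le kn) [_ [F]]; exact: Upsilon_brext. Qed.

Lemma brclass_cont n : brclass U f n -> cont_on U f.
Proof. by move=> /(brclass_le (leq0n n)) /(within_cont_on _ oU). Qed.

Lemma brext_eq k (g : brarg k -> 'rV[K]_e) F : is_brext U g F ->
  forall y : To (drule true) (brobj k),
    Tset (X := brobj k) (brdom U (k := k)) y ->
  g (sh (rb y) (rv y) (rt y)) = g (rb y) + rt y *: F y.
Proof.
move=> [_ FE] y Dy; have [y0|y0] := eqVneq (rt y) 0.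
  by rewrite y0 sh0 scale0r addr0.
rewrite (FE y) ?brdomS // /brquot brshiftE scalerA mulfV // scale1r addrC subrK //.
Qed.

(** The k-th bracketed quotient has the following ones as its own quotients. *)
Lemma brclass_Br n k j : brclass U f n -> (j + k <= n)%N ->
  Br (drule true) j (X := brobj k) (brdom U (k := k)) (Upsilon U f (k := k)).
Proof.
move=> fn; have cU i : (i <= n)%N -> cont_on (brdom U (k := i)) (Upsilon U f (k := i)).
  case: i => [_|i ni]; first exact: brclass_cont fn.
  by have [/(within_cont_on _ (brdom_open i.+1 oU))] := brclass_brext ni fn.
elim: j k => [|j IH] k jk; first exact: cU.
split; first by apply: cU; rewrite (leq_trans _ jk) // leq_addl.
have kn : (k < n)%N by rewrite (leq_trans _ jk) // addSn ltnS leq_addl.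
exists (Upsilon U f (k := k.+1)); split; first exact: brext_eq (brclass_brext kn fn).
have B : Br (drule true) j (X := brobj k.+1) (brdom U (k := k.+1)) (Upsilon U f (k := k.+1)).
  by apply: IH; rewrite addnS -addSn.
have TD : forall y : To (drule true) (brobj k), Tset (X := brobj k) (brdom U (k := k)) y ->
    brdom U (k := k.+1) y by move=> y; rewrite brdomS.
have BT := Br_lin (@drule_functorial R K true) (Y := brobj k.+1)
  (E := brdom U (k := k.+1)) TD (lin_brobjV k) B.
exact BT.
Qed.

End Bracketed.

(** * The iterated classes *)

Section Iterated.
Context {R : realType} {K : nonArchFieldType R}.
Notation obj := (@obj R K).
Variables (d e : nat).
Notation itarg := (@itarg R K d).

Lemma itshiftD k (v w : 'rV[K]_d) (y : itarg k) :
  itshift (v + w) y = itshift w (itshift v y).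
Proof. by elim: k y => [|k IH] y /=; rewrite ?addrA ?IH. Qed.

Lemma itshift0 k (y : itarg k) : itshift 0 y = y.
Proof. by elim: k y => [|k IH] /= y; [rewrite addr0|rewrite IH; case: y => [[]]]. Qed.

Lemma itshift_inj k (y : itarg k) : injective (fun v => itshift v y).
Proof. by elim: k y => [|k IH] /= y v w; [exact: addrI|case=> /IH]. Qed.

Lemma itshift_cont k : continuous (fun yv : itarg k * 'rV[K]_d => itshift yv.2 yv.1).
Proof.
elim: k => [|k IH]; first exact: vnorm_addC.
apply: cont_pair; last by cont_proj.
apply: cont_pair; last by cont_proj.
by apply: (@cont_op2 _ _ _ _ (fun y v => itshift v y) _ _ IH); cont_proj.
Qed.

Lemma itarg_hausdorff k : hausdorff_space (itarg k).
Proof.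
elim: k => [|k IH]; first exact: vnorm_hausdorff.
by apply: hausdorff_prod nabs_hausdorff; apply: hausdorff_prod IH _; exact: vnorm_hausdorff.
Qed.

(** The space of arguments of the k-th iterated quotient, whose only increments are
    those of the base point. *)
Definition itobj k : obj :=
  @Obj R K (itarg k) 'rV[K]_d (rV_tmod d) (fun y v => itshift v y)
    (fun y v w => itshiftD v w y) (@itshift0 k) (@itshift_inj k) (@itshift_cont k)
    (@itarg_hausdorff k).

Lemma lin_itobjV k : @lin _ _ (To irule (itobj k)) (itobj k.+1) id (fun _ w => w).
Proof. by split => //=; [move=> y; exact: cvg_id|exact: cont_snd]. Qed.

Lemma itdomS (U : set 'rV[K]_d) k :
  itdom U (k := k.+1) = Tset (r := irule) (X := itobj k) (itdom U (k := k)).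
Proof. by []. Qed.

Lemma itdom_open (U : set 'rV[K]_d) k : open U -> open (itdom U (k := k)).
Proof. by move=> oU; elim: k => [|k IH] //; exact (@Tset_open _ _ irule (itobj k) _ IH). Qed.

Lemma itdom_sub (U V : set 'rV[K]_d) k : U `<=` V -> itdom U (k := k) `<=` itdom V (k := k).
Proof. by move=> UV; elim: k => [|k IH] //= y [/IH y1 /IH]. Qed.

Lemma itregular_shift k v (y : itarg k) : itregular (itshift v y) <-> itregular y.
Proof. by elim: k y => [|k IH] //= y; rewrite IH. Qed.

(** Several scalars have to be moved to nonzero ones at a time. *)
Lemma itregular_dense k (y : itarg k) N : nbhs y N -> exists2 z, N z & itregular z.
Proof.
elim: k y N => [|k IH] /= y N; first by move=> /nbhs_singleton Ny; exists y.
case: y => [[y v] t] [[AB C] /= [[[A B] /= [nA nB] sAB] nC] sN].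
have [z Az zr] := IH _ _ nA.
have [u u0 Cu] : exists2 u, u != 0 & C u.
  have [t0|t0] := eqVneq t 0; last by exists t => //; exact: nbhs_singleton.
  by rewrite t0 in nC; exact: nbhs0_neq0.
exists (z, v, u) => //; apply: sN; split=> //=; apply: sAB; split=> //=.
exact: nbhs_singleton.
Qed.

Section Fixed.
Variables (U : set 'rV[K]_d) (f : 'rV[K]_d -> 'rV[K]_e).
Hypothesis oU : open U.

Lemma itext_uniq k (E : set (itarg k)) (u v : itarg k -> 'rV[K]_e) y :
  open E -> E y -> cont_on E u -> cont_on E v ->
  (forall z, E z -> itregular z -> u z = v z) -> u y = v y.
Proof.
move=> oE Ey cu cv uv.
apply: (cvg_uniq (@vnorm_hausdorff _ _ _) (cu _ Ey) (cv _ Ey)) => N yN.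
have [z [Nz Ez] zr] := itregular_dense (filterI yN (open_nbhs_nbhs (conj oE Ey))).
by exists z => //; exact: uv.
Qed.

Lemma is_PhibarP k (F : itarg k -> 'rV[K]_e) : is_Phibar U f F <->
  cont_on (itdom U (k := k)) F /\ forall y, itdom U y -> itregular y -> F y = Phi f y.
Proof.
have oD := @itdom_open U k oU.
by split=> [[/(within_cont_on _ oD)]|[/(within_cont_on _ oD)]].
Qed.

Lemma Phibar_ext k (F : itarg k -> 'rV[K]_e) :
  is_Phibar U f F -> is_Phibar U f (Phibar U f (k := k)).
Proof. by move=> extF; rewrite /Phibar; case: xgetP => [G _ //|/(_ F)]. Qed.

Lemma is_Phibar_uniq k (F G : itarg k -> 'rV[K]_e) y :
  is_Phibar U f F -> is_Phibar U f G -> itdom U y -> F y = G y.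
Proof.
move=> /is_PhibarP [cF FE] /is_PhibarP [cG GE] Dy.
apply: (itext_uniq (@itdom_open U k oU) Dy cF cG) => z Dz zr.
by rewrite FE // GE.
Qed.

(** The relation between successive quotients extends from nonzero scalars to all
    scalars by continuity. *)
Lemma Phibar_quot k (F : itarg k -> 'rV[K]_e) (G : itarg k.+1 -> 'rV[K]_e) :
  is_Phibar U f F -> is_Phibar U f G -> forall y : itarg k.+1, itdom U y ->
  F (itshift (y.2 *: y.1.2) y.1.1) = F y.1.1 + y.2 *: G y.
Proof.
move=> /is_PhibarP [cF FE] /is_PhibarP [cG GE] y Dy.
have oD := @itdom_open U k.+1 oU.
apply: (@itext_uniq k.+1 _ (fun y : itarg k.+1 => F (itshift (y.2 *: y.1.2) y.1.1))
  (fun y : itarg k.+1 => F y.1.1 + y.2 *: G y) y oD Dy).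
- apply: (cont_on_comp (E := itdom U (k := k)) _ _ cF); first by move=> z [].
  by move=> z _; exact: (@cont_sh _ _ irule (itobj k)).
- have cb : cont_on (itdom U (k := k.+1)) (fun y : itarg k.+1 => F y.1.1).
    apply: (cont_on_comp (E := itdom U (k := k)) _ _ cF); first by move=> z [].
    by move=> z _; exact: (@rb_cont _ _ irule (itobj k)).
  move=> z Dz; apply: (@cvg_op2 _ _ _ _ (fun w : 'rV[K]_e * 'rV[K]_e => w.1 + w.2)).
  + exact: cb.
  + apply: (@cvg_op2 _ _ _ _ (fun w : K * 'rV[K]_e => w.1 *: w.2)).
    * exact: cont_snd.
    * exact: cG.
    * exact: vnorm_scaleC.
  + exact: vnorm_addC.
- move=> z Dz [zr z0]; have [D1 D2] := Dz.
  rewrite FE ?itregular_shift // FE // GE //=.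
  by rewrite scalerA mulfV // scale1r addrC subrK.
Qed.

(** The k-th iterated quotient has the following ones as its own quotients. *)
Lemma itclass_Br n k j : itclass U f n -> (j + k <= n)%N ->
  Br irule j (X := itobj k) (itdom U (k := k)) (Phibar U f (k := k)).
Proof.
move=> [_ fn]; have pU i : (i <= n)%N -> is_Phibar U f (Phibar U f (k := i)).
  by move=> /fn [F]; exact: Phibar_ext.
have cU i : (i <= n)%N -> cont_on (itdom U (k := i)) (Phibar U f (k := i)).
  by move=> /pU /is_PhibarP [].
elim: j k => [|j IH] k jk; first exact: cU.
have kn : (k < n)%N by rewrite (leq_trans _ jk) // addSn ltnS leq_addl.
split; first by apply: cU; exact: ltnW.
exists (Phibar U f (k := k.+1)); split.
  by move=> y Dy; exact: (Phibar_quot (pU _ (ltnW kn)) (pU _ kn) Dy).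
have B : Br irule j (X := itobj k.+1) (itdom U (k := k.+1)) (Phibar U f (k := k.+1)).
  by apply: IH; rewrite addnS -addSn.
have BT := Br_lin (@irule_functorial R K) (Y := itobj k.+1) (E := itdom U (k := k.+1))
  (D := Tset (r := irule) (X := itobj k) (itdom U (k := k))) (fun y Dy => Dy) (lin_itobjV k) B.
exact BT.
Qed.

Lemma Phibar0 n x : itclass U f n -> U x -> Phibar U f (k := 0) x = f x.
Proof.
move=> [_ /(_ 0%N isT) [F /Phibar_ext/is_PhibarP [_ PE]]] Ux; exact: PE.
Qed.

End Fixed.

End Iterated.

(** * Parameters *)

Section Families.
Context {R : realType} {K : nonArchFieldType R}.
Notation obj := (@obj R K).
Variables (d e : nat).
Notation brobj := (@brobj R K d).
Notation itobj := (@itobj R K d).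
Variables (Z : topologicalType) (hZ : hausdorff_space Z).
Variables (D : set (Z * 'rV[K]_d)) (f : Z * 'rV[K]_d -> 'rV[K]_e).
Hypothesis oD : open D.

Definition slice (z : Z) : set 'rV[K]_d := [set x | D (z, x)].
Local Notation fz z := (fun x => f (z, x)).

Lemma cont_slice (A : topologicalType) (z : Z) : continuous (fun x : A => (z, x)).
Proof. by apply: cont_pair => x; [exact: cvg_const|exact: cvg_id]. Qed.

Lemma slice_open z : open (slice z).
Proof. by apply: (@open_comp _ _ (fun x => (z, x))) oD => x _; exact: cont_slice. Qed.

Lemma lin_paro_br k : @lin _ _ (paro hZ (brobj k.+1)) (To (drule true) (paro hZ (brobj k)))
  (fun zy => ((zy.1, zy.2.1.1), zy.2.1.2, zy.2.2)) (fun _ w => w).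
Proof.
split => //=; last exact: cont_snd.
by apply: cont_pair; [apply: cont_pair; [apply: cont_pair|]|]; cont_proj.
Qed.

Lemma lin_paro_it k : @lin _ _ (paro hZ (itobj k.+1)) (To irule (paro hZ (itobj k)))
  (fun zy => ((zy.1, zy.2.1.1), zy.2.1.2, zy.2.2)) (fun _ w => w).
Proof.
split => //=; last exact: cont_snd.
by apply: cont_pair; [apply: cont_pair; [apply: cont_pair|]|]; cont_proj.
Qed.

Definition pbrdom k : set (paro hZ (brobj k)) := [set zy | brdom (slice zy.1) zy.2].
Definition pitdom k : set (paro hZ (itobj k)) := [set zy | itdom (slice zy.1) zy.2].

Lemma pbrdom_T k zy : pbrdom (k := k.+1) zy ->
  Tset (r := drule true) (pbrdom (k := k)) ((zy.1, zy.2.1.1), zy.2.1.2, zy.2.2).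
Proof. by move=> [y1 y2]; split=> //; move: y2; rewrite brshiftE. Qed.

Lemma pbrdom_open k : open (pbrdom (k := k)).
Proof.
elim: k => [|k IH].
  rewrite (_ : pbrdom (k := 0) = D) //.
  by apply/seteqP; split=> -[z x].
rewrite (_ : pbrdom (k := k.+1) = ((fun zy : paro hZ (brobj k.+1) =>
    ((zy.1, zy.2.1.1), zy.2.1.2, zy.2.2)) @^-1` Tset (r := drule true) (pbrdom (k := k)))).
  apply: (@open_comp _ _ _ (Tset (r := drule true) (pbrdom (k := k)))).
    by move=> zy _; exact: (lin_cont (lin_paro_br k)).
  exact (@Tset_open _ _ (drule true) _ _ IH).
apply/seteqP; split=> zy; first exact: pbrdom_T.
by move=> [y1 y2]; split=> //; move: y2; rewrite brshiftE.
Qed.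

Lemma pitdom_open k : open (pitdom (k := k)).
Proof.
elim: k => [|k IH].
  rewrite (_ : pitdom (k := 0) = D) //.
  by apply/seteqP; split=> -[z x].
apply: (@open_comp _ _ (fun zy => ((zy.1, zy.2.1.1), zy.2.1.2, zy.2.2))
  (Tset (r := irule) (pitdom (k := k)))).
  by move=> zy _; exact: (lin_cont (lin_paro_it k)).
exact (@Tset_open _ _ irule _ _ IH).
Qed.

(** The unique extended quotients of the slices depend jointly continuously on the
    parameter, as they are the slices of a quotient of f. *)
Lemma brclass_param n : Br (drule true) n (X := paro hZ (brobj 0)) D f ->
  forall k, (k <= n)%N ->
  Br (drule true) (n - k) (pbrdom (k := k))
    (fun zy => Upsilon (slice zy.1) (fz zy.1) (k := k) zy.2) /\
  forall z, brclass (slice z) (fz z) k.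
Proof.
move=> Bf; elim=> [|k IH] kn.
  rewrite subn0; split.
    have Bf' : Br (drule true) n (X := paro hZ (brobj 0)) D
        (fun zy : Z * 'rV[K]_d => f (zy.1, zy.2)).
      by apply: Br_eq Bf => // -[].
    by apply: Br_sub Bf'; move=> -[z x].
  move=> z; rewrite /=; apply/(within_cont_on _ (@slice_open z)).
  apply: (@cont_on_comp _ _ _ _ D (fun x => (z, x)) f) (Br_cont Bf) => //.
  by move=> x _; exact: cont_slice.
have [+ fk] := IH (ltnW kn); rewrite -subSS subSn //=.
move=> [cG [dG [dGE BdG]]].
pose F z (y : @brarg R K d k.+1) := dG ((z, y.1.1), y.1.2, y.2).
have BF := Br_lin (@drule_functorial R K true) (@pbrdom_T k) (lin_paro_br k) BdG.
have extF z : is_brext (slice z) (Upsilon (slice z) (fz z) (k := k)) (F z).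
  split.
    apply/(within_cont_on _ (@brdom_open _ _ _ _ k.+1 (@slice_open z))).
    apply: (@cont_on_comp _ _ _ _ (pbrdom (k := k.+1)) (fun y => (z, y)) _ _ _ (Br_cont BF)).
      by [].
    by move=> y _; exact: cont_slice.
  move=> y Dy y0; rewrite /brquot.
  have := dGE _ (@pbrdom_T k (z, y) Dy); rewrite /= /sh /= -brshiftE => ->.
  by rewrite addrC addKr scalerA mulVf // scale1r.
have fk1 z : brclass (slice z) (fz z) k.+1 by split; [exact: fk|exists (F z)].
split => //; apply: Br_eq BF; first exact: pbrdom_open.
move=> [z y] Dy; apply: (brext_uniq (@slice_open z) (extF z)) Dy.
exact: Upsilon_brext (extF z).
Qed.

(** The analogue for the iterated quotients. *)
Lemma itclass_param n : Br irule n (X := paro hZ (itobj 0)) D f ->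
  forall k, (k <= n)%N ->
  Br irule (n - k) (pitdom (k := k))
    (fun zy => Phibar (slice zy.1) (fz zy.1) (k := k) zy.2) /\
  forall z, itclass (slice z) (fz z) k.
Proof.
move=> Bf; have cf z : cont_on (slice z) (fz z).
  apply: (@cont_on_comp _ _ _ _ D (fun x => (z, x)) f) (Br_cont Bf) => //.
  by move=> x _; exact: cont_slice.
have ext0 z : is_Phibar (slice z) (fz z) (k := 0) (fz z).
  by apply/(is_PhibarP _ (@slice_open z)); split => //; exact: cf.
have f0 z : is_Phibar (slice z) (fz z) (k := 0) (Phibar (slice z) (fz z) (k := 0)).
  exact: Phibar_ext (ext0 z).
elim=> [|k IH] kn.
  rewrite subn0; split.
    have Bf1 : Br irule n (X := paro hZ (itobj 0)) D
        (fun zy : Z * 'rV[K]_d => f (zy.1, zy.2)).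
      by apply: Br_eq Bf => // -[].
    have Bf2 : Br irule n (pitdom (k := 0)) (fun zy => f (zy.1, zy.2)).
      by apply: Br_sub Bf1; move=> [z x].
    apply: Br_eq Bf2; first exact: (@pitdom_open 0).
    by move=> [z x] Dx; exact: (is_Phibar_uniq (@slice_open z) (ext0 z) (f0 z)).
  move=> z; split; first exact/(within_cont_on _ (@slice_open z))/cf.
  by case=> // _; exists (fz z).
have [+ fk] := IH (ltnW kn); rewrite -subSS subSn //=.
move=> [cG [dG [dGE BdG]]].
pose F z (y : @itarg R K d k.+1) := dG ((z, y.1.1), y.1.2, y.2).
have TD (zy : paro hZ (itobj k.+1)) : pitdom (k := k.+1) zy ->
  Tset (r := irule) (pitdom (k := k)) ((zy.1, zy.2.1.1), zy.2.1.2, zy.2.2) by [].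
have BF := Br_lin (@irule_functorial R K) TD (lin_paro_it k) BdG.
have extF z : is_Phibar (slice z) (fz z) (k := k.+1) (F z).
  apply/(is_PhibarP _ (@slice_open z)); split.
    apply: (@cont_on_comp _ _ _ _ (pitdom (k := k.+1)) (fun y => (z, y)) _ _ _ (Br_cont BF)).
      by [].
    by move=> y _; exact: cont_slice.
  move=> y Dy [yr y0].
  have [_ /(_ k (leqnn k)) [G0 /Phibar_ext]] := fk z.
  move=> /(is_PhibarP _ (@slice_open z)) [_ PE].
  have [D1 D2] := Dy.
  have := dGE ((z, y.1.1), y.1.2, y.2) (conj D1 D2); rewrite /= /sh /= => dGE'.
  rewrite /= -PE ?itregular_shift // -PE // dGE'.
  by rewrite addrC addKr scalerA mulVf // scale1r.
split; last first.
  move=> z; have [c0 fk'] := fk z; split=> // m.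
  by rewrite leq_eqVlt => /orP [/eqP->|/fk' //]; exists (F z).
apply: Br_eq BF; first exact: (@pitdom_open k.+1).
move=> [z y] Dy; apply: (is_Phibar_uniq (@slice_open z) (extF z) _ Dy).
exact: Phibar_ext (extF z).
Qed.

End Families.

(** * Iterated quotients with variable vectors *)

Section IteratedFull.
Context {R : realType} {K : nonArchFieldType R}.
Notation obj := (@obj R K).
Variables (d e : nat).
Notation itarg := (@itarg R K d).
Notation V := 'rV[K]_d.
Notation vecV := (vec (@rV_tmod R K d)).

(** *** Arguments of iterated quotients with all their vectors variable *)

(** Increments of the base point and of all the vectors, the scalars being fixed. *)
Fixpoint finc (k : nat) : topologicalType :=
  if k is k'.+1 then (finc k' * V * 'rV[K]_0)%type else V.

Fixpoint fim (k : nat) : @tmod R K (finc k) :=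
  match k with
  | 0%N => rV_tmod d
  | k'.+1 => prod_tmod (prod_tmod (fim k') (rV_tmod d)) (rV_tmod 0)
  end.

Fixpoint fac (k : nat) : itarg k -> finc k -> itarg k :=
  match k with
  | 0%N => fun y w => y + w
  | k'.+1 => fun y w => (fac y.1.1 w.1.1, y.1.2 + w.1.2, y.2)
  end.

Lemma facA k y v w : @fac k y (ta (fim k) v w) = fac (fac y v) w.
Proof. by elim: k y v w => [|k IH] y v w /=; rewrite ?IH ?addrA. Qed.

Lemma fac0 k y : @fac k y (tz (fim k)) = y.
Proof.
elim: k y => [|k IH] /=; first by move=> y; rewrite addr0.
by move=> [[y v] t]; rewrite IH addr0.
Qed.

Lemma fac_inj k y : injective (@fac k y).
Proof.
elim: k y => [|k IH] y; first exact: addrI.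
move=> [[v w] u] [[v' w'] u'] /= [/IH-> /addrI->]; congr (_, _, _); exact: rV0_eq.
Qed.

Lemma fac_cont k : continuous (fun yv : itarg k * finc k => fac yv.1 yv.2).
Proof.
elim: k => [|k IH]; first exact: vnorm_addC.
apply: cont_pair; last by cont_proj.
apply: cont_pair; first by apply: (@cont_op2 _ _ _ _ (@fac k) _ _ IH); cont_proj.
by apply: (@cont_op2 _ _ _ _ (fun v w : V => v + w) _ _ (@vnorm_addC R K d)); cont_proj.
Qed.

Definition fobj k : obj :=
  @Obj R K (itarg k) (finc k) (fim k) (@fac k) (@facA k) (@fac0 k) (@fac_inj k)
    (@fac_cont k) (@itarg_hausdorff R K d k).

Notation Cf := (Cr (drule false)).
Notation Sf := (@scal R K false).

Lemma lin_fobjV k :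
  @lin _ _ (prodo (prodo (fobj k) vecV) Sf) (fobj k.+1) id (fun _ w => w).
Proof. by split => //=; [move=> y; exact: cvg_id|exact: cont_snd]. Qed.

Lemma lin_fobj k :
  @lin _ _ (fobj k.+1) (prodo (prodo (fobj k) vecV) Sf) id (fun _ w => w).
Proof. by split => //=; [move=> y; exact: cvg_id|exact: cont_snd]. Qed.

Section Smooth.
Variables (n : nat) (X : obj) (D : set X).

Lemma Cf_mk k (y : X -> fobj k) (v : X -> vecV) (t : X -> Sf) : Cf n D y -> Cf n D v ->
  Cf n D t -> Cf n D (fun x => (y x, v x, t x) : fobj k.+1).
Proof.
move=> cy cv ct; have c := Cr_compl (Cr_pair (Cr_pair cy cv) ct) (lin_fobjV k).
exact c.
Qed.

Lemma Cf_base k (y : X -> fobj k.+1) : Cf n D y -> Cf n D (fun x => (y x).1.1 : fobj k).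
Proof.
move=> cy; have c := Cr_compl cy
  (lin_comp (lin_comp (lin_fobj k) (lin_fst _ _)) (lin_fst _ _)).
exact c.
Qed.

Lemma Cf_vec k (y : X -> fobj k.+1) : Cf n D y -> Cf n D (fun x => (y x).1.2 : vecV).
Proof.
move=> cy; have c := Cr_compl cy
  (lin_comp (lin_comp (lin_fobj k) (lin_fst _ _)) (lin_snd _ _)).
exact c.
Qed.

Lemma Cf_scal k (y : X -> fobj k.+1) : Cf n D y -> Cf n D (fun x => (y x).2 : Sf).
Proof.
move=> cy; have c := Cr_compl cy (lin_comp (lin_fobj k) (lin_snd _ _)).
exact c.
Qed.

Lemma Cf_add (v w : X -> vecV) : Cf n D v -> Cf n D w -> Cf n D (fun x => v x + w x : vecV).
Proof. by move=> cv cw; have c := Cr_ta cv cw; exact c. Qed.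

Lemma Cf_scale (t : X -> Sf) (w : X -> vecV) :
  Cf n D t -> Cf n D w -> Cf n D (fun x => (t x : K) *: (w x : V) : vecV).
Proof. by move=> ct cw; have c := Cr_fun2 ct cw; exact c. Qed.

Lemma Cf_mul (t s : X -> Sf) :
  Cf n D t -> Cf n D s -> Cf n D (fun x => (t x : K) * (s x : K) : Sf).
Proof.
move=> ct cs.
have lm : @lin R K (prodo Sf Sf) Sf (fun y => (y.1 : K) * (y.2 : K)) (fun _ _ => 0).
  split => //=; first exact: nabs_mulC.
  - by move=> z; exact: cvg_const.
  - by move=> _ _ _; rewrite addr0.
  - by move=> _ t' _; rewrite scaler0.
have c := Cr_compl (Cr_pair ct cs) lm.
exact c.
Qed.

Lemma Cf_shift k (y : X -> fobj k) (v : X -> vecV) : Cf n D y -> Cf n D v ->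
  Cf n D (fun x => itshift (v x) (y x) : fobj k).
Proof.
elim: k y => [|k IH] y cy cv.
  have l : @lin R K (fobj 0) vecV id (fun _ w => w).
    by split => //=; [move=> z; exact: cvg_id|exact: cont_snd].
  have l' : @lin R K vecV (fobj 0) id (fun _ w => w).
    by split => //=; [move=> z; exact: cvg_id|exact: cont_snd].
  by have c := Cr_compl (Cf_add (Cr_compl cy l) cv) l'; exact c.
by have c := Cf_mk (IH _ (Cf_base cy) cv) (Cf_vec cy) (Cf_scal cy); exact c.
Qed.

End Smooth.

(** *** Changing one vector of an iterated quotient *)

(** Slots are numbered from the last vector. *)

Fixpoint slot_add (k j : nat) : itarg k -> V -> itarg k :=
  match k with
  | 0%N => fun y _ => y
  | k'.+1 => fun y w => match j with
      | 0%N => (y.1.1, y.1.2 + w, y.2)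
      | j'.+1 => (slot_add j' y.1.1 w, y.1.2, y.2)
      end
  end.

(** The argument of the quotient of order k in the increment s w of the j-th vector:
    as x moves by t (v + s w) through x + t v, the vector w is the increment of a
    quotient at x + t v with scalar t s. *)
Fixpoint slot_der (k j : nat) : itarg k -> V -> K -> itarg k :=
  match k with
  | 0%N => fun y _ _ => y
  | k'.+1 => fun y w s => match j with
      | 0%N => (itshift (y.2 *: y.1.2) y.1.1, w, y.2 * s)
      | j'.+1 => (slot_der j' y.1.1 w s, y.1.2, y.2)
      end
  end.

Lemma Cf_slot_add n (X : obj) D k j (y : X -> fobj k) (w : X -> vecV) :
  Cf n D y -> Cf n D w -> Cf n D (fun x => slot_add j (y x) (w x) : fobj k).
Proof.
elim: k j y => [|k IH] [|j] y cy cw //=.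
  by have c := Cf_mk (Cf_base cy) (Cf_add (Cf_vec cy) cw) (Cf_scal cy); exact c.
by have c := Cf_mk (IH j _ (Cf_base cy) cw) (Cf_vec cy) (Cf_scal cy); exact c.
Qed.

Lemma Cf_slot_der n (X : obj) D k j (y : X -> fobj k) (w : X -> vecV) (s : X -> Sf) :
  Cf n D y -> Cf n D w -> Cf n D s ->
  Cf n D (fun x => slot_der j (y x) (w x) (s x) : fobj k).
Proof.
elim: k j y => [|k IH] [|j] y cy cw cs //=.
  have cb := Cf_shift (Cf_base cy) (Cf_scale (Cf_scal cy) (Cf_vec cy)).
  by have c := Cf_mk cb cw (Cf_mul (Cf_scal cy) cs); exact c.
by have c := Cf_mk (IH j _ (Cf_base cy) cw cs) (Cf_vec cy) (Cf_scal cy); exact c.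
Qed.

Lemma slot_add_shift k j (y : itarg k) w v :
  itshift v (slot_add j y w) = slot_add j (itshift v y) w.
Proof. by elim: k j y => [|k IH] [|j] y //=; rewrite IH. Qed.

Lemma slot_der_shift k j (y : itarg k) w s v :
  itshift v (slot_der j y w s) = slot_der j (itshift v y) w s.
Proof.
elim: k j y => [|k IH] [|j] y //=; rewrite ?IH //.
by rewrite -!itshiftD addrC.
Qed.

Variables (F : forall k, itarg k -> 'rV[K]_e) (n : nat).
Hypothesis F_cont : forall k, (k <= n)%N -> continuous (@F k).
Hypothesis F_quot : forall k, (k < n)%N -> forall y : itarg k.+1,
  F (itshift (y.2 *: y.1.2) y.1.1) = F y.1.1 + y.2 *: F y.

Lemma scalar_uniq (u v : K -> 'rV[K]_e) : continuous u -> continuous v ->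
  (forall t, t != 0 -> u t = v t) -> forall t, u t = v t.
Proof.
move=> cu cv uv t; have [->|/uv //] := eqVneq t 0.
apply: (cvg_uniq (@vnorm_hausdorff _ _ _) (cu _) (cv _)) => N /nbhs0_neq0 [s s0 Ns].
by exists s; rewrite ?uv.
Qed.

Lemma cont_lincomb (T : topologicalType) (u v : T -> 'rV[K]_e) (s : K) :
  continuous u -> continuous v -> continuous (fun t => u t + s *: v t).
Proof.
move=> cu cv; apply: (@cont_op2 _ _ _ _ (fun a b : 'rV[K]_e => a + b) _ _ (@vnorm_addC R K e)) => //.
have cs : continuous (fun _ : T => s) by move=> t; exact: cvg_const.
exact: (@cont_op2 T K 'rV[K]_e 'rV[K]_e (fun a b => a *: b) _ _ (@vnorm_scaleC R K e) cs cv).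
Qed.

(** An increment of one vector moves the iterated quotient by a quotient of the same
    order. For nonzero t this is the telescoping of the increment t (v + s w) of the
    base point; the case t = 0 follows by density. *)
Lemma slot_quot k j : (j < k <= n)%N -> forall (y : itarg k) w s,
  F (slot_add j y (s *: w)) = F y + s *: F (slot_der j y w s).
Proof.
elim: k j => [|k IH] // [|j] /andP [jk kn] [[y v] t] w s /=.
  apply: (@scalar_uniq (fun t => F ((y, v + s *: w, t) : itarg k.+1))
    (fun t => F ((y, v, t) : itarg k.+1) +
      s *: F ((itshift (t *: v) y, w, t * s) : itarg k.+1))).
  - apply: (cont_comp _ (F_cont kn)).
    by apply: cont_pair => x; [exact: cvg_const|exact: cvg_id].
  - apply: cont_lincomb.
      apply: (cont_comp _ (F_cont kn)).
      by apply: cont_pair => x; [exact: cvg_const|exact: cvg_id].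
    apply: (cont_comp _ (F_cont kn)).
    apply: cont_pair; last first.
      apply: (@cont_op2 _ _ _ _ (fun a b : K => a * b) _ _ (@nabs_mulC R K)) => x;
        [exact: cvg_id|exact: cvg_const].
    apply: cont_pair; last by move=> x; exact: cvg_const.
    apply: (@cont_op2 _ _ _ _ (fun y v => itshift v y) _ _ (@itshift_cont R K d k)).
      by move=> x; exact: cvg_const.
    have cid : continuous (fun t : K => t) by move=> x; exact: cvg_id.
    have cv : continuous (fun _ : K => v) by move=> x; exact: cvg_const.
    exact: (@cont_op2 K K V V (fun a b => a *: b) _ _ (@vnorm_scaleC R K d) cid cv).
  move=> {}t t0; apply: (scalerI t0); rewrite scalerDr scalerA.
  have /= q1 := F_quot kn ((y, v + s *: w, t) : itarg k.+1).
  have /= q2 := F_quot kn ((y, v, t) : itarg k.+1).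
  have /= q3 := F_quot kn ((itshift (t *: v) y, w, t * s) : itarg k.+1).
  move: q1; rewrite scalerDr itshiftD scalerA q3 q2 -addrA => /addrI <-.
  by [].
apply: (@scalar_uniq (fun t => F ((slot_add j y (s *: w), v, t) : itarg k.+1))
    (fun t => F ((y, v, t) : itarg k.+1) +
      s *: F ((slot_der j y w s, v, t) : itarg k.+1))).
- apply: (cont_comp _ (F_cont kn)).
  by apply: cont_pair => x; [exact: cvg_const|exact: cvg_id].
- by apply: cont_lincomb; apply: (cont_comp _ (F_cont kn));
    apply: cont_pair => x; try exact: cvg_const; exact: cvg_id.
move=> {}t t0; apply: (scalerI t0); rewrite scalerDr scalerA.
have /= q1 := F_quot kn ((slot_add j y (s *: w), v, t) : itarg k.+1).
have /= q2 := F_quot kn ((y, v, t) : itarg k.+1).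
have /= q3 := F_quot kn ((slot_der j y w s, v, t) : itarg k.+1).
have jkn : (j < k <= n)%N by rewrite -ltnS jk ltnW.
move: q1; rewrite slot_add_shift !IH // -slot_der_shift q2 q3.
rewrite scalerDr scalerA !addrA (addrAC _ (t *: _)) -!addrA => /addrI/addrI.
by rewrite mulrC => <-.
Qed.

(** *** Changing all the vectors, one after the other *)

Fixpoint ibase (k : nat) : finc k -> V :=
  match k with 0%N => id | k'.+1 => fun i => ibase i.1.1 end.

Fixpoint icomp (k j : nat) : finc k -> V :=
  match k with
  | 0%N => fun _ => 0
  | k'.+1 => fun i => if j is j'.+1 then icomp j' i.1.1 else i.1.2
  end.

(** The base point and the last j vectors have been moved. *)
Fixpoint partial (k j : nat) (y : itarg k) (i : finc k) (s : K) : itarg k :=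
  if j is j'.+1 then slot_add j' (partial j' y i s) (s *: icomp j' i)
  else itshift (s *: ibase i) y.

Lemma partialS k j (y : itarg k.+1) i s : partial j.+1 y i s =
  (partial j y.1.1 i.1.1 s, y.1.2 + s *: i.1.2, y.2).
Proof.
elim: j => [|j IH] //.
by rewrite -[LHS]/(slot_add j.+1 (partial j.+1 y i s) (s *: icomp j.+1 i)) IH.
Qed.

Lemma partial_all k (y : itarg k) i s : partial k y i s = fac y (ts (fim k) s i).
Proof. by elim: k y i => [|k IH] y i //; rewrite partialS IH. Qed.

(** The quotient in all the vectors and the base point: a sum over the variables,
    which are moved one after the other. *)
Definition fder k (z : To (drule false) (fobj k)) : 'rV[K]_e :=
  F ((z.1.1, ibase z.1.2, z.2) : itarg k.+1) +
  \sum_(j < k) F (slot_der j (partial j z.1.1 z.1.2 z.2) (icomp j z.1.2) z.2).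

Lemma fderE k (z : To (drule false) (fobj k)) : (k < n)%N ->
  F (sh (rb z) (rv z) (rt z)) = F (rb z) + rt z *: fder z.
Proof.
move=> kn; case: z => [[y i] s]; rewrite /sh /= -partial_all /fder /= scalerDr addrA.
have /= <- := F_quot kn ((y, ibase i, s) : itarg k.+1).
rewrite scaler_sumr.
suff -> : forall m, (m <= k)%N -> F (partial m y i s) = F (itshift (s *: ibase i) y) +
    \sum_(j < m) s *: F (slot_der j (partial j y i s) (icomp j i) s) by [].
elim=> [|m IH] mk; first by rewrite big_ord0 addr0.
by rewrite big_ord_recr /= addrA -IH 1?ltnW // slot_quot // mk ltnW.
Qed.

Lemma Cf_ibase m (X : obj) D k (i : X -> vec (fim k)) :
  Cf m D i -> Cf m D (fun x => ibase (i x) : vecV).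
Proof.
elim: k i => [|k IH] i ci //=; apply: IH.
have l : @lin R K (vec (fim k.+1)) (vec (fim k)) (fun w => w.1.1) (fun _ w => w.1.1).
  by split => //=; cont_proj.
by have c := Cr_compl ci l; exact c.
Qed.

Lemma Cf_icomp m (X : obj) D k j (i : X -> vec (fim k)) :
  Cf m D i -> Cf m D (fun x => icomp j (i x) : vecV).
Proof.
elim: k j i => [|k IH] j i ci /=.
  have l : @lin R K (vec (fim 0)) vecV (fun=> 0) (fun _ _ => 0).
    split => //=; try by move=> x; exact: cvg_const.
    - by move=> _ _; rewrite addr0.
    - by move=> _ _ _; rewrite addr0.
    - by move=> _ t _; rewrite scaler0.
  by have c := Cr_compl ci l; exact c.
case: j => [|j].
  have l : @lin R K (vec (fim k.+1)) vecV (fun w => w.1.2) (fun _ w => w.1.2).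
    by split => //=; cont_proj.
  by have c := Cr_compl ci l; exact c.
apply: IH.
have l : @lin R K (vec (fim k.+1)) (vec (fim k)) (fun w => w.1.1) (fun _ w => w.1.1).
  by split => //=; cont_proj.
by have c := Cr_compl ci l; exact c.
Qed.

Lemma Cf_partial m (X : obj) D k j (y : X -> fobj k) (i : X -> vec (fim k)) (s : X -> Sf) :
  Cf m D y -> Cf m D i -> Cf m D s ->
  Cf m D (fun x => partial j (y x) (i x) (s x) : fobj k).
Proof.
move=> cy ci cs; elim: j => [|j IH] /=.
  exact: Cf_shift cy (Cf_scale cs (Cf_ibase ci)).
exact: Cf_slot_add IH (Cf_scale cs (Cf_icomp j ci)).
Qed.

Lemma Br_comp_Cf m (X : obj) D k (a : X -> fobj k) (g : itarg k -> 'rV[K]_e) :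
  Cf m D a -> Br (drule false) m (X := fobj k) setT g -> Br (drule false) m D (fun x => g (a x)).
Proof.
move=> ca Bg; have c := Cr_comp (E := setT) (fun _ _ => I) ca (Br_Cr Bg).
exact (Cr_Br c).
Qed.

Lemma Br_sum (r : @rule R K) m (X : obj) (D : set X) k (g : nat -> X -> 'rV[K]_e) :
  has_proj r -> Br r m D (fun=> 0 : 'rV[K]_e) -> (forall j, (j < k)%N -> Br r m D (g j)) ->
  Br r m D (fun x => \sum_(j < k) g j x).
Proof.
move=> Tp B0; elim: k => [|k IH] Bg.
  rewrite (_ : (fun x => _) = fun=> 0 : 'rV[K]_e) //.
  by apply/funext => x; rewrite big_ord0.
rewrite (_ : (fun x => _) = fun x => \sum_(j < k) g j x + g k x).
  apply: Br_add; last exact: Bg.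
  by apply: IH => j jk; apply: Bg; rewrite ltnS ltnW.
by apply/funext => x; rewrite big_ord_recr.
Qed.

Lemma Br_zero (r : @rule R K) m (X : obj) (D : set X) : Br r m D (fun=> 0 : 'rV[K]_e).
Proof.
elim: m X D => [|m IH] X D; first by move=> x _; exact: cvg_const.
split; first by move=> x _; exact: cvg_const.
by exists (fun=> 0); split=> // y _; rewrite scaler0 addr0.
Qed.

(** Iterated quotients in the base point have iterated quotients in all the vectors,
    because the latter are sums of iterated quotients in the base point. *)
Theorem iterated_full m k : (m + k <= n)%N -> Br (drule false) m (X := fobj k) setT (@F k).
Proof.
elim: m k => [|m IH] k mk; first by move=> y _; exact: F_cont.
have kn : (k < n)%N by rewrite (leq_trans _ mk) // addSn ltnS leq_addl.
split; first by move=> y _; apply: F_cont; exact: ltnW.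
exists (@fder k); split; first by move=> z _; exact: fderE.
have cb := Cr_lin (@drule_functorial R K false) m (Tset [set: fobj k]) (lin_Tbase false (fobj k)).
have ci := Cr_lin (@drule_functorial R K false) m (Tset [set: fobj k]) (lin_Tincr false (fobj k)).
have ct := Cr_lin (@drule_functorial R K false) m (Tset [set: fobj k]) (lin_Tscal false (fobj k)).
apply: Br_add.
  have a := Cf_mk cb (Cf_ibase ci) ct.
  by have c := Br_comp_Cf a (IH k.+1 _); apply: c; rewrite addnS -addSn.
apply: (@Br_sum _ m _ _ k (fun j (z : To (drule false) (fobj k)) =>
   F (slot_der j (partial j z.1.1 z.1.2 z.2) (icomp j z.1.2) z.2))).
- exact: drule_proj.
- exact: Br_zero.
- move=> j _; have a := Cf_slot_der j (Cf_partial j cb ci ct) (Cf_icomp j ci) ct.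
  by have c := Br_comp_Cf a (IH k _); apply: c; rewrite (leq_trans _ mk) // addSn.
Qed.

End IteratedFull.

(** * Smooth maps and the closeness of their quotients *)

Section SmoothClasses.
Context {R : realType} {K : nonArchFieldType R}.
Notation obj := (@obj R K).
Notation vecR d := (vec (@rV_tmod R K d)).

Lemma vball_open d (x : 'rV[K]_d) (r : R) : open [set y | vnorm (x - y) < r].
Proof.
rewrite openE => y /= xy; have r0 : 0 < r by apply: le_lt_trans xy; exact: vnorm_ge0.
apply: filterS (near_vnorm y r0) => z /= yz; exact: vdist_lt xy yz.
Qed.

Lemma vball_closed d (x : 'rV[K]_d) (r : R) : closed [set y | vnorm (x - y) < r].
Proof.
move=> y yc; have [z [/= z1 _]] := yc _ filterT.
have r0 : 0 < r by apply: le_lt_trans z1; exact: vnorm_ge0.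
have [w [/= xw yw]] := yc _ (near_vnorm y r0).
by apply: vdist_lt xw _; rewrite vnorm_distC.
Qed.

Lemma itdomT d k (y : itarg d k) : itdom [set: 'rV[K]_d] y.
Proof. by elim: k y => [|k IH] //=. Qed.

Lemma itclass_of_Br d e n (f : 'rV[K]_d -> 'rV[K]_e) :
  Br irule n (X := itobj d 0) setT f -> itclass setT f n.
Proof.
move=> Bf; have hZ := @vnorm_hausdorff R K 0.
have l : @lin R K (paro hZ (itobj d 0)) (itobj d 0) snd (fun _ v => v).
  by split => //=; [exact: cont_snd|exact: cont_snd].
have Bp := Br_lin (@irule_functorial R K) (D := setT) (fun _ _ => I) l Bf.
have [_ fz] := itclass_param openT Bp (leqnn n).
exact: fz 0.
Qed.

(** Locally f is extended by zero from a clopen ball to the whole space, where all the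
    arguments of the quotients are admissible. *)
Theorem itclass_full d e n (U : set 'rV[K]_d) (f : 'rV[K]_d -> 'rV[K]_e) :
  open U -> itclass U f n -> Br (drule false) n (X := vecR d) U f.
Proof.
move=> oU fU; apply: (Br_local (@drule_quotients R K false)) => // x Ux.
have [r r0 rU] := (nbhs_vnormP _ _).1 (open_nbhs_nbhs (conj oU Ux)).
pose E : set (vecR d) := [set y : 'rV[K]_d | vnorm (x - y) < r].
have oE : open E := @vball_open d x r.
exists E; split; [exact: oE|by rewrite /E /= subrr vnorm0|].
pose f1 (y : 'rV[K]_d) := if vnorm (x - y) < r then f y else 0.
have Bf1 : Br irule n (X := itobj d 0) setT f1.
  apply: (Br_local (@irule_quotients R K)); first exact: openT.
  move=> y _; have [Ey|Ey] := boolP (vnorm (x - y) < r).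
    exists E; split=> //.
    have B0 : Br irule n (X := itobj d 0) E (Phibar U f (k := 0)).
      by apply: Br_sub (itclass_Br (k := 0) (j := n) oU fU _) => //; rewrite addn0.
    by apply: Br_eq B0 => // z Ez; rewrite (Phibar0 oU fU) /f1 ?Ez //; exact: rU.
  exists (~` E); split; [by apply: closed_openC; exact: vball_closed|exact/negP|].
  apply: (@Br_eq _ _ irule n (itobj d 0) e (~` E) (fun=> 0)).
  - by apply: closed_openC; exact: vball_closed.
  - by move=> z /negP nEz; rewrite /f1 (negbTE nEz).
  - exact: Br_zero.
have I1 := itclass_of_Br Bf1.
pose F k := Phibar setT f1 (k := k).
have PF k : (k <= n)%N -> is_Phibar setT f1 (F k).
  by move=> kn; have [_ /(_ k kn) [G]] := I1; exact: Phibar_ext.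
have cF k : (k <= n)%N -> continuous (F k).
  by move=> /PF /(is_PhibarP _ openT) [cF _] y; apply: cF; exact: itdomT.
have qF k : (k < n)%N -> forall y : itarg d k.+1,
    F k (itshift (y.2 *: y.1.2) y.1.1) = F k y.1.1 + y.2 *: F k.+1 y.
  move=> kn y; apply: (Phibar_quot openT (PF _ (ltnW kn)) (PF _ kn)).
  exact: (@itdomT _ k.+1).
have B := iterated_full cF qF (m := n) (k := 0).
have l : @lin R K (vecR d) (fobj d 0) id (fun _ w => w).
  by split => //=; [move=> z; exact: cvg_id|exact: cont_snd].
have BF : Br (drule false) n (X := vecR d) E (F 0%N).
  have Bl := Br_lin (@drule_functorial R K false) (D := E) (E := setT) (fun _ _ => I) l
    (B (eq_leq (addn0 n))).
  exact Bl.
apply: Br_eq BF => // z Ez; rewrite /F (Phibar0 openT I1) //.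
by rewrite /f1 ifT.
Qed.

(** Both classes have difference quotients with variable vectors, for which the chain
    rule holds. *)
Definition smooth_rule (alpha : smoothness) : @rule R K :=
  match alpha with Citer _ => drule false | Cbrack _ => drule true end.

Theorem smooth_Br alpha d e (U : set 'rV[K]_d) (f : 'rV[K]_d -> 'rV[K]_e) :
  open U -> smooth alpha U f ->
  Br (smooth_rule alpha) (smooth_order alpha) (X := vecR d) U f.
Proof.
case: alpha => n oU /= fU; first exact: itclass_full.
exact: (brclass_Br oU fU (eq_leq (addn0 n))).
Qed.

(** *** Restriction of difference quotients *)

(** Quotients are determined by the map, and hence compatible with restriction. *)
Lemma Upsilon_sub d e n (O U : set 'rV[K]_d) (f : 'rV[K]_d -> 'rV[K]_e) k :
  open O -> open U -> O `<=` U -> brclass U f n -> (k <= n)%N ->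
  brclass O f k /\ forall y, brdom O y -> Upsilon O f (k := k) y = Upsilon U f (k := k) y.
Proof.
move=> oO oU OU fU; elim: k => [|k IH] kn.
  split=> //; apply/(within_cont_on _ oO); apply: cont_on_sub OU _.
  exact: brclass_cont fU.
have [fO eqO] := IH (ltnW kn); have [cU UE] := brclass_brext kn fU.
have ext : is_brext O (Upsilon O f (k := k)) (Upsilon U f (k := k.+1)).
  split.
    apply/(within_cont_on _ (@brdom_open _ _ _ _ k.+1 oO)).
    apply: (cont_on_sub (@brdom_sub _ _ _ _ _ k.+1 OU)).
    exact/(within_cont_on _ (@brdom_open _ _ _ _ k.+1 oU)).
  move=> y Dy y0; rewrite (UE _ (@brdom_sub _ _ _ _ _ k.+1 OU _ Dy) y0) /brquot.
  by have [D1 D2] := Dy; rewrite !eqO.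
split; first by split=> //; exists (Upsilon U f (k := k.+1)).
exact: (brext_uniq oO (Upsilon_brext ext) ext).
Qed.

Lemma Phibar_sub d e n (O U : set 'rV[K]_d) (f : 'rV[K]_d -> 'rV[K]_e) :
  open O -> open U -> O `<=` U -> itclass U f n ->
  itclass O f n /\ forall k, (k <= n)%N ->
    forall y, itdom O y -> Phibar O f (k := k) y = Phibar U f (k := k) y.
Proof.
move=> oO oU OU [cU fU].
have ext k : (k <= n)%N -> is_Phibar O f (Phibar U f (k := k)).
  move=> /fU [G /Phibar_ext /(is_PhibarP _ oU) [cG GE]]; apply/(is_PhibarP _ oO); split.
    exact: cont_on_sub (@itdom_sub _ _ _ _ _ k OU) cG.
  by move=> y /(@itdom_sub _ _ _ _ _ k OU); exact: GE.
split; last by move=> k /ext ek y Dy; exact: (is_Phibar_uniq oO (Phibar_ext ek) ek Dy).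
split; last by move=> k /ext ek; eexists; exact: ek.
apply/(within_cont_on _ oO); apply: cont_on_sub OU _.
exact/(within_cont_on _ oU).
Qed.

Lemma smooth_sub alpha d e (O U : set 'rV[K]_d) (f : 'rV[K]_d -> 'rV[K]_e) :
  open O -> open U -> O `<=` U -> smooth alpha U f -> smooth alpha O f.
Proof.
case: alpha => n oO oU OU fU; first by have [] := Phibar_sub oO oU OU fU.
by have [] := Upsilon_sub oO oU OU fU (leqnn n).
Qed.

Lemma close_on0 alpha d e (O : set 'rV[K]_d) rho eps (f g : 'rV[K]_d -> 'rV[K]_e) :
  open O -> 0 < eps -> smooth alpha O f -> smooth alpha O g ->
  close_on alpha 0 O rho eps f g -> forall x, O x -> vnorm (f x - g x) < eps.
Proof.
case: alpha => n oO e0 /= fO gO fg x Ox; apply/ball_vnormP => //.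
  by rewrite -(Phibar0 oO fO) // -(Phibar0 oO gO) //; exact: fg.
exact: fg.
Qed.

(** Closeness of the first quotients bounds the Lipschitz constant of the difference. *)
Lemma close_on1 alpha d e (O : set 'rV[K]_d) rho eps (f g : 'rV[K]_d -> 'rV[K]_e) :
  open O -> 0 < eps -> (0 < smooth_order alpha)%N -> smooth alpha O f -> smooth alpha O g ->
  close_on alpha 1 O rho eps f g ->
  forall x v t, O x -> O (x + t *: v) -> vnorm v <= rho -> t != 0 -> nabs t <= 1 ->
  vnorm ((f (x + t *: v) - f x) - (g (x + t *: v) - g x)) < nabs t * eps.
Proof.
case: alpha => -[//|n] oO e0 _ fO gO fg x v t Ox Oy vr t0 t1;
  have t_gt0 : 0 < nabs t by rewrite nabs_gt0.
- have PE (h : 'rV[K]_d -> 'rV[K]_e) : itclass O h n.+1 ->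
      Phibar O h (k := 1) (x, v, t) = t^-1 *: (h (x + t *: v) - h x).
    move=> [_ /(_ 1%N isT) [H /Phibar_ext /(is_PhibarP _ oO) [_ HE]]].
    by rewrite HE.
  have : ball (Phibar O f (k := 1) (x, v, t)) eps (Phibar O g (k := 1) (x, v, t)).
    exact: fg.
  rewrite !PE //.
  move=> /ball_vnormP-/(_ e0); rewrite -scalerBr vnormZ nabsV mulrC ltr_pdivrMr //.
  by rewrite mulrC.
- have PE (h : 'rV[K]_d -> 'rV[K]_e) : brclass O h n.+1 ->
      Upsilon O h (k := 1) (x, v, t) = t^-1 *: (h (x + t *: v) - h x).
    by move=> hO; have [_ HE] := brclass_brext (ltn0Sn n) hO; rewrite HE.
  have : ball (Upsilon O f (k := 1) (x, v, t)) eps (Upsilon O g (k := 1) (x, v, t)).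
    exact: fg.
  rewrite !PE //.
  move=> /ball_vnormP-/(_ e0); rewrite -scalerBr vnormZ nabsV mulrC ltr_pdivrMr //.
  by rewrite mulrC.
Qed.

(** *** Compact sets of arguments *)

Section Compact.
Hypothesis K_lc : locally_compact [set: K].
Variable d : nat.
Notation brarg := (@brarg R K d).
Notation itarg := (@itarg R K d).
Variables (C : set 'rV[K]_d) (rho : R).
Hypotheses (clC : closed C) (cC : compact C).

Lemma compact_prod3 (A B D : topologicalType) (P : set A) (Q : set B) (S : set D) :
  compact P -> compact Q -> compact S ->
  compact [set y : A * B * D | [/\ P y.1.1, Q y.1.2 & S y.2]].
Proof.
move=> cP cQ cS; rewrite (_ : mkset _ = (P `*` Q) `*` S).
  by apply: compact_setX => //; exact: compact_setX.
by apply/seteqP; split=> -[[a b] s] /= => [[]|[[]]].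
Qed.

Lemma compact_brincr k : compact (brincr rho (k := k) : set (brarg k)).
Proof.
elim: k => [|k IH]; first exact: (@compact_vnorm_le _ _ K_lc d rho).
exact: (compact_prod3 IH IH (@compact_nabs_le _ _ K_lc 1)).
Qed.

(** A compact set which contains the arguments that enter in [close_on]. *)
Fixpoint brbox (k : nat) : set (brarg k) :=
  match k with
  | 0%N => C
  | k'.+1 => [set y | [/\ brbox y.1.1, brincr rho y.1.2 & nabs y.2 <= 1]]
  end.

Fixpoint itbox (k : nat) : set (itarg k) :=
  match k with
  | 0%N => C
  | k'.+1 => [set y | [/\ itbox y.1.1, vnorm y.1.2 <= rho & nabs y.2 <= 1]]
  end.

Lemma compact_brbox k : compact (brbox (k := k)).
Proof.
elim: k => [|k IH] //.
exact: (compact_prod3 IH (@compact_brincr k) (@compact_nabs_le _ _ K_lc 1)).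
Qed.

Lemma compact_itbox k : compact (itbox (k := k)).
Proof.
elim: k => [|k IH] //.
exact: (compact_prod3 IH (@compact_vnorm_le _ _ K_lc d rho) (@compact_nabs_le _ _ K_lc 1)).
Qed.

Lemma closed_pre (A B : topologicalType) (g : A -> B) (E : set B) :
  continuous g -> closed E -> closed (g @^-1` E).
Proof. by move=> cg cE; apply: preimage_closed => // y _; exact: cg. Qed.

Lemma closed_brdom k : closed (brdom C (k := k)).
Proof.
elim: k => [|k IH] //; rewrite brdomS; apply: closedI.
  exact: (closed_pre (@rb_cont _ _ (drule true) (brobj d k)) IH).
exact: (closed_pre (@cont_sh _ _ (drule true) (brobj d k)) IH).
Qed.

Lemma closed_itdom k : closed (itdom C (k := k)).
Proof.
elim: k => [|k IH] //; rewrite itdomS; apply: closedI.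
  exact: (closed_pre (@rb_cont _ _ irule (itobj d k)) IH).
exact: (closed_pre (@cont_sh _ _ irule (itobj d k)) IH).
Qed.

Lemma brbox_bound k (y : brarg k) : brdom C y -> brbound rho y -> brbox y.
Proof. by elim: k y => [|k IH] //= y [y1 _] [/(IH _ y1)]. Qed.

Lemma itbox_bound k (y : itarg k) : itdom C y -> itbound rho y -> itbox y.
Proof. by elim: k y => [|k IH] //= y [y1 _] [/(IH _ y1)]. Qed.

End Compact.

Section JointlySmooth.
Hypothesis K_lc : locally_compact [set: K].
Variables (Z : topologicalType) (hZ : hausdorff_space Z) (alpha : smoothness).
Variables (d e : nat) (D : set (Z * 'rV[K]_d)) (f : Z * 'rV[K]_d -> 'rV[K]_e).
Hypothesis oD : open D.
Hypothesis Bf : Br (smooth_rule alpha) (smooth_order alpha) (X := paro hZ (vecR d)) D f.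
Local Notation fz z := (fun x => f (z, x)).

Lemma Bf_iter n : alpha = Citer n -> Br irule n (X := paro hZ (itobj d 0)) D f.
Proof.
move=> an; have := Bf; rewrite an /= => /Br_full_iter B.
have l : @lin R K (paro hZ (itobj d 0)) (paro hZ (vecR d)) id (fun _ w => w).
  by split => //=; [move=> z; exact: cvg_id|exact: cont_snd].
have Bl := Br_lin (@irule_functorial R K) (D := D : set (paro hZ (itobj d 0)))
  (fun _ Dz => Dz) l B.
exact Bl.
Qed.

Lemma smooth_slice z : smooth alpha (slice D z) (fz z).
Proof.
case E : alpha => [n|n] /=.
  by have [_] := itclass_param oD (Bf_iter E) (leqnn n); exact.
have := Bf; rewrite E /= => B.
by have [_] := brclass_param oD B (leqnn n); exact.
Qed.

(** Joint continuity of the quotients in the parameter and the arguments is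
    uniform on the compact sets of arguments. *)
Lemma near_uniform (A : topologicalType) (E : set (Z * A)) (G : Z * A -> 'rV[K]_e)
    (Q : set A) (z0 : Z) eps : 0 < eps -> compact Q -> open E ->
  (forall y, Q y -> E (z0, y)) -> cont_on E G ->
  \forall z \near z0, forall y, Q y -> E (z, y) /\ vnorm (G (z0, y) - G (z, y)) < eps.
Proof.
move=> e0 cQ oE QE cG.
pose P z y := E (z, y) /\ vnorm (G (z0, y) - G (z, y)) < eps.
suff : \forall z \near z0, Q `<=` P z by apply: filterS => z QP y /QP.
apply: ((compact_near_coveringP Q).1 cQ) => y Qy.
have Ey := QE _ Qy.
have near1 : \forall zy \near (z0, y), E zy /\ vnorm (G (z0, y) - G zy) < eps.
  apply: filterI; first exact: open_nbhs_nbhs.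
  by have /cvg_vnormP := cG _ Ey; apply.
have near2 : \forall y' \near y, vnorm (G (z0, y) - G (z0, y')) < eps.
  have n1 : nbhs y [set y' | E (z0, y') /\ vnorm (G (z0, y) - G (z0, y')) < eps].
    exact: (@cont_slice Z A z0 y _ near1).
  by apply: filterS n1 => y' [].
have [[N1 N2] /= [zN1 yN2] sN] := near1.
exists ([set y' | N2 y' /\ vnorm (G (z0, y) - G (z0, y')) < eps], N1).
  by split=> //=; exact: filterI.
move=> [y' z] [/= [N2y' yy'] N1z]; have [Ez zy'] := sN (z, y') (conj N1z N2y').
split=> //; apply: vdist_lt zy'.
by rewrite vnorm_distC.
Qed.

(** The quotients of the slices are continuous in the parameter, uniformly on compact
    sets of arguments. *)
Lemma close_near (O : set 'rV[K]_d) k rho eps z0 : open O -> vbounded O ->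
  closure O `<=` slice D z0 -> (k <= smooth_order alpha)%N -> 0 < eps ->
  \forall z \near z0, closure O `<=` slice D z /\ close_on alpha k O rho eps (fz z0) (fz z).
Proof.
move=> oO [r Or] OD kn e0.
have clO : closed (closure O) by exact: closed_closure.
have cO : compact (closure O).
  have Or' x : closure O x -> vnorm x <= r.
    by move=> xO; apply: (@closed_vnorm_le _ _ d r); apply: closureS xO => y; exact: Or.
  exact (compact_vbounded K_lc clO Or').
have inO : O `<=` closure O by exact: subset_closure.
have nearD : \forall z \near z0, closure O `<=` slice D z.
  have := near_uniform e0 cO oD OD (Br_cont Bf).
  by apply: filterS => z H y /H [].
suff nearS : \forall z \near z0, closure O `<=` slice D z ->
    close_on alpha k O rho eps (fz z0) (fz z).
  by apply: filterS2 nearD nearS => z h1 h2; split=> //; exact: h2.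
case E : alpha kn => [n|n] /= kn.
  have [B fk] := itclass_param oD (Bf_iter E) kn.
  pose Q := itdom (closure O) (k := k) `&` itbox (closure O) rho (k := k).
  have cQ : compact Q.
    rewrite /Q setIC; apply: compact_closedI; last exact: closed_itdom.
    exact: compact_itbox.
  have QE y : Q y -> pitdom (hZ := hZ) D (k := k) (z0, y).
    by move=> [y1 _]; exact: (@itdom_sub _ _ _ _ _ k OD).
  have := near_uniform e0 cQ (@pitdom_open _ _ _ _ hZ _ oD k) QE (Br_cont B).
  apply: filterS => z near Oz y yO yb.
  have Qy : Q y.
    have yc : itdom (closure O) y by exact: (@itdom_sub _ _ _ _ _ k inO).
    by split=> //; exact: itbox_bound yb.
  have [_] := near y Qy.
  have E1 w : closure O `<=` slice D w ->
      Phibar O (fz w) y = Phibar (slice D w) (fz w) y.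
    move=> Ow; have [_ H] := Phibar_sub oO (@slice_open _ _ _ _ _ oD w)
      (subset_trans inO Ow) (fk w).
    exact: H.
  by move=> h; apply/ball_vnormP => //; rewrite !E1.
have := Bf; rewrite E /= => Bf'.
have [B fk] := brclass_param oD Bf' kn.
pose Q := brdom (closure O) (k := k) `&` brbox (closure O) rho (k := k).
have cQ : compact Q.
  rewrite /Q setIC; apply: compact_closedI; last exact: closed_brdom.
  exact: compact_brbox.
have QE y : Q y -> pbrdom (hZ := hZ) D (k := k) (z0, y).
  by move=> [y1 _]; exact: (@brdom_sub _ _ _ _ _ k OD).
have := near_uniform e0 cQ (@pbrdom_open _ _ _ _ hZ _ oD k) QE (Br_cont B).
apply: filterS => z near Oz y yO yb.
have Qy : Q y.
  have yc : brdom (closure O) y by exact: (@brdom_sub _ _ _ _ _ k inO).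
  by split=> //; exact: brbox_bound yb.
have [_] := near y Qy.
have E1 w : closure O `<=` slice D w ->
    Upsilon O (fz w) y = Upsilon (slice D w) (fz w) y.
  move=> Ow; have [_ H] := Upsilon_sub oO (@slice_open _ _ _ _ _ oD w)
    (subset_trans inO Ow) (fk w) (leqnn k).
  exact: H.
by move=> h; apply/ball_vnormP => //; rewrite !E1.
Qed.

End JointlySmooth.

End SmoothClasses.

(** * Odometers: p-adic iterates of near-identity cocycles *)

Section Digits.
Variable p : nat.
Hypothesis p_gt1 : (1 < p)%N.

Let p_gt0 : (0 < p)%N := ltnW p_gt1.

(** Sequences of digits, a compact space in which the p-adic expansions of the
    natural numbers are dense: the topological space of the p-adic integers. *)
Definition padic := prod_topology (fun _ : nat => discrete_topology 'I_p).

Definition agree (m : nat) (z w : padic) := forall i, (i < m)%N -> z i = w i.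

Definition digits (n : nat) : padic := fun i => Ordinal (ltn_pmod (n %/ p ^ i) p_gt0).

Lemma agree_sym m z w : agree m z w -> agree m w z.
Proof. by move=> zw i im; rewrite zw. Qed.

Lemma agree_trans m z w u : agree m z w -> agree m w u -> agree m z u.
Proof. by move=> zw wu i im; rewrite zw // wu. Qed.

Lemma agree_le m n z w : (m <= n)%N -> agree n z w -> agree m z w.
Proof. by move=> mn zw i im; rewrite zw // (leq_trans im). Qed.

Lemma padic_compact : compact [set: padic].
Proof.
rewrite (_ : setT = [set f : padic | forall i, [set: discrete_topology 'I_p] (f i)]).
  apply: (@tychonoff _ (fun _ : nat => discrete_topology 'I_p) (fun=> setT)) => i.
  apply: finite_compact; exact: (@finite_finset 'I_p).
by apply/seteqP; split.
Qed.

Lemma padic_hausdorff : hausdorff_space padic.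
Proof. by apply: hausdorff_product => i; exact: discrete_hausdorff. Qed.

Lemma nbhs_agree z m : nbhs z (agree m z).
Proof.
elim: m => [|m IH]; first by apply: filterS filterT => w _ i.
have zm : nbhs z [set w : padic | w m = z m].
  have := @proj_continuous _ (fun _ : nat => discrete_topology 'I_p) m z [set z m].
  by apply; rewrite nbhs_principalE.
apply: filterS2 IH zm => w zw wm i.
by rewrite ltnS leq_eqVlt => /orP [/eqP->|/zw].
Qed.

Lemma nbhs_agreeP z A : nbhs z A -> exists m, agree m z `<=` A.
Proof.
pose F := filter_from [set: nat] (fun m => agree m z).
have FF : Filter F.
  apply: filter_from_filter; first by exists 0%N.
  move=> m n _ _; exists (maxn m n) => // w zw.
  by split; apply: agree_le zw; rewrite ?leq_maxl ?leq_maxr.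
have Fz : F --> z.
  apply/cvg_sup => N U [V] [[W] oW <-] WfN WU.
  exists N.+1 => // w zw; apply: WU; rewrite /preimage /=.
  by rewrite -(zw N (ltnSn N)).
by move=> /Fz [m _ mA]; exists m.
Qed.

(** Congruence of natural numbers modulo p^m is equality of their first m digits. *)
Lemma digits_agree m n n' : (n = n' %[mod p ^ m])%N -> agree m (digits n) (digits n').
Proof.
have dE k i : (i < m)%N -> (k %/ p ^ i %% p = (k %% p ^ m) %/ p ^ i %% p)%N.
  move=> im; have [e ->] : exists e, m = (e.+1 + i)%N by exists (m - i.+1)%N; lia.
  rewrite expnD {1}(divn_eq k (p ^ e.+1 * p ^ i)) mulnA divnMDl ?expn_gt0 ?p_gt0 //.
  by rewrite expnS (mulnC p) mulnA modnMDl.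
by move=> nn i im; apply: val_inj; rewrite /= (dE n _ im) (dE n' _ im) nn.
Qed.

Lemma digits_mod m n n' : agree m (digits n) (digits n') -> (n = n' %[mod p ^ m])%N.
Proof.
have dE k j : (k %% p ^ j.+1 = (k %/ p ^ j %% p) * p ^ j + k %% p ^ j)%N.
  rewrite {1}(divn_eq k (p ^ j)) {1}(divn_eq (k %/ p ^ j) p) mulnDl -mulnA -expnS -addnA.
  rewrite modnMDl modn_small // expnS.
  have d1 : (k %/ p ^ j %% p < p)%N by rewrite ltn_pmod.
  apply: (@leq_trans ((k %/ p ^ j %% p).+1 * p ^ j)); last by rewrite leq_mul2r d1 orbT.
  by rewrite mulSn addnC ltn_add2r ltn_pmod // expn_gt0 p_gt0.
elim: m => [|m IH] nn; first by rewrite expn0 !modn1.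
rewrite (dE n) (dE n') IH; last exact: agree_le nn.
by have /(congr1 val) /= -> := nn m (ltnSn m).
Qed.

Lemma digits_dense z m : exists n, agree m z (digits n).
Proof.
suff [n [_ zn]] : exists n, (n < p ^ m)%N /\ agree m z (digits n) by exists n.
elim: m => [|m [n [nm zn]]]; first by exists 0%N; split.
exists (z m * p ^ m + n)%N; split.
  have zm : (z m < p)%N by exact: ltn_ord.
  apply: (@leq_trans ((z m).+1 * p ^ m)); last by rewrite expnS leq_mul2r zm orbT.
  by rewrite mulSn addnC ltn_add2r.
move=> i; rewrite ltnS leq_eqVlt => /orP [/eqP->|im].
  apply: val_inj => /=; rewrite divnMDl ?expn_gt0 ?p_gt0 // divn_small // addn0.
  by rewrite modn_small //; exact: ltn_ord.
rewrite zn //; apply: digits_agree im.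
by rewrite modnMDl.
Qed.

Lemma digits_cluster (z : padic) A : nbhs z A -> exists n, A (digits n).
Proof. by move=> /nbhs_agreeP [m mA]; have [n zn] := digits_dense z m; exists n; exact: mA. Qed.

End Digits.

Section Odometer.
Context {R : realType} {K : nonArchFieldType R}.
Variables (p d : nat) (c : R).
Hypotheses (pK : p \in [pchar K]) (c0 : 0 <= c) (c1 : c < 1).
Hypothesis K_lc : locally_compact [set: K].
Notation V := 'rV[K]_d.

Lemma pchar_gt1 : (1 < p)%N.
Proof. by have /andP [/prime_gt1] := pK. Qed.

(** The displacement G - id is c-Lipschitz; with c < 1 such maps are isometries, and
    they form a group. *)
Definition nearid (G : V -> V) :=
  forall y w, vnorm ((G y - y) - (G w - w)) <= c * vnorm (y - w).

Lemma nearid_le (r : R) : 0 <= r -> c * r <= r.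
Proof. by move=> r0; rewrite ler_piMl // ltW. Qed.

Lemma nearid_lip G y w : nearid G -> vnorm (G y - G w) <= vnorm (y - w).
Proof.
move=> nG; rewrite -(subrK (y - w) (G y - G w)).
have -> : G y - G w - (y - w) = (G y - y) - (G w - w).
  by rewrite !opprD !opprK addrACA.
apply: vnormD_le => //; apply: le_trans (nG y w) _.
exact/nearid_le/vnorm_ge0.
Qed.

Lemma nearid_id : nearid id.
Proof. by move=> y w; rewrite !subrr vnorm0 mulr_ge0 ?vnorm_ge0. Qed.

Lemma nearid_comp G H : nearid G -> nearid H -> nearid (G \o H).
Proof.
move=> nG nH y w /=.
have -> : G (H y) - y - (G (H w) - w) =
    (G (H y) - H y - (G (H w) - H w)) + (H y - y - (H w - w)).
  by rewrite addrACA -opprD subrKA addrA subrK.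
apply: vnormD_le; last exact: nH.
apply: le_trans (nG _ _) _; apply: ler_wpM2l => //; exact: nearid_lip.
Qed.

Lemma nearid_iter G n : nearid G -> nearid (iter n G).
Proof.
move=> nG; elim: n => [|n IH]; first exact: nearid_id.
exact: nearid_comp nG IH.
Qed.

Lemma nearid_orbit G n y : nearid G -> vnorm (iter n G y - y) <= vnorm (G y - y).
Proof.
move=> nG; elim: n => [|n IH] /=; first by rewrite subrr vnorm0 vnorm_ge0.
apply: (@vdist_le _ _ _ _ (G y)) => //.
exact: le_trans (nearid_lip _ _ nG) IH.
Qed.

(** In characteristic p the displacement contracts under p-th powers: the p equal
    leading terms of the sum of displacements cancel. *)
Lemma nearid_pow G y : nearid G -> vnorm (iter p G y - y) <= c * vnorm (G y - y).
Proof.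
move=> nG; pose u w := G w - w.
have sumE n : iter n G y - y = u y *+ n + \sum_(i < n) (u (iter i G y) - u y).
  elim: n => [|n IH]; first by rewrite big_ord0 mulr0n addr0 subrr.
  have -> : iter n.+1 G y - y = u (iter n G y) + (iter n G y - y) by rewrite /u subrKA.
  rewrite IH big_ord_recr /= mulrSr [RHS]addrACA [X in _ = _ + X]addrC subrK.
  exact: addrC.
rewrite sumE (_ : u y *+ p = 0); last first.
  by rewrite -scaler_nat (pcharf0 pK) scale0r.
rewrite add0r; elim/big_ind: _ => [|a b|i _]; first by rewrite vnorm0 mulr_ge0 ?vnorm_ge0.
  exact: vnormD_le.
apply: le_trans (nG _ _) _; apply: ler_wpM2l => //; exact: nearid_orbit.
Qed.

Lemma nearid_pows G y j : nearid G ->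
  vnorm (iter (p ^ j) G y - y) <= c ^+ j * vnorm (G y - y).
Proof.
move=> nG; elim: j => [|j IH]; first by rewrite expn0 expr0 mul1r.
rewrite expnS iterM; have nGj := nearid_iter (p ^ j)%N nG.
apply: le_trans (nearid_pow y nGj) _.
by rewrite exprS -mulrA ler_wpM2l.
Qed.

Notation Z := (padic p).
Notation dig := (@digits p pchar_gt1).

Variables (Q : topologicalType) (Phi : Z -> Q -> V -> V).
Hypothesis Phi_cont : continuous (fun w : Z * Q * V => Phi w.1.1 w.1.2 w.2).
Hypothesis Phi_nearid : forall z q, nearid (Phi z q).

(** The fibre component of the n-th iterate of the skew product
    (z, y) |-> (z + 1, Phi z q y) that starts at z = 0, for the parameter q. *)
Fixpoint cocycle (n : nat) (q : Q) (y : V) : V :=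
  if n is n'.+1 then Phi (dig n') q (cocycle n' q y) else y.

Lemma cocycle_nearid n q : nearid (cocycle n q).
Proof.
elim: n => [|n IH]; first exact: nearid_id.
exact: (nearid_comp (Phi_nearid _ _) IH).
Qed.

Lemma compact_padic_ball rho : compact ([set: Z] `*` [set y : V | vnorm y <= rho]).
Proof. by apply: compact_setX; [exact: padic_compact|exact: compact_vnorm_le]. Qed.

Lemma Phi_bounded q : exists2 rho, 0 <= rho & forall z (y : V), vnorm y <= rho -> vnorm (Phi z q y) <= rho.
Proof.
have [N N0] : exists N : nat, forall z, vnorm (Phi z q 0) <= N%:R.
  have : \forall n \near \oo, [set: Z] `<=` fun z => vnorm (Phi z q 0) <= n%:R :> R.
    apply: ((compact_near_coveringP _).1 (@padic_compact p)) => z _.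
    have [n nz] : exists n : nat, vnorm (Phi z q 0) + 1 <= n%:R :> R.
      exists (Num.truncn (vnorm (Phi z q 0) + 1)).+1.
      by apply/ltW/truncnS_gt.
    have cz : (fun z' => Phi z' q 0) @ z --> Phi z q 0.
      apply: (@cont_comp _ _ _ (fun z' : Z => (z', q, 0 : V)) _ _ Phi_cont).
      apply: cont_pair => [z'|z']; last exact: cvg_const.
      by apply: cvg_pair2; [exact: cvg_id|exact: cvg_const].
    have /cvg_vnormP-/(_ 1 ltr01) near1 := cz.
    exists ([set z' | vnorm (Phi z q 0 - Phi z' q 0) < 1], [set m | (n <= m)%N]).
      by split=> //=; exists n.
    move=> [z' m] /= [zz' nm].
    apply: (@le_trans _ _ n%:R); last by rewrite ler_nat.
    apply: le_trans nz; rewrite -(subrK (Phi z q 0) (Phi z' q 0)); apply: vnormD_le.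
      by rewrite vnorm_distC (le_trans (ltW zz')) // lerDr vnorm_ge0.
    by rewrite lerDl.
  by move=> [N _ H]; exists N => z; apply: (H N) => //=.
exists N%:R => // z y yN; rewrite -(subrK (Phi z q 0) (Phi z q y)); apply: vnormD_le => //.
by apply: le_trans (nearid_lip _ _ (Phi_nearid z q)) _; rewrite subr0.
Qed.

Lemma cocycle_bounded q (y : V) : exists rho, [/\ 0 <= rho, vnorm (y : V) <= rho,
  forall z (w : V), vnorm w <= rho -> vnorm (Phi z q w) <= rho &
  forall n (w : V), vnorm w <= rho -> vnorm (cocycle n q w) <= rho].
Proof.
have [r r0 rP] := Phi_bounded q.
have H z w : vnorm w <= Num.max r (vnorm y) -> vnorm (Phi z q w) <= Num.max r (vnorm y).
  move=> wr; rewrite -(subrK (Phi z q 0) (Phi z q w)); apply: vnormD_le.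
    by apply: le_trans (nearid_lip _ _ (Phi_nearid z q)) _; rewrite subr0.
  by rewrite le_max rP ?vnorm0.
exists (Num.max r (vnorm y)); split=> //; try by rewrite le_max ?lexx ?r0 ?orbT.
by elim=> [|n IH] w wr //=; apply/H/IH.
Qed.

(** Uniform continuity along the compact set of digits. *)
Lemma Phi_uniform q rho eps : 0 < eps -> exists m N, nbhs q N /\
  forall q' z z' (y : V), N q' -> agree m z z' -> vnorm y <= rho ->
    vnorm (Phi z' q' y - Phi z q y) < eps.
Proof.
move=> e0.
pose F := filter_prod \oo (nbhs q).
pose P (mq : nat * Q) (zy : Z * V) := forall z', agree mq.1 zy.1 z' ->
  vnorm (Phi z' mq.2 zy.2 - Phi zy.1 q zy.2) < eps.
have : \forall mq \near F, ([set: Z] `*` [set y : V | vnorm y <= rho]) `<=` P mq.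
  apply: ((compact_near_coveringP _).1 (@compact_padic_ball rho)) => -[z y] _.
  have near1 : nbhs (z, q, y) [set w | vnorm (Phi z q y - Phi w.1.1 w.1.2 w.2) < eps].
    by have /cvg_vnormP-/(_ eps e0) := @Phi_cont (z, q, y).
  have [[AN B] /= [[[A N] /= [zA qN] sAN] yB] sP] := near1.
  have [m mA] := nbhs_agreeP zA.
  exists ([set zy | agree m z zy.1 /\ B zy.2], [set mq | (m <= mq.1)%N /\ N mq.2]).
    split=> /=; first by exists (agree m z, B) => //=; split=> //; exact: nbhs_agree.
    exists ([set k | (m <= k)%N], N) => //=; split=> //; by exists m.
  move=> [[z1 y1] [k q1]] /= [[zz1 By1] [mk Nq1]] z' /= z1z'.
  have H u q2 : agree m z u -> N q2 -> vnorm (Phi z q y - Phi u q2 y1) < eps.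
    move=> zu Nq2; apply: (sP (u, q2, y1)); split=> //=; apply: sAN; split=> //=.
    exact: mA.
  apply: (@vdist_lt _ _ _ _ (Phi z q y)).
    rewrite vnorm_distC; apply: H => //.
    exact: agree_trans zz1 (agree_le mk z1z').
  by apply: H => //; exact: nbhs_singleton.
move=> [[A N] /= [[m _ mA] qN] sP].
exists m, N; split=> // q' z z' y Nq' zz' yr.
by apply: (sP (m, q')) (z, y) _ z' zz'; split=> //=; apply: mA => /=.
Qed.

(** Near-identity maps do not expand distances, so that errors do not accumulate along
    an orbit. *)
Lemma cocycle_close q rho eps m N :
  (forall z (w : V), vnorm w <= rho -> vnorm (Phi z q w) <= rho) ->
  (forall q' z z' (y : V), N q' -> agree m z z' -> vnorm y <= rho ->
    vnorm (Phi z' q' y - Phi z q y) < eps) ->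
  forall M k q' (y y' : V), N q' -> (p ^ m %| M)%N -> vnorm y <= rho -> vnorm (y' - y) <= eps ->
    forall F : nat -> V, F 0%N = y' -> (forall n, F n.+1 = Phi (dig (M + n)) q' (F n)) ->
    vnorm (F k - cocycle k q y) <= eps.
Proof.
move=> Hr HN M k q' y y' Nq' mM yr yy' F F0 FS.
have bnd n : vnorm (cocycle n q y) <= rho by elim: n => [|n IH] //=; exact: Hr.
elim: k => [|k IH]; first by rewrite F0.
rewrite FS /=; apply: (@vdist_le _ _ _ _ (Phi (dig (M + k)) q' (cocycle k q y))).
  exact: le_trans (nearid_lip _ _ (Phi_nearid _ _)) IH.
apply/ltW/HN => //; apply/agree_sym/digits_agree.
by rewrite -modnDml (eqP mM) add0n.
Qed.

Lemma cocycle_shift q rho eps m N : N q ->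
  (forall z (w : V), vnorm w <= rho -> vnorm (Phi z q w) <= rho) ->
  (forall q' z z' (y : V), N q' -> agree m z z' -> vnorm y <= rho ->
    vnorm (Phi z' q' y - Phi z q y) < eps) -> 0 <= eps ->
  forall M k (y : V), (p ^ m %| M)%N -> vnorm y <= rho ->
    vnorm (cocycle (M + k) q y - cocycle k q (cocycle M q y)) <= eps.
Proof.
move=> Nq Hr HN e0 M k y mM yr.
have bnd n : vnorm (cocycle n q y) <= rho by elim: n => [|n IH] //=; exact: Hr.
apply: (@cocycle_close q rho eps m N Hr HN M k q (cocycle M q y) (cocycle M q y) Nq mM (bnd M)
  _ (fun n => cocycle (M + n) q y)).
- by rewrite subrr vnorm0.
- by rewrite addn0.
- by move=> n; rewrite addnS.
Qed.

(** Recurrence: along an orbit of period p^m of the base, the fibre map is nearly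
    the power of a single perturbation of the identity. *)
Lemma cocycle_recurrent q (y : V) eps : 0 < eps -> exists m, forall M, (p ^ m %| M)%N ->
  vnorm (cocycle M q y - y) <= eps.
Proof.
move=> e0; have [rho [r0 yr Hr Hn]] := cocycle_bounded q y.
have [m [N [qN HN]]] := Phi_uniform q rho e0.
have Nq := nbhs_singleton qN; have e0' := ltW e0.
have shift := cocycle_shift Nq Hr HN e0'.
pose G := cocycle (p ^ m) q; have nG : nearid G by exact: cocycle_nearid.
have powG i : vnorm (cocycle (i * p ^ m) q y - iter i G y) <= eps.
  elim: i => [|i IH]; first by rewrite mul0n subrr vnorm0.
  rewrite mulSn addnC iterS.
  apply: (@vdist_le _ _ _ _ (G (cocycle (i * p ^ m) q y))).
    by apply: shift => //; exact: dvdn_mull.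
  exact: le_trans (nearid_lip _ _ nG) IH.
have [j jP] : exists j, c ^+ j * vnorm (G y - y) <= eps.
  have r1 : 0 < rho + 1 by rewrite ltr_wpDl.
  have [j cj] := small_power c0 c1 (divr_gt0 e0 r1).
  exists j; rewrite ltr_pdivlMr // in cj; apply: le_trans (ltW cj).
  apply: ler_wpM2l; first exact: exprn_ge0.
  by rewrite (le_trans (vnormB_le (Hn _ _ yr) yr)) // lerDl.
exists (m + j)%N => M /dvdnP [i ->].
have -> : (i * p ^ (m + j) = (i * p ^ j) * p ^ m)%N by rewrite expnD (mulnC (p ^ m)%N) mulnA.
apply: (@vdist_le _ _ _ _ (iter (i * p ^ j) G y)); first exact: powG.
rewrite iterM.
apply: le_trans (nearid_orbit i y (nearid_iter (p ^ j)%N nG)) _.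
exact: le_trans (nearid_pows y j nG) jP.
Qed.

(** p-adic equicontinuity of the iterated cocycle. *)
Lemma cocycle_uniform q (y : V) eps : 0 < eps -> exists m N, nbhs q N /\
  forall n n' q' (y' : V), (n = n' %[mod p ^ m])%N -> N q' -> vnorm (y' - y) <= eps ->
    vnorm (cocycle n' q' y' - cocycle n q y) <= eps.
Proof.
move=> e0; have [rho [r0 yr Hr Hn]] := cocycle_bounded q y.
have [m1 [N [qN HN]]] := Phi_uniform q rho e0.
have [m2 Hrec] := cocycle_recurrent q y e0.
have Nq := nbhs_singleton qN; have e0' := ltW e0.
have shift := cocycle_shift Nq Hr HN e0'.
exists (maxn m1 m2), N; split=> // n n' q' y' nn Nq' yy'.
pose P := (p ^ maxn m1 m2)%N.
have P1 : (p ^ m1 %| P)%N by rewrite dvdn_exp2l // leq_maxl.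
have P2 : (p ^ m2 %| P)%N by rewrite dvdn_exp2l // leq_maxr.
have base k : vnorm (cocycle k q y - cocycle (k %% P) q y) <= eps.
  rewrite {1}(divn_eq k P).
  apply: (@vdist_le _ _ _ _ (cocycle (k %% P) q (cocycle (k %/ P * P) q y))).
    by apply: shift => //; exact: dvdn_mull.
  apply: le_trans (nearid_lip _ _ (cocycle_nearid _ _)) _.
  by apply: Hrec; exact: dvdn_mull.
apply: (@vdist_le _ _ _ _ (cocycle n' q y)).
  by apply: (@cocycle_close q rho eps m1 N Hr HN 0 n' q' y y' Nq' (dvdn0 _) yr yy'
    (fun k => cocycle k q' y')).
apply: (@vdist_le _ _ _ _ (cocycle (n' %% P) q y)); first exact: base.
by rewrite vnorm_distC -/P -nn; exact: base.
Qed.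

(** The iterates of a near-identity cocycle over the p-adic odometer interpolate
    continuously to p-adic exponents. *)
Theorem odometer : exists Psi : Z * Q * V -> V, continuous Psi /\
  forall n q y, Psi (dig n, q, y) = cocycle n q y.
Proof.
pose lim z q y w := forall eps, 0 < eps -> exists m, forall n, agree m z (dig n) ->
  vnorm (cocycle n q y - w) <= eps.
have lim_ex z q y : exists w, lim z q y w.
  have [rho [r0 yr Hr Hn]] := cocycle_bounded q y.
  pose F := filter_from [set: nat] (fun m => (fun n => cocycle n q y) @` (agree m z \o dig)).
  have PF : ProperFilter F.
    apply: filter_from_proper; last first.
      by move=> m _; have [n zn] := digits_dense pchar_gt1 z m; exists (cocycle n q y), n.
    apply: filter_from_filter; first by exists 0%N.
    move=> m n _ _; exists (maxn m n) => // _ [k zk <-].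
    by split; exists k => //; apply: agree_le zk; rewrite ?leq_maxl ?leq_maxr.
  have FB : F [set w : V | vnorm w <= rho].
    by exists 0%N => // _ [k _ <-]; exact: Hn.
  have [w [_ wF]] := compact_vnorm_le K_lc PF FB.
  exists w => eps e0; have [m [N [qN HN]]] := cocycle_uniform q y e0.
  exists m => n zn.
  have Fm : F ((fun n => cocycle n q y) @` (agree m z \o dig)) by exists m.
  have [_ [[n' zn' <-] /= wn']] := wF _ _ Fm (near_vnorm w e0).
  apply: (@vdist_le _ _ _ _ (cocycle n' q y)); last by rewrite vnorm_distC ltW.
  apply: HN; [|exact: nbhs_singleton|by rewrite subrr vnorm0 ltW].
  apply: (digits_mod (p_gt1 := pchar_gt1)).
  exact: agree_trans (agree_sym zn') zn.
pose Psi (w : Z * Q * V) := xget 0 (lim w.1.1 w.1.2 w.2).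
have PsiP z q y : lim z q y (Psi (z, q, y)).
  by have [w wP] := lim_ex z q y; rewrite /Psi; case: xgetP => [w' _ //|/(_ w)].
exists Psi; split; last first.
  move=> n q y; apply/eqP; rewrite eq_sym -subr_eq0; apply/eqP/vnorm0_eq0.
  apply/ler_addgt0Pr => eps e0; rewrite add0r.
  by have [m Hm] := PsiP (dig n) q y eps e0; exact: Hm.
move=> [[z q] y]; apply/cvg_vnormP => eps e0.
have e2 : 0 < eps / 2 by rewrite divr_gt0.
have [m [N [qN HN]]] := cocycle_uniform q y e2.
exists (agree m z `*` N, [set y' | vnorm (y - y') < eps / 2]) => /=.
  split; last exact: near_vnorm.
  by exists (agree m z, N) => //; split=> //; exact: nbhs_agree.
move=> [[z' q'] y'] [/= [zz' Nq'] yy'].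
have [m1 H1] := PsiP z q y _ e2; have [m2 H2] := PsiP z' q' y' _ e2.
have [n zn] := digits_dense pchar_gt1 z (maxn m m1).
have [n' zn'] := digits_dense pchar_gt1 z' (maxn m m2).
apply: (@le_lt_trans _ _ (eps / 2)); last by rewrite ltr_pdivrMr // ltr_pMr // ltr1n.
apply: (@vdist_le _ _ _ _ (cocycle n q y)).
  by rewrite vnorm_distC; apply: H1; apply: agree_le zn; exact: leq_maxr.
apply: (@vdist_le _ _ _ _ (cocycle n' q' y')).
  rewrite vnorm_distC; apply: HN => //; last by rewrite vnorm_distC ltW.
  apply: (digits_mod (p_gt1 := pchar_gt1)).
  have zn1 : agree m z (dig n) by apply: agree_le zn; exact: leq_maxl.
  have zn2 : agree m z' (dig n') by apply: agree_le zn'; exact: leq_maxl.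
  exact: agree_trans (agree_sym zn1) (agree_trans zz' zn2).
by apply: H2; apply: agree_le zn'; exact: leq_maxr.
Qed.

End Odometer.

(** * Flows of triangular maps *)

Section Triangular.
Context {R : realType} {K : nonArchFieldType R}.
Variables (p d : nat) (c : R).
Hypotheses (pK : p \in [pchar K]) (c0 : 0 <= c) (c1 : c < 1).
Hypothesis K_lc : locally_compact [set: K].
Notation obj := (@obj R K).
Notation V := 'rV[K]_d.
Notation vecV := (vec (@rV_tmod R K d)).
Notation Z := (padic p).
Notation dig := (@digits p (pchar_gt1 pK)).

(** Self-maps that are built from the identity by fibrewise perturbations of the
    identity. *)
Inductive triangular : forall X : obj, (X -> X) -> Prop :=
| Tri_id (X : obj) : @triangular X id
| Tri_ext (X : obj) (h : X -> X) (F : X -> V -> V) :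
    @triangular X h -> (forall x, nearid c (F x)) ->
    @triangular (prodo X vecV) (fun y => (h y.1, F y.1 y.2))
| Tri_iso (X Y : obj) (h : X -> X) (f : X -> Y) l (g : Y -> X) m (h' : Y -> Y) :
    lin f l -> lin g m ->
    cancel f g -> cancel g f -> @triangular X h -> (forall y, h' y = f (h (g y))) ->
    @triangular Y h'.

Theorem triangular_flow (X : obj) (h : X -> X) : triangular h -> continuous h ->
  exists g : Z * X -> X, continuous g /\ forall n x, g (dig n, x) = iter n h x.
Proof.
elim=> {X h} [X|X h F _ IH nF|X Y h f l g m h' lf lg fK gK _ IH h'E] ch.
- exists snd; split; first exact: cont_snd.
  by move=> n x; elim: n => //= n <-.
- have ci : continuous (fun x : X => (x, 0 : V)).
    by apply: cont_pair => x; [exact: cvg_id|exact: cvg_const].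
  have {}/IH [g1 [cg1 g1E]] : continuous h.
    exact: (cont_comp ci (cont_comp ch (@cont_fst _ _))).
  have cF : continuous (fun y : X * V => F y.1 y.2) by exact: (cont_comp ch (@cont_snd _ _)).
  pose Phi z x y := F (g1 (z, x)) y.
  have cPhi : continuous (fun w : Z * X * V => Phi w.1.1 w.1.2 w.2).
    apply: (@cont_op2 _ _ _ _ F (fun w : Z * X * V => g1 (w.1.1, w.1.2)) snd cF); last exact: cont_snd.
    by apply: (cont_comp _ cg1); cont_proj.
  have [Psi [cPsi PsiE]] := odometer pK c0 c1 K_lc cPhi (fun z x => nF _).
  exists (fun zy => (g1 (zy.1, zy.2.1), Psi ((zy.1, zy.2.1), zy.2.2))); split.
    apply: cont_pair.
      by apply: (cont_comp _ cg1); cont_proj.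
    by apply: (cont_comp _ cPsi); cont_proj.
  move=> n [x y] /=; rewrite g1E PsiE.
  by elim: n => //= n <-; rewrite /Phi g1E.
- have {}/IH [g1 [cg1 g1E]] : continuous h.
    have -> : h = g \o h' \o f by apply/funext => x; rewrite /= h'E !fK.
    exact: (cont_comp (lin_cont lf) (cont_comp ch (lin_cont lg))).
  exists (fun zy => f (g1 (zy.1, g zy.2))); split.
    apply: (cont_comp _ (lin_cont lf)); apply: (cont_comp _ cg1).
    by apply: cont_pair; [cont_proj|apply: (cont_comp _ (lin_cont lg)); cont_proj].
  move=> n y; rewrite g1E; elim: n => [|n IHn]; first exact: gK.
  by rewrite !iterS -IHn h'E fK.
Qed.

Variable b : bool.
Notation r := (drule b).
Notation T := (To r).

Lemma dense_uniq (A : topologicalType) (X : obj) (u v : T X -> A) : hausdorff_space A ->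
  continuous u -> continuous v -> (forall y, rt y != 0 -> u y = v y) -> u =1 v.
Proof.
move=> hA cu cv uv y; apply: (cvg_uniq hA (cu y) (cv y)) => N /dense_scalar [t t0 Nt].
by eexists; first exact: Nt; apply: uv; rewrite rtK.
Qed.

Lemma sh_inj (X : obj) (x : X) v w t : t != 0 -> sh x v t = sh x w t -> v = w.
Proof.
move=> t0 /ac_inj /(congr1 (ts (im X) t^-1)).
by rewrite !tsA mulVf // !ts1.
Qed.

Lemma lin_vfst A B (m : @tmod R K A) (n : @tmod R K B) :
  @lin R K (vec (prod_tmod m n)) (vec m) fst (fun _ v => v.1).
Proof. by split => //=; cont_proj. Qed.

Lemma lin_vsnd A B (m : @tmod R K A) (n : @tmod R K B) :
  @lin R K (vec (prod_tmod m n)) (vec n) snd (fun _ v => v.2).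
Proof. by split => //=; cont_proj. Qed.

Lemma sub_common (f w a a' u u' : V) :
  (f + a - (w + u)) - (f + a' - (w + u')) = (a - u) - (a' - u').
Proof. by apply/rowP => i; rewrite !mxE; ring. Qed.

Lemma sub_split (a a' b' b'' u u' : V) :
  (a - u) - (a' - u') = ((b' - u) - (b'' - u')) + ((a - b') - (a' - b'')).
Proof. by apply/rowP => i; rewrite !mxE; ring. Qed.

(** Prolongations of triangular maps are triangular: the quotient of a fibrewise
    perturbation of the identity is again one, in the increment of the fibre. *)
Theorem triangular_prolong (X : obj) (h : X -> X) (dh : T X -> inc X) :
  triangular h -> continuous h -> continuous dh ->
  (forall y, h (sh y.1.1 y.1.2 y.2) = sh (h y.1.1) (dh y) y.2) ->
  triangular (X := T X) (Tmap (r := r) h dh).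
Proof.
move=> th; elim: th dh => {X h} [X|X h F th IH nF|X Y h f l g m h' lf lg fK gK th IH h'E] dh ch cdh dhE.
- have dhv : dh =1 (fun y => y.1.2).
    apply: (dense_uniq (t_haus (im X)) cdh); first by cont_proj.
    by move=> y y0; apply: (@sh_inj X y.1.1 _ _ _ y0); exact: (esym (dhE y)).
  rewrite (_ : Tmap _ _ = id); first exact: Tri_id.
  by apply/funext => -[[x v] t]; rewrite /Tmap /= dhv.
- pose dh1 (y : T X) := (dh ((y.1.1, 0 : V), (y.1.2, 0 : V), y.2)).1.
  (* the quotient of F in the fibre: dF y w is the fibre map over (x, v, t) and w *)
  pose dF (y : T X) (w u : V) := (dh ((y.1.1, w), (y.1.2, u), y.2)).2.
  have cT : continuous (fun z : (T X * V) * V => ((z.1.1.1.1, z.1.2), (z.1.1.1.2, z.2), z.1.1.2) : T (prodo X vecV)).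
    by apply: cont_pair; [apply: cont_pair; [apply: cont_pair|apply: cont_pair]|]; cont_proj.
  have ci : continuous (fun x : X => (x, 0 : V)).
    by apply: cont_pair => x; [exact: cvg_id|exact: cvg_const].
  have ch1 : continuous h by exact: (cont_comp ci (cont_comp ch (@cont_fst _ _))).
  have ci2 : continuous (fun y : T X => ((y, 0 : V), 0 : V)).
    by apply: cont_pair; [apply: cont_pair => y; [exact: cvg_id|exact: cvg_const]|
      move=> y; exact: cvg_const].
  have cdh1 : continuous dh1.
    exact: (cont_comp ci2 (cont_comp cT (cont_comp cdh (@cont_fst _ _)))).
  have dh1E y : h (sh y.1.1 y.1.2 y.2) = sh (h y.1.1) (dh1 y) y.2.
    have := dhE ((y.1.1, 0 : V), (y.1.2, 0 : V), y.2).
    by rewrite /sh /= => /(congr1 fst).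
  have dhfst (y : T X) w u : (dh ((y.1.1, w), (y.1.2, u), y.2)).1 = dh1 y.
    have cu : continuous (fun y : T X => (dh ((y.1.1, w), (y.1.2, u), y.2)).1).
      have cj : continuous (fun y : T X => ((y, w : V), u : V)).
        by apply: cont_pair; [apply: cont_pair => z; [exact: cvg_id|exact: cvg_const]|
          move=> z; exact: cvg_const].
      exact: (cont_comp cj (cont_comp cT (cont_comp cdh (@cont_fst _ _)))).
    apply: (dense_uniq (t_haus (im X)) cu cdh1) => {}y y0.
    apply: (@sh_inj X (h y.1.1) _ _ _ y0); apply: etrans (dh1E y).
    have := dhE ((y.1.1, w), (y.1.2, u), y.2).
    by rewrite /sh /= => /(congr1 fst) /= <-.
  have dFE (y : T X) w u : F (sh y.1.1 y.1.2 y.2) (w + y.2 *: u) = F y.1.1 w + y.2 *: dF y w u.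
    have := dhE ((y.1.1, w), (y.1.2, u), y.2).
    by rewrite /sh /= => /(congr1 snd).
  have nd (y : T X) w : nearid c (dF y w).
    move=> u u'.
    have nz (y' : T X) : rt y' != 0 ->
        vnorm ((dF y' w u - u) - (dF y' w u' - u')) <= c * vnorm (u - u').
      move=> y0; have t0 : 0 < nabs (y'.2) by rewrite nabs_gt0.
      rewrite -(ler_pM2l t0) -vnormZ.
      have -> : y'.2 *: (dF y' w u - u - (dF y' w u' - u')) =
         (F (sh y'.1.1 y'.1.2 y'.2) (w + y'.2 *: u) - (w + y'.2 *: u)) -
         (F (sh y'.1.1 y'.1.2 y'.2) (w + y'.2 *: u') - (w + y'.2 *: u')).
        by rewrite (dFE y' w u) (dFE y' w u') sub_common !scalerBr.
      apply: le_trans (nF _ _ _) _.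
      by rewrite opprD addrACA subrr add0r -scalerBr vnormZ mulrCA.
    have cd w' u1 : continuous (fun z : T X => dF z w' u1).
      have cj : continuous (fun y : T X => ((y, w' : V), u1 : V)).
        by apply: cont_pair; [apply: cont_pair => z; [exact: cvg_id|exact: cvg_const]|
          move=> z; exact: cvg_const].
      exact: (cont_comp cj (cont_comp cT (cont_comp cdh (@cont_snd _ _)))).
    apply/ler_addgt0Pr => e e0.
    have nearu u1 : nbhs y [set z : T X | vnorm (dF y w u1 - dF z w u1) < e].
      by have /cvg_vnormP-/(_ e e0) := cd w u1 y.
    have [t t0 [/= n1 n2]] := dense_scalar (filterI (nearu u) (nearu u')).
    have := nz (y.1.1, y.1.2, t) t0; set y' := (y.1.1, y.1.2, t) => nzy.
    rewrite (sub_split _ _ (dF y' w u) (dF y' w u')); apply: vnormD_le.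
      by apply: le_trans nzy _; rewrite lerDl ltW.
    apply: (@le_trans _ _ e); last by rewrite lerDr mulr_ge0 ?vnorm_ge0.
    by apply: vnormB_le; exact: ltW.
  pose base := prodo (T X) vecV.
  pose k1 (y : base) : base := (Tmap (r := r) h dh1 y.1, F y.1.1.1 y.2).
  have tk1 : triangular k1.
    exact: (Tri_ext (F := fun y : T X => F y.1.1) (IH dh1 ch1 cdh1 dh1E) (fun y => nF _)).
  pose k2 (y : prodo base vecV) : prodo base vecV := (k1 y.1, dF y.1.1 y.1.2 y.2).
  have tk2 : triangular k2.
    exact: (Tri_ext (F := fun y : base => dF y.1 y.2) tk1 (fun y => nd _ _)).
  have l1 := lin_fst base vecV; have l2 := lin_snd base vecV.
  have l11 := lin_comp l1 (lin_fst (T X) vecV); have l12 := lin_comp l1 (lin_snd (T X) vecV).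
  have lb := lin_comp l11 (lin_Tbase b X); have li := lin_comp l11 (lin_Tincr b X).
  have lt := lin_comp l11 (lin_Tscal b X).
  have to := lin_pair (lin_pair (lin_pair lb l12) (lin_vec_pair li l2)) lt.
  have fb := lin_Tbase b (prodo X vecV); have fi := lin_Tincr b (prodo X vecV).
  have ft := lin_Tscal b (prodo X vecV).
  have from := lin_pair (lin_pair (lin_pair (lin_pair (lin_comp fb (lin_fst _ _))
    (lin_comp fi (lin_vfst _ _))) ft) (lin_comp fb (lin_snd _ _))) (lin_comp fi (lin_vsnd _ _)).
  apply: (@Tri_iso (prodo base vecV) (T (prodo X vecV)) k2 _ _ _ _ _ to from _ _ tk2).
  - by move=> [[[[x v] t] w] u].
  - by move=> [[[x w] [v u]] t].
  - move=> [[[x w] [v u]] t]; rewrite /Tmap /k2 /k1 /=.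
    rewrite /Tmap /=.
    congr (_, _, _).
    by rewrite -(dhfst ((x, v), t) w u) /dF /=; case: (dh _).
- have hE x : h x = g (h' (f x)) by rewrite h'E !fK.
  have mlK x v : m (f x) (l x v) = v.
    by apply: (@ac_inj _ _ _ x); rewrite -{1}(fK x) -(lin_ac lg) -(lin_ac lf) fK.
  have lmK y w : l (g y) (m y w) = w.
    by apply: (@ac_inj _ _ _ y); rewrite -{1}(gK y) -(lin_ac lf) -(lin_ac lg) gK.
  have [m1 lTf] := drule_functorial b lf; have [m2 lTg] := drule_functorial b lg.
  pose Tf := Tmap (r := r) f (fun y => l y.1.1 y.1.2).
  pose Tg := Tmap (r := r) g (fun y => m y.1.1 y.1.2).
  pose dh1 (y : T X) := m (h' (f y.1.1)) (dh (Tf y)).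
  have ch1 : continuous h.
    have -> : h = g \o h' \o f by apply/funext.
    exact: (cont_comp (lin_cont lf) (cont_comp ch (lin_cont lg))).
  have cdh1 : continuous dh1.
    apply: (@cont_op2 _ _ _ _ m (fun y : T X => h' (f y.1.1)) (fun y => dh (Tf y)) (lin_dcont lg)).
      apply: (cont_comp _ ch); apply: (cont_comp _ (lin_cont lf)); cont_proj.
    exact: (cont_comp (lin_cont lTf) cdh).
  have dh1E y : h (sh y.1.1 y.1.2 y.2) = sh (h y.1.1) (dh1 y) y.2.
    by rewrite !hE (lin_sh lf) /dh1 -(lin_sh lg); congr g; exact: (dhE (Tf y)).
  apply: (Tri_iso lTf lTg _ _ (IH dh1 ch1 cdh1 dh1E)).
  + by move=> [[x v] t]; rewrite /Tmap /= fK mlK.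
  + by move=> [[y w] t]; rewrite /Tmap /= gK lmK.
  move=> [[y w] t]; rewrite /Tmap /= -h'E; congr (_, _, _).
  by rewrite /dh1 /Tf /Tmap /= hE gK lmK lmK.
Qed.

(** The flow of a triangular map is as smooth as the map, jointly with continuous
    dependence on the p-adic exponent. *)
Theorem triangular_family n (X : obj) (h : X -> X) : triangular h -> Cr r n setT h ->
  exists g : Z * X -> X, (forall k x, g (dig k, x) = iter k h x) /\
    Cr r n (X := paro (@padic_hausdorff p) X) setT g.
Proof.
elim: n X h => [|n IH] X h th.
  move=> ch; have [g [cg gE]] := triangular_flow th (fun x => ch x I).
  by exists g; split=> // zx _; exact: cg.
move=> [ch [dh [dhE cdh]]].
have cTh := Cr_cont cdh.
have cdh' : continuous dh.
  have cT : continuous (Tmap (r := r) h dh) by move=> y; exact: cTh.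
  exact: (cont_comp cT (cont_comp (@cont_fst _ _) (@cont_snd _ _))).
have dhE' y : h (sh y.1.1 y.1.2 y.2) = sh (h y.1.1) (dh y) y.2 by exact: dhE.
have tT := triangular_prolong th (fun x => ch x I) cdh' dhE'.
have cdhT : Cr r n (X := T X) (Y := T X) setT (Tmap h dh).
  by apply: Cr_sub cdh.
have [G [GE cG]] := IH _ _ tT cdhT.
pose P := paro (@padic_hausdorff p) X.
have contG : continuous G by have cG' := Cr_cont cG; move=> zy; exact (cG' zy I).
pose g (zx : P) : X := (G (zx.1, (zx.2, tz (im X), 0))).1.1.
have cg : continuous g.
  do 2 (apply: cont_fstc); apply: (cont_comp _ contG).
  apply: cont_pair; first by cont_proj.
  by apply: cont_pair; [apply: cont_pair; [cont_proj|]|] => z; exact: cvg_const.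
have iterT k (y : T X) : [/\ (iter k (Tmap (r := r) h dh) y).1.1 = iter k h y.1.1,
    (iter k (Tmap (r := r) h dh) y).2 = y.2 &
    iter k h (sh y.1.1 y.1.2 y.2) =
      sh (iter k h y.1.1) (iter k (Tmap (r := r) h dh) y).1.2 y.2].
  elim: k => [|k [IH1 IH2 IH3]]; first by [].
  rewrite !iterS IH3; have := dhE' (iter k (Tmap (r := r) h dh) y).
  by rewrite IH1 IH2 => ->; split; rewrite /Tmap /= ?IH1 ?IH2.
have gE k x : g (dig k, x) = iter k h x.
  by rewrite /g GE; have [-> _ _] := iterT k (x, tz (im X), 0).
have uniqZ (A : topologicalType) (u v : Z -> A) : hausdorff_space A -> continuous u ->
    continuous v -> (forall k, u (dig k) = v (dig k)) -> u =1 v.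
  move=> hA cu cv uv z; apply: (cvg_uniq hA (cu z) (cv z)) => N zN.
  by have [k Nk] := digits_cluster (pchar_gt1 pK) zN; exists (dig k).
have cGy y : continuous (fun z : Z => G (z, y)).
  apply: (cont_comp _ contG); apply: cont_pair => z; [exact: cvg_id|exact: cvg_const].
have cgx x : continuous (fun z : Z => g (z, x)).
  apply: (cont_comp _ cg); apply: cont_pair => z; [exact: cvg_id|exact: cvg_const].
have G1 z y : (G (z, y)).1.1 = g (z, y.1.1).
  apply: (uniqZ _ (fun z => (G (z, y)).1.1) (fun z => g (z, y.1.1)) (@pt_haus _ _ X)) z => //.
    by do 2 (apply: cont_fstc); exact: cGy.
  by move=> k; rewrite GE gE; have [] := iterT k y.
have G2 z y : (G (z, y)).2 = y.2.
  apply: (uniqZ _ (fun z => (G (z, y)).2) (fun=> y.2) (@nabs_hausdorff R K)) z => //.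
  - by apply: cont_sndc; exact: cGy.
  - by move=> z; exact: cvg_const.
  by move=> k; rewrite GE; have [] := iterT k y.
exists g; split=> //; split; first by move=> zx _; exact: cg.
exists (fun y : T P => (G (y.1.1.1, (y.1.1.2, y.1.2, y.2))).1.2); split.
  move=> [[[z x] v] t] _ /=; rewrite /sh /=.
  apply: (uniqZ _ (fun z => g (z, sh x v t))
    (fun z => sh (g (z, x)) (G (z, (x, v, t))).1.2 t) (@pt_haus _ _ X)) z => //.
    apply: (@cont_op2 _ _ _ _ (@ac _ _ X) _ _ (@ac_cont _ _ X)); first exact: cgx.
    apply: (@cont_op2 _ _ _ _ (ts (im X)) (fun=> t) (fun z => (G (z, (x, v, t))).1.2)
      (@ts_cont _ _ _ (im X))); first by move=> z'; exact: cvg_const.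
    by apply: cont_sndc; apply: cont_fstc; exact: cGy.
  by move=> k; rewrite !gE GE; have [] := iterT k (x, v, t).
have lP : @lin R K (T P) (paro (@padic_hausdorff p) (T X))
    (fun y => (y.1.1.1, (y.1.1.2, y.1.2, y.2))) (fun _ w => w).
  split => //=; last exact: cont_snd.
  by apply: cont_pair; [|apply: cont_pair; [apply: cont_pair|]]; cont_proj.
have cGP := Cr_comp (E := setT) (fun _ _ => I)
  (Cr_lin (@drule_functorial R K b) n (Tset (r := r) [set: P]) lP) cG.
apply: Cr_eq cGP; first by apply: Tset_open; exact: openT.
move=> [[[z x] v] t] _; rewrite /Tmap /=.
have := G1 z (x, v, t); have := G2 z (x, v, t).
by case: (G (z, (x, v, t))) => [[a w] s] /= -> ->.
Qed.

End Triangular.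

(** * Characters of the one-units *)

(** Otherwise the complements of finite unions generate a filter with no cluster
    point. *)
Lemma compact_net (T : topologicalType) (A : set T) (B : T -> set T) :
  compact A -> (forall x, A x -> nbhs x (B x)) ->
  exists s : seq T, (forall x, x \in s -> A x) /\
    forall y, A y -> exists2 x, x \in s & B x y.
Proof.
move=> cA AB; apply: contrapT => /forallNP no.
pose F : set_system T := [set X | exists s : seq T, (forall x, x \in s -> A x) /\
  forall y, A y -> ~ X y -> exists2 x, x \in s & B x y].
have FF : ProperFilter F.
  split; first by move=> [s [sA s0]]; apply: (no s); split=> // y Ay; exact: s0.
  split.
  - by exists [::]; split=> // y _ [].
  - move=> X Y [s [sA sX]] [s' [sA' sY]]; exists (s ++ s'); split=> [x|y Ay].
      by rewrite mem_cat => /orP[/sA|/sA'].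
    move=> /not_andP[/(sX _ Ay)|/(sY _ Ay)] [x xs xy];
      by exists x; rewrite // mem_cat xs ?orbT.
  - move=> X Y XY [s [sA sX]]; exists s; split=> // y Ay nY.
    by apply: sX => // /XY.
have FA : F A by exists [::]; split.
have [x [Ax clx]] := cA F FF FA.
have Fx : F (A `\` B x).
  exists [:: x]; split=> [y|y Ay nB]; first by rewrite inE => /eqP ->.
  by exists x; [exact: mem_head|apply: contrapT => nBy; exact: nB].
by have [y [[_ nB] By]] := clx _ _ Fx (AB _ Ax).
Qed.

Section Characters.
Context {R : realType} {K : nonArchFieldType R}.
Variables (p : nat) (pi : K).
Hypothesis pK : p \in [pchar K].
Hypotheses (pi0 : 0 < nabs pi) (pi1 : nabs pi < 1).
Hypothesis K_lc : locally_compact [set: K].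

Let p_prime : prime p := pcharf_prime pK.
Let p_gt0 : (0 < p)%N := prime_gt0 p_prime.
Let p_gt1 : (1 < p)%N := pchar_gt1 pK.

Definition near_units (r : R) : set K := [set u | nabs (u - 1) <= nabs pi /\ nabs (u - 1) <= r].
Notation U1 := (near_units (nabs pi)).

Lemma near_unitsW r u : near_units r u -> U1 u.
Proof. by case. Qed.

Lemma one_unit_norm u : U1 u -> nabs u = 1.
Proof.
move=> [u1 _]; rewrite -(subrK 1 u) addrC nabsDl ?nabs1 //.
exact: le_lt_trans u1 pi1.
Qed.

Lemma one_unit_neq0 u : U1 u -> u != 0.
Proof. by move=> /one_unit_norm u1; rewrite -nabs_gt0 u1. Qed.

Lemma near_units_one r : 0 <= r -> near_units r 1.
Proof. by move=> r0; split; rewrite subrr nabs0 // ltW. Qed.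

Lemma near_units_mul r u v : near_units r u -> near_units r v -> near_units r (u * v).
Proof.
move=> Uu Uv; have v1 := one_unit_norm (near_unitsW Uv).
have -> : near_units r (u * v) = (nabs (u * v - 1) <= nabs pi /\ nabs (u * v - 1) <= r) by [].
have -> : u * v - 1 = (u - 1) * v + (v - 1) by rewrite mulrBl mul1r addrA subrK.
by case: Uu Uv => ? ? [? ?]; split; apply: nabsD_le => //; rewrite nabsM v1 mulr1.
Qed.

Lemma near_units_inv r u : near_units r u -> near_units r u^-1.
Proof.
move=> Uu; have u1 := one_unit_norm (near_unitsW Uu); have u0 := one_unit_neq0 (near_unitsW Uu).
have -> : near_units r u^-1 = (nabs (u^-1 - 1) <= nabs pi /\ nabs (u^-1 - 1) <= r) by [].
have -> : u^-1 - 1 = - (u - 1) / u by field.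
by rewrite nabsM nabsV u1 invr1 mulr1 nabsN.
Qed.

Lemma near_units_exp r u n : 0 <= r -> near_units r u -> near_units r (u ^+ n).
Proof.
by move=> r0 Uu; elim: n => [|n IH]; rewrite ?expr0 ?exprS; [exact: near_units_one|exact: near_units_mul].
Qed.

(** In characteristic p the p-th power is additive, and contracts the units to 1. *)
Lemma nabs_frob (u : K) : nabs (u ^+ p - 1) = nabs (u - 1) ^+ p.
Proof.
rewrite -nabsX; congr nabs.
have := pFrobenius_autB_comm pK (mulrC u 1 : GRing.comm u 1).
by rewrite !pFrobenius_autE expr1n => <-.
Qed.

Notation "x == y %[mod1]" := ((x - y) \is a Num.int) (at level 70, y at next level,
  format "x  ==  y  %[mod1]").

Lemma mod1_refl (x : rat) : x == x %[mod1].
Proof. by rewrite subrr. Qed.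

Lemma mod1_sym (x y : rat) : x == y %[mod1] -> y == x %[mod1].
Proof. by rewrite -opprB rpredN. Qed.

Lemma mod1_trans (x y z : rat) : x == y %[mod1] -> y == z %[mod1] -> x == z %[mod1].
Proof. by move=> xy yz; rewrite -(subrKA y) rpredD. Qed.

Lemma mod1_add (x y x' y' : rat) : x == y %[mod1] -> x' == y' %[mod1] ->
  x + x' == y + y' %[mod1].
Proof. by move=> xy xy'; rewrite opprD addrACA rpredD. Qed.

Lemma mod1_muln (x y : rat) n : x == y %[mod1] -> x *+ n == y *+ n %[mod1].
Proof. by move=> xy; rewrite -mulrnBl rpredMn. Qed.

(** *** Extension of characters *)

Section Extension.
Variable r : R.
Hypothesis r0 : 0 < r.

(** Open subgroups of the group of one-units. *)
Record subgroup (H : set K) : Prop := Subgroup {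
  sg_U : H `<=` U1; sg_r : near_units r `<=` H;
  sg_mul : forall u v, H u -> H v -> H (u * v);
  sg_inv : forall u, H u -> H u^-1 }.

Definition additive (H : set K) (f : K -> rat) :=
  forall u v, H u -> H v -> f (u * v) == f u + f v %[mod1].

Lemma sg_one H : subgroup H -> H 1.
Proof. by move=> sH; apply: (sg_r sH); apply: near_units_one; exact: ltW. Qed.

Lemma sg_exp H u n : subgroup H -> H u -> H (u ^+ n).
Proof.
move=> sH Hu; elim: n => [|n IH]; first by rewrite expr0; exact: sg_one.
by rewrite exprS; exact: (sg_mul sH).
Qed.

Lemma additive_exp H f u n : subgroup H -> additive H f -> H u ->
  f (u ^+ n) == f u *+ n %[mod1].
Proof.
move=> sH af Hu; elim: n => [|n IH].
  have := af 1 1 (sg_one sH) (sg_one sH); rewrite mulr1 expr0 mulr0n.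
  by move=> h; apply: mod1_sym; move: h; rewrite opprD addrA subrr !sub0r.
rewrite exprS mulrS; apply: mod1_trans (af _ _ Hu (sg_exp n sH Hu)) _.
exact: mod1_add (mod1_refl _) IH.
Qed.

(** A character with values in Q/Z extends to a group with one more generator l of
    order e modulo H: the value d at l must satisfy e d = f(l^e), which has a solution
    as Q/Z is divisible, and may be chosen. *)
Lemma adjoin_order H f l d e : subgroup H -> additive H f -> U1 l -> (0 < e)%N ->
    (forall n, H (l ^+ n) <-> (e %| n)%N) -> d *+ e == f (l ^+ e) %[mod1] ->
  exists H' f', [/\ subgroup H', additive H' f', H `<=` H', H' l &
    f' l == d %[mod1] /\ forall u, H u -> f' u == f u %[mod1]].
Proof.
move=> sH af Ul e0 He de; have l0 := one_unit_neq0 Ul.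
pose rep u := [set hj : K * nat | H hj.1 /\ u = hj.1 * l ^+ hj.2].
pose H' u := exists hj, rep u hj.
pose val (hj : K * nat) := f hj.1 + d *+ hj.2.
pose f' u := val (xget (1, 0%N) (rep u)).
have Hle : H (l ^+ e) by apply/He.
have val_le u h i h' j : (i <= j)%N -> rep u (h, i) -> rep u (h', j) ->
    val (h, i) == val (h', j) %[mod1].
  move=> ij [/= Hh uh] [/= Hh' uh'].
  have h'0 := one_unit_neq0 (sg_U sH Hh').
  have hE : h = h' * l ^+ (j - i).
    apply: (mulIf (expf_neq0 i l0)); rewrite -uh uh' -mulrA -exprD subnK //.
  have Hji : H (l ^+ (j - i)).
    have -> : l ^+ (j - i) = h * h'^-1 by rewrite hE mulrAC divff ?mul1r.
    by apply: (sg_mul sH) => //; exact: sg_inv sH _ _.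
  have /dvdnP[q qE] : (e %| j - i)%N by apply/He.
  rewrite /val /=; have -> : j = (i + (j - i))%N by rewrite subnKC.
  rewrite mulrnDr (addrC (d *+ i)) addrA; apply: mod1_add (mod1_refl _).
  rewrite hE; apply: mod1_trans (af _ _ Hh' Hji) _; apply: mod1_add (mod1_refl _) _.
  rewrite qE mulnC exprM mulrnA; apply: mod1_trans (additive_exp q sH af Hle) _.
  by apply: mod1_muln; exact: mod1_sym.
have val_uniq u hj hj' : rep u hj -> rep u hj' -> val hj == val hj' %[mod1].
  case: hj hj' => [h i] [h' j] r1 r2; case/orP: (leq_total i j) => ij.
    exact: val_le ij r1 r2.
  by apply: mod1_sym; exact: val_le ij r2 r1.
have f'E u hj : rep u hj -> f' u == val hj %[mod1].
  by move=> r1; apply: (val_uniq u) => //; exact: (xgetI (1, 0%N) r1).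
have repH u : H u -> rep u (u, 0%N) by move=> Hu; split; rewrite //= expr0 mulr1.
have rep_mul u v hj hj' : rep u hj -> rep v hj' ->
    rep (u * v) (hj.1 * hj'.1, (hj.2 + hj'.2)%N).
  move=> [Hu ->] [Hv ->]; split; first exact: (sg_mul sH).
  by rewrite /= exprD mulrACA.
have repl : rep l (1, 1%N) by split; [exact: sg_one|rewrite /= mul1r expr1].
exists H', f'; split.
- split.
  + move=> u [[h j] [/= Hh ->]]; apply: near_units_mul; first exact: (sg_U sH).
    by apply: near_units_exp => //; exact: nabs_ge0.
  + by move=> u /(sg_r sH)/repH Hu; exists (u, 0%N).
  + by move=> u v [a ra] [b rb]; eexists; exact: rep_mul ra rb.
  + move=> u [[h j] [/= Hh ->]]; exists (h^-1 * (l ^+ e) ^- j, (e.-1 * j)%N); split => /=.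
      apply: (sg_mul sH); first exact: (sg_inv sH).
      by apply: (sg_inv sH); exact: sg_exp.
    have hE : (l ^+ e) ^+ j = l ^+ j * l ^+ (e.-1 * j).
      by rewrite -exprD -exprM -mulSn prednK.
    rewrite hE invfM [(l ^+ j * _)^-1]invfM -!mulrA mulVf ?mulr1 //.
    exact: expf_neq0.
- move=> u v [a ra] [b rb]; apply: mod1_trans (f'E _ _ (rep_mul _ _ _ _ ra rb)) _.
  apply: (@mod1_trans _ (val a + val b)); last first.
    by apply: mod1_sym; apply: mod1_add; exact: f'E.
  rewrite /val /= mulrnDr (addrACA (f a.1)); apply: mod1_add (mod1_refl _).
  exact: af ra.1 rb.1.
- by move=> u Hu; exists (u, 0%N); exact: repH.
- by exists (1, 1%N).
- split=> [|u Hu].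
    apply: mod1_trans (f'E _ _ repl) _; rewrite /val /= mulr1n.
    have := additive_exp 0 sH af (sg_one sH); rewrite expr0 mulr0n => f1.
    by rewrite -{2}(add0r d); exact: mod1_add f1 (mod1_refl _).
  by apply: mod1_trans (f'E _ _ (repH _ Hu)) _; rewrite /val /= mulr0n addr0 mod1_refl.
Qed.

(** Large powers l^(p^k) lie in any neighbourhood of 1, so that l has finite order
    modulo H. *)
Lemma subgroup_order H l : subgroup H -> U1 l ->
  exists2 e, (0 < e)%N & forall n, H (l ^+ n) <-> (e %| n)%N.
Proof.
move=> sH Ul; have l0 := one_unit_neq0 Ul.
have ex : exists e, (0 < e)%N && `[<H (l ^+ e)>].
  have [k kr] : exists k, nabs (l - 1) ^+ (p ^ k) <= r.
    have [k kr] := small_power (nabs_ge0 _) (le_lt_trans Ul.1 pi1) r0.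
    exists k; apply: le_trans (ltW kr); apply: ler_wiXn2l; rewrite ?nabs_ge0 //.
      by apply: ltW; exact: le_lt_trans Ul.1 pi1.
    exact: ltnW (ltn_expl _ p_gt1).
  exists (p ^ k)%N; rewrite expn_gt0 p_gt0; apply/asboolP/(sg_r sH).
  have Ulk : U1 (l ^+ (p ^ k)) by apply: near_units_exp => //; exact: nabs_ge0.
  split; first exact: Ulk.1.
  suff -> : nabs (l ^+ (p ^ k) - 1) = nabs (l - 1) ^+ (p ^ k) by [].
  elim: (k) => [|j IH]; first by rewrite expn0 !expr1.
  by rewrite expnSr !exprM nabs_frob IH.
case: (ex_minnP ex) => e /andP[e0 /asboolP He] emin; exists e => // n; split=> [Hn|].
  rewrite /dvdn; case: posnP => // ne0.
  suff /emin : (0 < n %% e)%N && `[<H (l ^+ (n %% e))>].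
    by rewrite leqNgt ltn_mod e0.
  rewrite ne0; apply/asboolP.
  have -> : l ^+ (n %% e) = l ^+ n * ((l ^+ e) ^+ (n %/ e))^-1.
    apply: (mulIf (expf_neq0 (e * (n %/ e)) l0)).
    by rewrite -exprM -mulrA mulVf ?expf_neq0 // mulr1 -exprD addnC mulnC -divn_eq.
  by apply: (sg_mul sH) => //; apply: (sg_inv sH); exact: sg_exp.
by move=> /dvdnP[q ->]; rewrite mulnC exprM; exact: sg_exp.
Qed.

Lemma adjoin_list H f (s : seq K) : subgroup H -> additive H f ->
    (forall l, l \in s -> U1 l) ->
  exists H' f', [/\ subgroup H', additive H' f', H `<=` H', (forall l, l \in s -> H' l) &
    forall u, H u -> f' u == f u %[mod1]].
Proof.
move=> sH af; elim: s => [|l s IH] sU.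
  by exists H, f; split=> // u _; exact: mod1_refl.
have [H' [f' [sH' af' HH' Hs f'f]]] := IH (fun x xs => sU x (mem_behead (s := l :: s) xs)).
have Ul : U1 l by apply: sU; exact: mem_head.
have [e e0 He] := subgroup_order sH' Ul.
have [|H2 [f2 [sH2 af2 HH2 H2l [_ f2f]]]] := adjoin_order (d := f' (l ^+ e) / e%:R) sH' af' Ul e0 He.
  by rewrite -(mulr_natr (_ / _)) divfK ?pnatr_eq0 -?lt0n // mod1_refl.
exists H2, f2; split=> //; first exact: subset_trans HH' HH2.
  by move=> x; rewrite inE => /orP[/eqP ->|/Hs/HH2].
by move=> u Hu; apply: mod1_trans (f2f _ (HH' _ Hu)) (f'f _ Hu).
Qed.

Lemma unit_net : exists s : seq K, (forall l, l \in s -> U1 l) /\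
  forall u, U1 u -> exists2 l, l \in s & nabs (u - l) <= r.
Proof.
have clU : closed U1.
  have -> : U1 = (fun u => u - 1) @^-1` [set x | nabs x <= nabs pi].
    by apply/seteqP; split=> [u []//|u ?]; split.
  have cont : continuous (fun u : K => u - 1).
    have c1 : continuous (fun u : K => u) by move=> u; exact: cvg_id.
    have c2 : continuous (fun _ : K => - 1 : K) by move=> u; apply: cvg_const.
    have c := cont_op2 (h := fun x y : K => x + y) (@nabs_addC _ K) c1 c2; exact c.
  apply: preimage_closed; last exact: closed_nabs_le.
  by move=> u _; exact: cont.
have cU : compact U1.
  apply: (subclosed_compact clU (@compact_nabs_le _ _ K_lc 1)) => u /one_unit_norm u1 /=.
  by rewrite u1.
have [s [sU net]] := compact_net cU (B := fun l => [set u | nabs (l - u) < r])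
  (fun l _ => near_nabs l r0).
exists s; split=> // u /net[l ls lu]; exists l => //.
by rewrite -nabsN opprB; exact: ltW.
Qed.

(** By compactness finitely many generators are enough modulo [near_units r]. *)
Lemma extend_character H f : subgroup H -> additive H f ->
  exists f', additive U1 f' /\ forall u, H u -> f' u == f u %[mod1].
Proof.
move=> sH af; have [s [sU net]] := unit_net.
have [H' [f' [sH' af' HH' Hs f'f]]] := adjoin_list sH af sU.
exists f'; split=> // u v Uu Uv.
suff HU w : U1 w -> H' w by apply: af'; exact: HU.
move=> Uw; have [l ls wl] := net _ Uw.
have l0 := one_unit_neq0 (sU _ ls); rewrite -(divfK l0 w).
apply: (sg_mul sH'); last exact: Hs.
apply: (sg_r sH'); split; first by have [] := near_units_mul Uw (near_units_inv (sU _ ls)).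
have -> : w / l - 1 = (w - l) / l by field.
by rewrite nabsM nabsV (one_unit_norm (sU _ ls)) invr1 mulr1.
Qed.

End Extension.

Notation x0 := (1 + pi).

Lemma one_unit_x0 : U1 x0.
Proof. by split; rewrite addrC addKr. Qed.

Let near_units_sub r : 0 < r -> subgroup r (near_units r).
Proof.
move=> r0; split=> //; [exact: near_unitsW|exact: near_units_mul|exact: near_units_inv].
Qed.

(** The element 1 + pi has order p modulo the units of level |pi|^2, so that the value
    1/p may be prescribed there. *)
Lemma first_character : exists chi : K -> rat, [/\ additive U1 chi,
  (forall u, near_units (nabs pi ^+ 2) u -> chi u \is a Num.int) & chi x0 == p%:R^-1 %[mod1]].
Proof.
have r0 : 0 < nabs pi ^+ 2 by rewrite exprn_gt0.
have sH := near_units_sub r0.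
have a0 : additive (near_units (nabs pi ^+ 2)) (fun=> 0) by move=> u v _ _; exact: (mod1_refl 0).
have p0 : p%:R != 0 :> rat by rewrite pnatr_eq0 -lt0n.
have ep n : near_units (nabs pi ^+ 2) (x0 ^+ n) <-> (p %| n)%N.
  have Hp : near_units (nabs pi ^+ 2) (x0 ^+ p).
    have [Up _] := near_units_exp p (nabs_ge0 pi) one_unit_x0; split=> //.
    by rewrite nabs_frob addrC addKr; apply: ler_wiXn2l; rewrite ?nabs_ge0 // ltW.
  have [e e0 He] := subgroup_order r0 sH one_unit_x0; rewrite He.
  have : (e %| p)%N by apply/He.
  case/primeP: p_prime => _ prm /prm/orP[/eqP e1|/eqP -> //].
  have [_] : near_units (nabs pi ^+ 2) (x0 ^+ 1) by apply/He; rewrite e1.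
  rewrite expr1 addrC addKr expr2 -[X in X <= _]mulr1 ler_pM2l // => h.
  by have := lt_le_trans pi1 h; rewrite ltxx.
have [|H' [f' [sH' af' HH' H'x [f'x f'0]]]] :=
    adjoin_order (d := p%:R^-1) r0 sH a0 one_unit_x0 p_gt0 ep.
  by rewrite -(mulr_natr p%:R^-1) mulVf // subr0 rpred1.
have [f [af ff']] := extend_character r0 sH' af'.
exists f; split=> //; last exact: mod1_trans (ff' _ H'x) f'x.
by move=> u Uu; rewrite -(subr0 (f u)); exact: mod1_trans (ff' _ (HH' _ Uu)) (f'0 _ Uu).
Qed.

Let sU1 : subgroup (nabs pi) U1 := near_units_sub pi0.

(** The p-th power map is injective on one-units and u^p near 1 forces u near 1: the
    formula psi(u^p v) = chi(u), for v near 1, defines a character, whose extension psi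
    satisfies p psi(u) = psi(u^p) = chi(u). *)
Lemma divide_character chi r : 0 < r -> additive U1 chi ->
    (forall u, near_units r u -> chi u \is a Num.int) ->
  exists psi r', [/\ 0 < r', additive U1 psi, (forall u, near_units r' u -> psi u \is a Num.int) &
    forall u, U1 u -> psi u *+ p == chi u %[mod1]].
Proof.
move=> r0 ac chi_r; have rp0 : 0 < r ^+ p by rewrite exprn_gt0.
have chi_int u v : U1 u -> U1 v -> near_units (r ^+ p) ((u / v) ^+ p) -> chi u == chi v %[mod1].
  move=> Uu Uv [_]; rewrite nabs_frob ler_pXn2r ?nnegrE ?nabs_ge0 ?(ltW r0) // => uv.
  have Uuv : near_units r (u / v) by split=> //; have [] := near_units_mul Uu (near_units_inv Uv).
  rewrite -{1}(divfK (one_unit_neq0 Uv) u); apply: mod1_trans (ac _ _ (near_unitsW Uuv) Uv) _.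
  by rewrite addrK; exact: chi_r.
pose rep w := [set u : K | U1 u /\ near_units (r ^+ p) (w / u ^+ p)].
pose H w := exists u, rep w u.
pose f w := chi (xget 1 (rep w)).
have fE w u : rep w u -> f w == chi u %[mod1].
  move=> ru; have [Ux xw] : rep w (xget 1 (rep w)) := xgetI 1 ru.
  have [Uu uw] := ru; apply: chi_int => //.
  set x := xget _ _ in Ux xw *; have x0 := one_unit_neq0 Ux; have u0 := one_unit_neq0 Uu.
  have -> : (x / u) ^+ p = (w / u ^+ p) * (w / x ^+ p)^-1.
    have w0 : w != 0.
      apply/eqP => w0; have := one_unit_neq0 (near_unitsW uw).
      by rewrite w0 mul0r eqxx.
    have up := expf_neq0 p u0; have xp := expf_neq0 p x0; rewrite expr_div_n.
    by move: (u ^+ p) (x ^+ p) up xp => a b a0 b0; field; rewrite a0 b0 w0.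
  by apply: near_units_mul => //; exact: near_units_inv.
have rep_mul w w' u u' : rep w u -> rep w' u' -> rep (w * w') (u * u').
  move=> [Uu uw] [Uu' uw']; split; first exact: near_units_mul.
  by rewrite exprMn invfM mulrACA; exact: near_units_mul.
have Up u : U1 u -> U1 (u ^+ p) by apply: near_units_exp; exact: nabs_ge0.
have repp u : U1 u -> rep (u ^+ p) u.
  move=> Uu; split=> //; rewrite divff ?expf_neq0 ?one_unit_neq0 //.
  by apply: near_units_one; exact: ltW.
have rep1 w : near_units (r ^+ p) w -> rep w 1.
  by move=> Uw; split; [apply: near_units_one; exact: ltW|rewrite expr1n divr1].
have sH : subgroup (r ^+ p) H.
  split.
  - move=> w [u [Uu uw]]; rewrite -(divfK (one_unit_neq0 (Up _ Uu)) w).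
    by apply: near_units_mul; [exact: near_unitsW uw|exact: Up].
  - by move=> w Uw; exists 1; exact: rep1.
  - by move=> w w' [u ru] [u' ru']; exists (u * u'); exact: rep_mul.
  - move=> w [u [Uu uw]]; exists u^-1; split; first exact: near_units_inv.
    by rewrite exprVn -invfM; exact: near_units_inv.
have af : additive H f.
  move=> w w' [u ru] [u' ru']; apply: mod1_trans (fE _ _ (rep_mul _ _ _ _ ru ru')) _.
  apply: (@mod1_trans _ (chi u + chi u')); first exact: ac ru.1 ru'.1.
  by apply: mod1_sym; apply: mod1_add; exact: fE.
have [psi [apsi psif]] := extend_character rp0 sH af.
exists psi, (r ^+ p); split=> // u Uu.
  have := additive_exp pi0 0 sU1 ac (near_units_one (ltW pi0)).
  rewrite expr0 mulr0n subr0 => chi1; rewrite -(subr0 (psi u)).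
  apply: mod1_trans (psif _ (sg_r sH Uu)) _; apply: mod1_trans (fE _ _ (rep1 _ Uu)) _.
  by rewrite subr0.
apply: mod1_trans (mod1_sym (additive_exp pi0 p sU1 apsi Uu)) _.
have Hu : H (u ^+ p) by exists u; exact: repp.
by apply: mod1_trans (psif _ Hu) (fE _ _ (repp _ Uu)).
Qed.

Definition character_at (m : nat) (chi : K -> rat) := [/\ additive U1 chi,
  exists2 r, 0 < r & forall u, near_units r u -> chi u \is a Num.int &
  chi x0 == (p ^ m)%:R^-1 %[mod1]].

(** The quotient of a character by p is corrected by a multiple of the first character,
    which p kills, to take the prescribed value at 1 + pi. *)
Lemma next_character m chi : character_at m chi -> exists psi, character_at m.+1 psi /\
  forall u, U1 u -> psi u *+ p == chi u %[mod1].
Proof.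
move=> [ac [r r0 chi_r] chix].
have p0 : p%:R != 0 :> rat by rewrite pnatr_eq0 -lt0n.
have [psi [r' [r'0 apsi psi_r psip]]] := divide_character r0 ac chi_r.
have [chi1 [a1 chi1_r chi1x]] := first_character.
have [N NE] : exists N : int, psi x0 *+ p - (p ^ m)%:R^-1 = N%:~R.
  by apply/intrP; exact: mod1_trans (psip _ one_unit_x0) chix.
have r2 : 0 < nabs pi ^+ 2 by rewrite exprn_gt0.
have chi1p u : U1 u -> chi1 u *+ p \is a Num.int.
  move=> Uu; have Uup : near_units (nabs pi ^+ 2) (u ^+ p).
    split; first by have [] := near_units_exp p (nabs_ge0 pi) Uu.
    rewrite nabs_frob; apply: (@le_trans _ _ (nabs pi ^+ p)).
      by rewrite ler_pXn2r ?nnegrE ?nabs_ge0 //; exact: Uu.1.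
    by apply: ler_wiXn2l; rewrite ?nabs_ge0 // ltW.
  rewrite -(subr0 (_ *+ p)).
  apply: mod1_trans (mod1_sym (additive_exp pi0 p sU1 a1 Uu)) _.
  by rewrite subr0; exact: chi1_r.
exists (fun u => psi u - chi1 u * N%:~R); split; last first.
  move=> u Uu; rewrite mulrnBl addrAC rpredB ?psip // -mulrnAl.
  by rewrite rpredM ?intr_int ?chi1p.
split.
- move=> u v Uu Uv.
  have -> : forall a b c a' b' c' N : rat,
    (a - a' * N) - (b - b' * N + (c - c' * N)) = (a - (b + c)) - (a' - (b' + c')) * N.
    by move=> *; ring.
  by rewrite rpredB ?apsi // rpredM ?intr_int ?a1.
- exists (Num.min r' (nabs pi ^+ 2)) => [|u Uu]; first by rewrite lt_min r'0 r2.
  move: Uu => [U1u]; rewrite le_min => /andP[ur' ur2].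
  rewrite rpredB ?psi_r ?rpredM ?intr_int ?chi1_r //; by split.
- have pe : (p ^ m.+1)%:R^-1 = (p ^ m)%:R^-1 / p%:R :> rat.
    by rewrite expnS natrM invfM mulrC.
  have -> : psi x0 = (p ^ m)%:R^-1 / p%:R + N%:~R / p%:R.
    by rewrite -NE -mulrDl addrCA subrr addr0 -(mulr_natr (psi x0)) mulfK.
  rewrite pe; set q := (_ / _ : rat).
  have -> : forall a b c : rat, q + a / b - c * a - q = - ((c - b^-1) * a).
    by move=> *; ring.
  by rewrite rpredN rpredM ?intr_int.
Qed.

Lemma character_chain : exists2 chi : nat -> K -> rat, chi 0%N = (fun=> 0) &
  forall m, character_at m (chi m) /\ forall u, U1 u -> chi m.+1 u *+ p == chi m u %[mod1].
Proof.
have next : forall mc : nat * (K -> rat), exists psi : K -> rat,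
    character_at mc.1 mc.2 -> character_at mc.1.+1 psi /\
    forall u, U1 u -> psi u *+ p == mc.2 u %[mod1].
  move=> [m chi] /=.
  have [/next_character[psi h]|no] := pselect (character_at m chi); first by exists psi.
  by exists chi.
have [F FP] := choice next.
pose chi := fix chi m := if m is m'.+1 then F (m', chi m') else fun=> 0 : rat.
have chiP m : character_at m (chi m).
  elim: m => [|m IH]; last by have [] := FP (m, chi m) IH.
  split=> /=; first by move=> u v _ _; exact: (mod1_refl 0).
    by exists 1 => // u _; exact: (rpred0 Num.int).
  by rewrite expn0 invr1 sub0r rpredN rpred1.
by exists chi => // m; split=> //; exact: (FP (m, chi m) (chiP m)).2.
Qed.

Lemma mod1_fracn m a b : (a%:R / (p ^ m)%:R : rat) == b%:R / (p ^ m)%:R %[mod1] ->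
  (a = b %[mod p ^ m])%N.
Proof.
have P0 : (p ^ m)%:R != 0 :> rat by rewrite pnatr_eq0 expn_eq0 -leqn0 leqNgt p_gt0.
rewrite -mulrBl => /intrP[k /(canRL (divfK P0)) kE].
have {}kE : (a%:Z = k * (p ^ m)%N%:Z + b%:Z)%R.
  apply: (@intr_inj rat); rewrite rmorphD rmorphM /= -!pmulrn -kE subrK //.
by have := modzMDl k b%:Z (p ^ m)%N%:Z; rewrite -kE !modz_nat => -[].
Qed.

(** A compatible chain of characters with values in (1/p^m)Z/Z is a continuous
    homomorphism to the p-adic integers. Its values are given by their residues c m u
    modulo p^m. *)
Lemma padic_logarithm : exists (zeta : K -> padic p) (c : nat -> K -> nat),
  [/\ forall u m, U1 u -> agree m (zeta u) (digits p_gt1 (c m u)),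
      forall u v m, U1 u -> U1 v -> (c m (u * v)%R = c m u + c m v %[mod p ^ m])%N,
      zeta x0 = digits p_gt1 1,
      zeta 1 = digits p_gt1 0 &
      forall u m, U1 u -> exists2 r, 0 < r &
        forall v, U1 v -> nabs (u - v) <= r -> agree m (zeta u) (zeta v)].
Proof.
have [chi chi_0 chiP] := character_chain.
have P0 m : (p ^ m)%:R != 0 :> rat by rewrite pnatr_eq0 expn_eq0 -leqn0 leqNgt p_gt0.
have chi_int m u : U1 u -> chi m u *+ p ^ m \is a Num.int.
  move=> Uu; elim: m => [|m IH]; first by rewrite chi_0 mul0rn rpred0.
  rewrite expnS mulrnA -(subrK (chi m u *+ p ^ m) (_ *+ _ *+ _)) rpredD //.
  by apply: mod1_muln; exact: (chiP m).2.
have chi_frac (mu : nat * K) : exists n : nat, U1 mu.2 ->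
    chi mu.1 mu.2 == n%:R / (p ^ mu.1)%:R %[mod1].
  case: mu => m u /=.
  have [Uu|nU] := pselect (U1 u); last by exists 0%N.
  have /intrP[N NE] := chi_int m u Uu.
  exists (absz (N %% (p ^ m)%N)%Z) => _.
  have chiE : chi m u = N%:~R / (p ^ m)%:R by rewrite -NE -(mulr_natr (chi m u)) mulfK.
  have -> : (absz (N %% (p ^ m)%N)%Z)%:R = (N %% (p ^ m)%N)%Z%:~R :> rat.
    have : (0 <= (N %% (p ^ m)%N)%Z)%R.
      by apply: modz_ge0; rewrite eqz_nat expn_eq0 -leqn0 leqNgt p_gt0.
    by move=> h; rewrite -{2}(gez0_abs h) -pmulrn.
  rewrite chiE -mulrBl {1}(divz_eq N (p ^ m)%N) rmorphD rmorphM /= addrK.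
  by rewrite mulfK ?intr_int // -pmulrn.
have [c0 c0P] := choice chi_frac; pose c m u := c0 (m, u).
have cP m u : U1 u -> chi m u == (c m u)%:R / (p ^ m)%:R %[mod1] by exact: c0P (m, u).
have cD m u v : U1 u -> U1 v -> (c m (u * v)%R = c m u + c m v %[mod p ^ m])%N.
  move=> Uu Uv; apply: mod1_fracn; apply: mod1_trans (mod1_sym (cP _ _ (near_units_mul Uu Uv))) _.
  have [[ac _ _] _] := chiP m; apply: mod1_trans (ac _ _ Uu Uv) _.
  by rewrite natrD mulrDl; apply: mod1_add; exact: cP.
have cS m u : U1 u -> (c m.+1 u = c m u %[mod p ^ m])%N.
  move=> Uu; apply: mod1_fracn; apply: mod1_trans (cP _ _ Uu).
  apply: mod1_trans ((chiP m).2 _ Uu); apply: mod1_sym.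
  have -> : (c m.+1 u)%:R / (p ^ m)%:R = (c m.+1 u)%:R / (p ^ m.+1)%:R *+ p :> rat.
    rewrite expnS natrM -(mulr_natr (_ / _)); have := P0 m; have := P0 1%N; rewrite expn1.
    by move: (p ^ m)%N (c m.+1 u) => P k *; field; apply/andP.
  by apply: mod1_muln; exact: cP.
have cle m n u : (m <= n)%N -> U1 u -> (c n u = c m u %[mod p ^ m])%N.
  move=> mn Uu; rewrite -(subnK mn); elim: (n - m)%N => [|k IH] //.
  rewrite addSn -IH; have /(congr1 (fun k => k %% p ^ m)%N) := cS (k + m)%N u Uu.
  by rewrite /= !modn_dvdm // dvdn_exp2l // leq_addl.
pose zeta u : padic p := fun i => digits p_gt1 (c i.+1 u) i.
have zetaE u m : U1 u -> agree m (zeta u) (digits p_gt1 (c m u)).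
  move=> Uu i im; rewrite /zeta.
  by apply: (@digits_agree p p_gt1 i.+1) => //; apply/esym; exact: cle.
have zeta_digits u n : U1 u -> (forall m, (c m u = n %[mod p ^ m])%N) ->
    zeta u = digits p_gt1 n.
  move=> Uu cn; apply: funext => i; apply: (@digits_agree p p_gt1 i.+1) => //; exact: cn.
have U11 : U1 1 by apply: near_units_one; exact: ltW.
exists zeta, c; split=> //.
- by move=> u v m; exact: cD.
- apply: zeta_digits one_unit_x0 _ => m; apply: mod1_fracn.
  apply: mod1_trans (mod1_sym (cP _ _ one_unit_x0)) _; rewrite mul1r.
  by have [[_ _]] := chiP m.
- apply: (zeta_digits _ _ U11) => m; have := cD m 1 1 U11 U11; rewrite mulr1.
  by move=> /eqP; rewrite -{1}(addn0 (c m 1)) eqn_modDl => /eqP.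
- move=> u m Uu; have [[ac [r r0 chi_r] _] _] := chiP m; exists r => // v Uv uv.
  apply: agree_trans (zetaE u m Uu) _; apply: agree_sym.
  apply: agree_trans (zetaE v m Uv) _; apply: digits_agree; apply/esym/mod1_fracn.
  apply: mod1_trans (mod1_sym (cP _ _ Uu)) _; apply: mod1_trans (cP _ _ Uv).
  have v0 := one_unit_neq0 Uv; rewrite -{1}(divfK v0 u).
  have Uuv : near_units r (u / v).
    split; first by have [] := near_units_mul Uu (near_units_inv Uv).
    have -> : u / v - 1 = (u - v) / v by field.
    by rewrite nabsM nabsV (one_unit_norm Uv) invr1 mulr1.
  by apply: mod1_trans (ac _ _ (near_unitsW Uuv) Uv) _; rewrite addrK; exact: chi_r.
Qed.

End Characters.

(** * Families of maps and the diffeomorphism group *)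

Section OpenPreimage.
Variables (S T : topologicalType) (D : set S) (E : set T) (f : S -> T).

Lemma open_cont_pre : open D -> cont_on D f -> open E -> open [set x | D x /\ E (f x)].
Proof.
move=> oD cf oE; rewrite openE => x [Dx Ex].
by apply: filterI; [exact: open_nbhs_nbhs|apply: cf => //; exact: open_nbhs_nbhs].
Qed.

End OpenPreimage.

Section Charts.
Context {R : realType} {K : nonArchFieldType R} {d : nat} {M : topologicalType}.
Variable C : chart K d M.
Notation V := 'rV[K]_d.

Definition cimg : set V := cfun C @` cdom C.

Lemma cimg_cinv y : cimg y -> cdom C (cinv C y) /\ cfun C (cinv C y) = y.
Proof. by move=> [m Dm <-]; rewrite cfunK. Qed.

Lemma cimg_cfun m : cdom C m -> cimg (cfun C m).
Proof. by move=> Dm; exists m. Qed.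

Lemma cinv_on : cont_on cimg (cinv C).
Proof. have [h _] := within_cont_on (cinv C) (@cimg_open _ _ _ _ C); by apply: h; exact: cinv_cont. Qed.

Lemma cfun_on : cont_on (cdom C) (cfun C).
Proof. have [h _] := within_cont_on (cfun C) (@cdom_open _ _ _ _ C); by apply: h; exact: cfun_cont. Qed.

Lemma cimg_sub (Q : set M) :
  cfun C @` (cdom C `&` Q) = [set y | cimg y /\ Q (cinv C y)].
Proof.
apply/seteqP; split=> [_ [m [Dm Qm] <-]|y [/cimg_cinv[Dy yE] Qy]].
  by split; [exact: cimg_cfun|rewrite cfunK].
by exists (cinv C y).
Qed.

Lemma cimg_sub_open (Q : set M) : open Q -> open (cfun C @` (cdom C `&` Q)).
Proof. by rewrite cimg_sub => oQ; apply: open_cont_pre; [exact: cimg_open|exact: cinv_on|]. Qed.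

End Charts.

Section ParameterMaps.
Context {R : realType} {K : nonArchFieldType R}.
Variables (S : topologicalType) (hS : hausdorff_space S) (b : bool).
Notation obj := (@obj R K).

(** Parameters are carried along: they contribute no increments. *)
Lemma Cr_paro n (X Y : obj) (D : set X) (f : X -> Y) : open D -> Cr (drule b) n D f ->
  Cr (drule b) n (X := paro hS X) (Y := paro hS Y) [set sx : S * X | D sx.2]
    (fun sx => (sx.1, f sx.2)).
Proof.
elim: n X Y D f => [|n IH] X Y D f oD.
  move=> cf; apply: cont_on_pair => [[s x] Dx|]; first exact: cvg_fst.
  apply: (cont_on_comp (E := D)) cf => // sx _; exact: cvg_snd.
move=> [cf [df [fE cdf]]]; split.
  apply: cont_on_pair => [[s x] Dx|]; first exact: cvg_fst.
  apply: (cont_on_comp (E := D)) cf => // sx _; exact: cvg_snd.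
exists (fun y => df (y.1.1.2, y.1.2, y.2)); split.
  by move=> [[[s x] v] t] [/= Dx Dy]; rewrite /sh /=; congr pair; exact: (fE (x, v, t)).
have oTD := @Tset_open _ _ (drule b) X D oD.
have c1 := IH _ _ _ _ oTD cdf.
pose u (y : To (drule b) (paro hS X)) : paro hS (To (drule b) X) :=
  (y.1.1.1, (y.1.1.2, y.1.2, y.2)).
have l1 : @lin R K (To (drule b) (paro hS X)) (paro hS (To (drule b) X)) u (fun _ w => w).
  split => //=; last exact: cont_snd.
  by apply: cont_pair; [|apply: cont_pair; [apply: cont_pair|]]; cont_proj.
have l2 : @lin R K (paro hS (To (drule b) Y)) (To (drule b) (paro hS Y))
    (fun y => ((y.1, y.2.1.1), y.2.1.2, y.2.2)) (fun _ w => w).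
  split => //=; last exact: cont_snd.
  by apply: cont_pair; [apply: cont_pair; [apply: cont_pair|]|]; cont_proj.
pose D' : set (To (drule b) (paro hS X)) :=
  [set y | @Tset _ _ (drule b) X D (y.1.1.2, y.1.2, y.2)].
have c0 := Cr_lin (@drule_functorial R K b) n D' l1.
pose E' : set (paro hS (To (drule b) X)) := [set sx | @Tset _ _ (drule b) X D sx.2].
have DE y : D' y -> E' (u y) by [].
have c2 := Cr_compl (Cr_comp (E := E') DE c0 c1) l2.
apply: Cr_sub c2 => -[[[s x] v] t] [/= Dx Dy]; split=> //.
Qed.

End ParameterMaps.

Section Families.
Context {R : realType} {K : nonArchFieldType R} {d : nat} {alpha : smoothness}.
Context {M : topologicalType} (A : atlas K d alpha M).
Notation V := 'rV[K]_d.
Notation vecV := (vec (@rV_tmod R K d)).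
Notation r := (@smooth_rule R K alpha).
Notation n := (smooth_order alpha).
Variables (Z : topologicalType) (hZ : hausdorff_space Z).

(** The arguments (z, x) for which G z can be read between the charts i and j at x. *)
Definition family_dom (G : Z * M -> M) (i j : cidx A) : set (Z * V) :=
  [set zx | cimg (A i) zx.2 /\ cdom (A j) (G (zx.1, cinv (A i) zx.2))].

Definition family_fun (G : Z * M -> M) (i j : cidx A) (zx : Z * V) : V :=
  cfun (A j) (G (zx.1, cinv (A i) zx.2)).

Definition smooth_family (G : Z * M -> M) :=
  forall i j, Br r n (X := paro hZ vecV) (family_dom G i j) (family_fun G i j).

Lemma family_dom_open G i j : continuous G -> open (family_dom G i j).
Proof.
move=> cG.
have -> : family_dom G i j = [set zx | [set zx : Z * V | cimg (A i) zx.2] zx /\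
  [set zm | cdom (A j) (G zm)] (zx.1, cinv (A i) zx.2)] by [].
have oD : open [set zx : Z * V | cimg (A i) zx.2].
  by apply: (@open_comp _ _ snd) (@cimg_open _ _ _ _ (A i)) => zx _; exact: cvg_snd.
apply: open_cont_pre => //.
  apply: cont_on_pair => [zx _|]; first exact: cvg_fst.
  apply: (cont_on_comp (E := cimg (A i))) (cinv_on (C := A i)) => // zx _; exact: cvg_snd.
by apply: (open_comp _ (@cdom_open _ _ _ _ (A j))) => zm _; exact: cG.
Qed.

Lemma family_slice G z : continuous G -> smooth_family G ->
  smooth_map A (fun m => G (z, m)).
Proof.
move=> cG sG i j; rewrite cimg_sub.
have h := smooth_slice (@family_dom_open G i j cG) (sG i j) z; exact h.
Qed.

Lemma trans_Br i j : Br r n (X := vecV) (cfun (A i) @` (cdom (A i) `&` cdom (A j)))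
  (cfun (A j) \o cinv (A i)).
Proof. by apply: smooth_Br (atrans i j); exact/cimg_sub_open/cdom_open. Qed.

Lemma smooth_ruleE : exists b, r = drule b.
Proof. by case: (alpha) => k; [exists false|exists true]. Qed.

Lemma Br_compr (X : obj) (D : set X) (E : set V) (f : X -> vecV) (g : V -> V) :
  (forall x, D x -> E (f x)) -> Br r n D f -> Br r n (X := vecV) E g ->
  Br r n D (g \o f).
Proof.
have [b ->] := smooth_ruleE => DE Bf Bg.
exact/Cr_Br/(Cr_comp (E := E : set vecV) DE (Br_Cr Bf))/Br_Cr.
Qed.

(** Smoothness of a family is local and can be tested in any charts, by the chain
    rule and the smoothness of the transition maps. *)
Theorem family_local G : continuous G ->
  (forall z m, exists i j (E : set (Z * V)), [/\ open E, cdom (A i) m,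
    E (z, cfun (A i) m), E `<=` family_dom G i j & Br r n (X := paro hZ vecV) E (family_fun G i j)]) ->
  smooth_family G.
Proof.
move=> cG loc i j.
have [b rE] := smooth_ruleE.
have oD := @family_dom_open G i j cG.
suff : Br (drule b) n (X := paro hZ vecV) (family_dom G i j) (family_fun G i j) by rewrite -rE.
apply: (@Br_local R K (drule b) (@drule_quotients R K b) n (paro hZ vecV) d _ _ oD).
move=> -[z x] [/= xi Gj].
have [Dm xE] := cimg_cinv xi; set m := cinv (A i) x in Dm Gj xE.
have [k [l [E [oE km Em EG BE]]]] := loc z m.
pose S := cfun (A i) @` (cdom (A i) `&` cdom (A k)).
have oS : open S by exact/cimg_sub_open/cdom_open.
have SE y : S y = (cimg (A i) y /\ cdom (A k) (cinv (A i) y)) by rewrite /S cimg_sub.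
pose tau (zx : Z * V) : Z * V := (zx.1, cfun (A k) (cinv (A i) zx.2)).
have oST : open [set zx : Z * V | S zx.2].
  by apply: (@open_comp _ _ snd) oS => zx _; exact: cvg_snd.
have ctau : Cr (drule b) n (X := paro hZ vecV) (Y := paro hZ vecV) [set zx | S zx.2] tau.
  have B0 := trans_Br i k; rewrite rE in B0.
  have c := @Cr_paro R K Z hZ b n vecV vecV S _ oS (Br_Cr B0); exact c.
pose D1 : set (Z * V) := [set zx | [set zx : Z * V | S zx.2] zx /\ E (tau zx)].
have oD1 : open D1 by apply: open_cont_pre => //; exact: Cr_cont ctau.
pose D2 : set (Z * V) := D1 `&` family_dom G i j.
have oD2 : open D2 by exact: openI.
have Gtau zx : S zx.2 -> G ((tau zx).1, cinv (A k) (tau zx).2) = G (zx.1, cinv (A i) zx.2).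
  by rewrite SE => -[_ Dk]; rewrite /tau /= cfunK.
exists D2; split=> //.
  by do 2 split=> //=; rewrite ?SE.
have B1 : Br (drule b) n (X := paro hZ vecV) D2 (family_fun G k l \o tau).
  apply: Cr_Br; apply: (Cr_comp (E := E : set (paro hZ vecV))); last by apply: Br_Cr; rewrite -rE.
    by move=> zx [[_]].
  by apply: Cr_sub ctau => zx [[]].
have B2 : Br (drule b) n (X := paro hZ vecV) D2
    ((cfun (A j) \o cinv (A l)) \o (family_fun G k l \o tau)).
  rewrite -rE; apply: (Br_compr (E := cfun (A l) @` (cdom (A l) `&` cdom (A j)))).
  - move=> zx [[Szx Ezx] [_ Gj']]; have [_ Gl] := EG _ Ezx.
    exists (G ((tau zx).1, cinv (A k) (tau zx).2)) => //; split=> //.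
    by rewrite Gtau.
  - by rewrite rE.
  - exact: trans_Br.
apply: Br_eq B2 => // zx [[Szx Ezx] _] /=; have [_ Gl] := EG _ Ezx.
by rewrite /family_fun cfunK // Gtau.
Qed.

End Families.

Section Diffeomorphisms.
Context {R : realType} {K : nonArchFieldType R} {d : nat} {alpha : smoothness}.
Context {M : topologicalType} (A : atlas K d alpha M).
Notation V := 'rV[K]_d.
Notation vecV := (vec (@rV_tmod R K d)).
Notation r := (@smooth_rule R K alpha).
Notation n := (smooth_order alpha).

Lemma diffeo_ext (f g : diffeo A) : dfun f = dfun g -> f = g.
Proof. by case: f g => [f fP] [g gP] /= fg; subst g; congr Diffeo; exact: Prop_irrelevance. Qed.

Lemma diffeo_cont (f : diffeo A) : continuous f.
Proof. by have [g [_ _ []]] := dfunP f. Qed.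

Lemma diffeo_smooth (f : diffeo A) : smooth_map A f.
Proof. by have [g [_ _ _ []]] := dfunP f. Qed.

Lemma diffeo_inverse (f : diffeo A) : exists g : diffeo A, cancel f g /\ cancel g f.
Proof.
have [g [fK gK [cf cg] [sf sg]]] := dfunP f.
have gP : exists g', [/\ cancel g g', cancel g' g, continuous g /\ continuous g' &
    smooth_map A g /\ smooth_map A g'] by exists f; split.
by exists (Diffeo gP).
Qed.

(** The chain rule in charts, by the local criterion for a constant family. *)
Lemma smooth_comp (f g : M -> M) : continuous f -> continuous g ->
  smooth_map A f -> smooth_map A g -> smooth_map A (f \o g).
Proof.
move=> cf cg sf sg.
pose Z := 'rV[K]_0; have hZ := @vnorm_hausdorff R K 0.
pose G (zm : Z * M) := f (g zm.2).
have cG : continuous G.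
  by apply: (cont_comp _ cf); apply: (cont_comp _ cg); exact: cont_snd.
suff sG : smooth_family A hZ G by exact: (family_slice (0 : Z) cG sG).
apply: family_local => // z m.
have [i Di] := acover A m; have [k Dk] := acover A (g m); have [j Dj] := acover A (f (g m)).
pose Q := g @^-1` cdom (A k) `&` (f \o g) @^-1` cdom (A j).
have oQ : open Q.
  apply: openI; first by apply: (open_comp _ (@cdom_open _ _ _ _ (A k))) => x _; exact: cg.
  apply: (open_comp _ (@cdom_open _ _ _ _ (A j))) => x _.
  by apply: continuous_comp; [exact: cg|exact: cf].
pose S := cfun (A i) @` (cdom (A i) `&` Q).
have oS : open S by exact: cimg_sub_open.
have SE y : S y = (cimg (A i) y /\ Q (cinv (A i) y)) by rewrite /S cimg_sub.
have oU h a b : continuous h -> open (cfun (A a) @` (cdom (A a) `&` h @^-1` cdom (A b))).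
  move=> ch; apply: cimg_sub_open; apply: (open_comp _ (@cdom_open _ _ _ _ (A b))) => x _.
  exact: ch.
have Bg := smooth_Br (oU g i k cg) (sg i k).
have Bf := smooth_Br (oU f k j cf) (sf k j).
have Bfg : Br r n (X := vecV) S (in_charts k j f \o in_charts i k g).
  apply: Br_compr Bf; last first.
    by apply: Br_sub Bg => _ [x [Dx [Qx _]] <-]; exists x.
  move=> y; rewrite SE => -[yi [Q1 Q2]].
  by exists (g (cinv (A i) y)).
have l : @lin R K (paro hZ vecV) vecV snd (fun _ v => v).
  by split => //=; exact: cont_snd.
have [b rE] := @smooth_ruleE R K alpha.
exists i, j, [set zx | S zx.2]; split=> //.
- by apply: (@open_comp _ _ snd) oS => zx _; exact: cvg_snd.
- by exists m.
- by move=> zx /=; rewrite SE => -[zi [_ Q2]].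
have Bl : Br r n (X := paro hZ vecV) [set zx | S zx.2]
    ((in_charts k j f \o in_charts i k g) \o snd).
  rewrite rE in Bfg *.
  by apply: (Br_lin (@drule_functorial R K b) (E := S : set vecV) _ l).
apply: Br_eq Bl; first by apply: (@open_comp _ _ snd) oS => zx _; exact: cvg_snd.
move=> zx /=; rewrite SE => -[zi [/= Q1 Q2]].
by rewrite /in_charts /= cfunK.
Qed.

Lemma diffeo_comp (f g : diffeo A) : exists h : diffeo A, dfun h = f \o g.
Proof.
have [f' [fK f'K [cf cf'] [sf sf']]] := dfunP f.
have [g' [gK g'K [cg cg'] [sg sg']]] := dfunP g.
have hP : exists h, [/\ cancel (f \o g) h, cancel h (f \o g),
    continuous (f \o g) /\ continuous h & smooth_map A (f \o g) /\ smooth_map A h].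
  exists (g' \o f'); split; [exact: can_comp|exact: can_comp| |].
    by split=> x; apply: continuous_comp; auto; [exact: cg|exact: cf|exact: cf'|exact: cg'].
  by split; exact: smooth_comp.
by exists (Diffeo hP).
Qed.

Lemma diffeo_id : exists h : diffeo A, dfun h = idfun.
Proof.
have cid : continuous (@idfun M) by move=> x; exact: cvg_id.
have sid : smooth_map A idfun by move=> i j; exact: atrans.
have hP : exists h : M -> M, [/\ cancel (@idfun M) h, cancel h (@idfun M),
    continuous (@idfun M) /\ continuous h & smooth_map A idfun /\ smooth_map A h].
  by exists idfun; split; [by []|by []|exact: (conj cid cid)|exact: (conj sid sid)].
by exists (Diffeo hP).
Qed.

(** *** The topology of the diffeomorphism group *)

Definition near_diffeo (f0 : diffeo A) i j (O : set V) k rho eps : set (diffeo A) :=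
  [set f : diffeo A | f @` (cinv (A i) @` closure O) `<=` cdom (A j) /\
     close_on alpha k O rho eps (in_charts i j f0) (in_charts i j f)].

Lemma close_on_refl (k : nat) (U : set V) rho eps (f : V -> V) : 0 < eps ->
  close_on alpha k U rho eps f f.
Proof. by move=> e0; case: (alpha) => m y _ _; exact: ballxx. Qed.

Lemma nbhs_near_diffeo (f0 : diffeo A) i j O k rho eps : open O -> vbounded O ->
  closure O `<=` cimg (A i) -> f0 @` (cinv (A i) @` closure O) `<=` cdom (A j) ->
  (k <= n)%N -> 0 < eps -> nbhs f0 (near_diffeo f0 i j O k rho eps).
Proof.
move=> oO bO Oi Oj kn e0; pose N := near_diffeo f0 i j O k rho eps.
have sN : diffeo_subbase (A := A) N by exists f0, i, j, O, k, rho, eps; split.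
rewrite nbhsE; exists N => //; split; last by split=> //; exact: close_on_refl.
exists [set N]; last by rewrite bigcup_set1.
move=> _ ->; exists [fset N]%fset.
  by move=> B /fset1P ->; exact/mem_set.
by rewrite set_fset1 bigcap_set1.
Qed.

(** Convergence in the diffeomorphism group is tested on the subbase. *)
Lemma nbhs_diffeo (f : diffeo A) (F : set_system (diffeo A)) : Filter F ->
  (forall N, diffeo_subbase (A := A) N -> N f -> F N) -> nbhs f `<=` F.
Proof.
move=> FF FN W; rewrite nbhsE => -[_ [[B sB <-] [C BC Cf]] BW].
apply: filterS BW _; apply: (@filterS _ _ _ C).
  by move=> g Cg; exists C.
have [D sD DC] := sB _ BC; rewrite -DC.
apply: filter_bigI => N ND; apply: FN; first by apply: set_mem; exact: sD.
by move: Cf; rewrite -DC => /(_ N ND).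
Qed.

End Diffeomorphisms.

(** * Diffeomorphisms near the identity *)

Section Evaluation.
Context {R : realType} {K : nonArchFieldType R} {d : nat} {alpha : smoothness}.
Context {M : topologicalType} (A : atlas K d alpha M).
Notation V := 'rV[K]_d.
Notation n := (smooth_order alpha).

Lemma in_charts_smooth (f : diffeo A) i j (O : set V) : open O ->
  (forall x, O x -> cimg (A i) x /\ cdom (A j) (f (cinv (A i) x))) ->
  smooth alpha O (in_charts i j f).
Proof.
move=> oO Of; have := diffeo_smooth (A := A) f i j; rewrite cimg_sub => sf.
apply: smooth_sub sf => //.
apply: open_cont_pre; [exact: cimg_open|exact: cinv_on|].
by apply: (open_comp _ (@cdom_open _ _ _ _ (A j))) => x _; exact: diffeo_cont.
Qed.

Lemma near_diffeo_in (f g : diffeo A) i j (O : set V) k rho eps :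
  near_diffeo f i j O k rho eps g -> forall x, closure O x -> cdom (A j) (g (cinv (A i) x)).
Proof. by move=> [Og _] x Ox; apply: Og; exists (cinv (A i) x) => //; exists x. Qed.

Section Bounds.
Variables (f g : diffeo A) (i j : cidx A) (O : set V) (rho eps : R).
Hypotheses (oO : open O) (Oi : O `<=` cimg (A i)) (e0 : 0 < eps).
Hypothesis Of : forall x, O x -> cdom (A j) (f (cinv (A i) x)).

Let smooth_f : smooth alpha O (in_charts i j f).
Proof. by apply: in_charts_smooth => // x Ox; split; [exact: Oi|exact: Of]. Qed.

Let smooth_g k : near_diffeo f i j O k rho eps g -> smooth alpha O (in_charts i j g).
Proof.
move=> fg; apply: in_charts_smooth => // x Ox; split; first exact: Oi.
by apply: (near_diffeo_in fg); exact: subset_closure.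
Qed.

Lemma near_diffeo0 x : near_diffeo f i j O 0 rho eps g -> O x ->
  vnorm (in_charts i j f x - in_charts i j g x) < eps.
Proof.
by move=> fg Ox; have := close_on0 oO e0 smooth_f (smooth_g fg) fg.2 Ox.
Qed.

Lemma near_diffeo1 x v t : near_diffeo f i j O 1 rho eps g -> (0 < n)%N ->
  O x -> O (x + t *: v) -> vnorm v <= rho -> t != 0 -> nabs t <= 1 ->
  vnorm ((in_charts i j f (x + t *: v) - in_charts i j f x) -
         (in_charts i j g (x + t *: v) - in_charts i j g x)) < nabs t * eps.
Proof.
move=> fg n0 Ox Oy vr t0 t1.
exact: (close_on1 oO e0 n0 smooth_f (smooth_g fg) fg.2 Ox Oy vr t0 t1).
Qed.

End Bounds.

Lemma vball_closure (x : V) (r : R) :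
  closure [set y | vnorm (x - y) < r] = [set y | vnorm (x - y) < r].
Proof. by apply/esym/closure_id; exact: vball_closed. Qed.

Lemma vball_bounded (x : V) (r : R) : vbounded [set y | vnorm (x - y) < r].
Proof.
exists (Num.max (vnorm x) r) => y /= xy; rewrite -(subKr x y).
by apply: vnormB_le; rewrite le_max ?lexx // (ltW xy) orbT.
Qed.

(** Neighbourhoods in the diffeomorphism group control the values of the maps on small
    clopen balls. *)
Lemma eval_cont m : continuous (fun g : diffeo A => g m).
Proof.
move=> f U fU; have [i Di] := acover A m; have [j Dj] := acover A (f m).
pose x := cfun (A i) m.
have xE : cinv (A i) x = m by rewrite /x cfunK.
pose D := [set y | cimg (A i) y /\ (f @^-1` cdom (A j)) (cinv (A i) y)].
have oD : open D.
  apply: open_cont_pre; [exact: cimg_open|exact: cinv_on|].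
  by apply: (open_comp _ (@cdom_open _ _ _ _ (A j))) => y _; exact: diffeo_cont.
have Dx : D x by split; [exact: cimg_cfun|rewrite /preimage /= xE].
have [r r0 rD] := (nbhs_vnormP _ _).1 (open_nbhs_nbhs (conj oD Dx)).
have [eps e0 eU] : exists2 eps, 0 < eps & forall y, cdom (A j) y ->
    vnorm (cfun (A j) (f m) - cfun (A j) y) < eps -> U y.
  have : nbhs (cfun (A j) (f m)) [set y | U (cinv (A j) y)].
    apply: (cinv_on (cimg_cfun Dj)); rewrite cfunK //; exact: fU.
  move=> /nbhs_vnormP[eps e0 eU]; exists eps => // y Dy fy.
  by rewrite -(cfunK Dy); exact: eU.
pose O := [set y : V | vnorm (x - y) < r].
have oO : open O by exact: vball_open.
have clO : closure O = O by exact: vball_closure.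
have Ox : O x by rewrite /O /= subrr vnorm0.
have Oi : O `<=` cimg (A i) by move=> y /rD [].
have Of y : O y -> cdom (A j) (f (cinv (A i) y)) by move=> /rD [].
have := @nbhs_near_diffeo _ _ _ _ _ A f i j O 0 0 eps oO (vball_bounded x r).
rewrite clO => /(_ Oi); have Oj : f @` (cinv (A i) @` O) `<=` cdom (A j).
  by move=> _ [_ [y Oy <-] <-]; exact: Of.
move=> /(_ Oj isT e0); apply: filterS => g fg; apply: eU.
  by rewrite -xE; apply: (near_diffeo_in fg); rewrite clO.
by have := near_diffeo0 oO Oi e0 Of fg Ox; rewrite /in_charts /= xE.
Qed.

End Evaluation.

Section NearIdentity.
Context {R : realType} {K : nonArchFieldType R} {d : nat} {alpha : smoothness}.
Context {M : topologicalType} (A : atlas K d alpha M).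
Notation V := 'rV[K]_d.
Notation n := (smooth_order alpha).
Variables (idx : M -> cidx A) (rad : M -> R) (c : R).
Local Notation Phi a := (cfun (A (idx a))).
Local Notation Psi a := (cinv (A (idx a))).

Definition ball_at a : set V := [set y | vnorm (Phi a a - y) < rad a].
Definition nbd_at a : set M := [set m | cdom (A (idx a)) m /\ ball_at a (Phi a m)].

(** The map in the chart ball at a, extended by the identity. *)
Definition loc a (g : M -> M) (y : V) : V :=
  if vnorm (Phi a a - y) < rad a then Phi a (g (Psi a y)) else y.

Definition near_id a (g : M -> M) :=
  (forall m, nbd_at a m -> nbd_at a (g m) /\ vnorm (Phi a (g m) - Phi a m) <= c * rad a) /\
  nearid c (loc a g).

Hypothesis ball_cimg : forall a, ball_at a `<=` cimg (A (idx a)).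

Lemma ball_nbd a y : ball_at a y -> nbd_at a (Psi a y) /\ Phi a (Psi a y) = y.
Proof.
move=> By; have [Dy yE] := cimg_cinv (ball_cimg By).
by split=> //; split; rewrite ?yE.
Qed.

Lemma nbd_ball a m : nbd_at a m -> ball_at a (Phi a m) /\ Psi a (Phi a m) = m.
Proof. by move=> [Dm Bm]; rewrite cfunK. Qed.

Lemma locE a g m : nbd_at a m -> loc a g (Phi a m) = Phi a (g m).
Proof. by move=> Nm; have [Bm mE] := nbd_ball Nm; rewrite /loc Bm mE. Qed.

Lemma loc_out a g y : ~ ball_at a y -> loc a g y = y.
Proof. by move=> nB; rewrite /loc ifF //; apply/negbTE/negP. Qed.

Lemma loc_ball a g y : near_id a g -> ball_at a y -> ball_at a (loc a g y).
Proof.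
move=> [gN _] By; have [Ny yE] := ball_nbd By.
by rewrite -yE locE //; have [/nbd_ball[]] := gN _ Ny.
Qed.

Lemma loc_disp a g y : near_id a g -> ball_at a y -> vnorm (loc a g y - y) <= c * rad a.
Proof.
move=> [gN _] By; have [Ny yE] := ball_nbd By.
by rewrite -yE locE //; have [] := gN _ Ny.
Qed.

Lemma loc_comp a f g : near_id a g -> loc a (f \o g) = loc a f \o loc a g.
Proof.
move=> ng; apply/funext => y /=; have [By|nB] := pselect (ball_at a y); last first.
  by rewrite !loc_out.
have [Ny yE] := ball_nbd By; rewrite -yE (locE (f \o g)) // (locE g) // locE //.
by have [/(_ _ Ny)[]] := ng.
Qed.

Hypotheses (c0 : 0 < c) (c1 : c < 1).

(** Displacements in the ball bounded by c times the radius match the identity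
    outside. *)
Lemma nearid_extend a g :
  (forall y, ball_at a y -> vnorm (loc a g y - y) <= c * rad a) ->
  (forall y w, ball_at a y -> ball_at a w ->
    vnorm ((loc a g y - y) - (loc a g w - w)) <= c * vnorm (y - w)) ->
  nearid c (loc a g).
Proof.
move=> gd gl.
have mixed y w : ball_at a y -> ~ ball_at a w -> vnorm (loc a g y - y) <= c * vnorm (y - w).
  move=> By Bw; apply: le_trans (gd _ By) _; rewrite ler_pM2l // leNgt.
  by apply/negP => yw; apply: Bw; exact: vdist_lt By yw.
move=> y w; have [By|nBy] := pselect (ball_at a y); have [Bw|nBw] := pselect (ball_at a w).
- exact: gl.
- by rewrite (loc_out g nBw) subrr subr0; exact: mixed.
- by rewrite (loc_out g nBy) subrr sub0r vnormN (vnorm_distC y); exact: mixed.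
- by rewrite !loc_out // !subrr vnorm0 mulr_ge0 ?vnorm_ge0 ?ltW.
Qed.

Hypothesis rad_gt0 : forall a, 0 < rad a.

Lemma near_id_id a : near_id a idfun.
Proof.
split; first by move=> m Nm; split=> //; rewrite subrr vnorm0 ltW // mulr_gt0.
have -> : loc a idfun = id; last exact: nearid_id (ltW c0).
apply/funext => y; rewrite /loc; case: ifP => // By.
by have [_ yE] := ball_nbd (By : ball_at a y).
Qed.

Lemma near_id_comp a f g : near_id a f -> near_id a g -> near_id a (f \o g).
Proof.
move=> nf ng; split; last first.
  by rewrite loc_comp //; apply: nearid_comp; [exact: ltW|exact: c1|exact: nf.2|exact: ng.2].
move=> m Nm; have [Ng gd] := ng.1 m Nm; have [Nf fd] := nf.1 _ Ng; split=> //.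
by rewrite /= -(subrKA (Phi a (g m))); exact: vnormD_le.
Qed.

Lemma near_id_iter a g k : near_id a g -> near_id a (iter k g).
Proof. by move=> ng; elim: k => [|k IH]; [exact: near_id_id|exact: near_id_comp]. Qed.

Lemma loc_iter a g k : near_id a g -> loc a (iter k g) = iter k (loc a g).
Proof.
move=> ng; elim: k => [|k IH].
  by apply/funext => y; rewrite /= /loc; case: ifP => // By;
    have [_ yE] := ball_nbd (By : ball_at a y).
apply/funext => y; rewrite iterS -IH.
by have := congr1 (fun h => h y) (loc_comp g (near_id_iter k ng)).
Qed.

Lemma nbd_open a : open (nbd_at a).
Proof. by apply: open_cont_pre; [exact: cdom_open|exact: cfun_on|exact: vball_open]. Qed.

Hypotheses (hM : hausdorff_space M) (K_lc : locally_compact [set: K]).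

Lemma nbd_closed a : closed (nbd_at a).
Proof.
have -> : nbd_at a = Psi a @` ball_at a.
  apply/seteqP; split=> [m /nbd_ball[Bm mE]|_ [y By <-]]; first by exists (Phi a m).
  by have [] := ball_nbd By.
apply: compact_closed => //; apply: continuous_compact.
  apply/within_cont_on; first exact: vball_open.
  apply: cont_on_sub (cinv_on (C := A (idx a))); exact: ball_cimg.
have [rho rhoP] := vball_bounded (Phi a a) (rad a).
exact: (compact_vbounded K_lc (@vball_closed _ _ _ _ _) rhoP).
Qed.

Section Inverse.
Variables (p : nat) (pK : p \in [pchar K]) (a : M) (f g : M -> M).
Hypotheses (nf : near_id a f) (fK : cancel f g) (gK : cancel g f) (cg : continuous g).

(** The orbits of f in the compact open neighbourhood are recurrent, so that f is
    onto there. *)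
Lemma inverse_nbd m : nbd_at a m -> nbd_at a (g m).
Proof.
move=> Nm; apply: contrapT => nN.
have [Bm mE] := nbd_ball Nm.
have nb : nbhs (Phi a m) [set y | ~ nbd_at a (g (Psi a y))].
  have c1' := cinv_on (ball_cimg Bm); rewrite mE in c1'.
  have h : nbhs (g m) (~` nbd_at a).
    by apply: open_nbhs_nbhs; split=> //; apply: closed_openC; exact: nbd_closed.
  exact: (c1' _ (cg h)).
have [e e0 eN] := (nbhs_vnormP _ _).1 nb.
have rc : 0 <= rad a by exact/ltW.
have [j jP] := small_power (ltW c0) c1 (divr_gt0 e0 (rad_gt0 a)).
rewrite ltr_pdivlMr // in jP.
have pj : (0 < p ^ j)%N by rewrite expn_gt0 (ltnW (pchar_gt1 pK)).
pose k := (p ^ j).-1; have kE : (p ^ j)%N = k.+1 by rewrite /k prednK.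
have Nk := ((near_id_iter k.+1 nf).1 m Nm).1.
have Nk' := ((near_id_iter k nf).1 m Nm).1.
have : ~ nbd_at a (g (Psi a (Phi a (iter k.+1 f m)))).
  suff h : vnorm (Phi a m - Phi a (iter k.+1 f m)) < e by exact: (eN _ h).
  rewrite vnorm_distC -(locE (iter k.+1 f)) // loc_iter // -kE.
  apply: le_lt_trans (nearid_pows pK (ltW c0) c1 _ _ nf.2) _.
  apply: le_lt_trans jP; rewrite ler_wpM2l ?exprn_ge0 ?(ltW c0) //.
  by apply: le_trans (loc_disp nf Bm) _; rewrite ler_piMl // ltW.
by rewrite (nbd_ball Nk).2 iterS fK; apply.
Qed.

(** If k is inverse to h, the displacement of k at y is the opposite of the displacement
    of h at k y, and h does not contract distances. *)
Lemma near_id_inverse : near_id a g.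
Proof.
have disp m : nbd_at a m -> vnorm (Phi a (g m) - Phi a m) <= c * rad a.
  move=> Nm; have [_] := nf.1 _ (inverse_nbd Nm).
  by rewrite gK vnorm_distC.
split=> [m Nm|]; first by split; [exact: inverse_nbd|exact: disp].
apply: nearid_extend.
  move=> y By; have [Ny yE] := ball_nbd By.
  by have := disp _ Ny; rewrite -(locE g) // yE.
have locK y : ball_at a y -> loc a f (loc a g y) = y.
  move=> By; have [Ny yE] := ball_nbd By; rewrite -{1}yE (locE g) //.
  by rewrite locE ?gK //; exact: inverse_nbd.
move=> y w By Bw; have := locK _ By; have := locK _ Bw.
set y' := loc a g y; set w' := loc a g w => wK yK.
have -> : y' - y - (w' - w) = - ((loc a f y' - y') - (loc a f w' - w')).
  by rewrite yK wK; apply/rowP => i; rewrite !mxE; ring.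
rewrite vnormN; apply: le_trans (nf.2 _ _) _; rewrite ler_pM2l //.
(* a perturbation of the identity does not contract distances *)
have [->|yw] := eqVneq y' w'; first by rewrite subrr vnorm0 vnorm_ge0.
rewrite -yK -wK leNgt; apply/negP => lt.
have yw0 : 0 < vnorm (y' - w').
  by rewrite ltNge; apply: contra yw => /vnorm0_eq0/eqP; rewrite subr_eq0.
suff : vnorm (y' - w') < vnorm (y' - w') by rewrite ltxx.
have {1}-> : y' - w' = (loc a f y' - loc a f w') - ((loc a f y' - y') - (loc a f w' - w')).
  by apply/rowP => i; rewrite !mxE; ring.
apply: vnormD_lt => //; rewrite vnormN; apply: le_lt_trans (nf.2 _ _) _.
by rewrite -subr_gt0 -{1}(mul1r (vnorm _)) -mulrBl mulr_gt0 // subr_gt0.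
Qed.

End Inverse.

(** The quotients of order 0 and 1 control the displacement and its Lipschitz constant. *)
Lemma near_id_open a : (0 < n)%N -> open [set g : diffeo A | near_id a g].
Proof.
move=> n0; rewrite openE => f nf.
pose i := idx a; pose O := ball_at a; pose r := rad a; have r0 : 0 < r := rad_gt0 a.
have oO : open O by exact: vball_open.
have clO : closure O = O by exact: vball_closure.
have bO : vbounded O by exact: vball_bounded.
have Of y : O y -> cdom (A i) (f (cinv (A i) y)).
  by move=> /ball_nbd[/(nf.1)[[]]].
have [q q0 q1] := @small_scalar R K; have nq : 0 < nabs q by rewrite nabs_gt0.
have near k eps : (k <= n)%N -> 0 < eps -> nbhs f (near_diffeo f i i O k r eps).
  move=> kn e0; apply: nbhs_near_diffeo => //; rewrite clO; first exact: ball_cimg.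
  by move=> _ [_ [y Oy <-] <-]; exact: Of.
pose eps := c * r * nabs q.
have e0 : 0 < eps by rewrite !mulr_gt0.
have cr0 : 0 < c * r by rewrite mulr_gt0.
apply: filterS (filterI (near 0%N (c * r) (leq0n n) cr0) (near 1%N eps n0 e0)).
move=> g [g0 g1].
have gE y : O y -> loc a f y - loc a g y = in_charts i i f y - in_charts i i g y.
  by move=> Oy; rewrite /loc Oy.
have gd y : O y -> vnorm (loc a g y - y) <= c * r.
  move=> Oy; rewrite -(subrKA (loc a f y)); apply: vnormD_le; last exact: loc_disp.
  by rewrite vnorm_distC gE //; apply: ltW; exact: (near_diffeo0 oO (@ball_cimg a) cr0 Of g0 Oy).
split.
  move=> m Nm; have [Bm mE] := nbd_ball Nm; rewrite -(locE g) //; split; last exact: gd.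
  have Dg : cdom (A i) (g m) by rewrite -mE; apply: (near_diffeo_in g0); rewrite clO.
  split=> //; rewrite -(locE g) //.
  apply: (@vdist_lt _ _ _ _ (Phi a m)) => //; rewrite vnorm_distC.
  by apply: le_lt_trans (gd _ Bm) _; rewrite -subr_gt0 -{1}(mul1r (rad a)) -mulrBl mulr_gt0 ?subr_gt0.
apply: nearid_extend => // y w Oy Ow.
have [->|yw] := eqVneq y w; first by rewrite !subrr vnorm0 mulr0.
have yw0 : 0 < vnorm (y - w).
  by rewrite ltNge; apply: contra yw => /vnorm0_eq0/eqP; rewrite subr_eq0.
(* the increment is scaled by a power of q to a vector of norm comparable to r *)
have ex : exists k, nabs q ^+ k.+1 * r < vnorm (y - w).
  have [k kP] := small_power (nabs_ge0 q) q1 (divr_gt0 yw0 r0).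
  exists k; rewrite -ltr_pdivlMr //; apply: le_lt_trans kP.
  by apply: ler_wiXn2l; rewrite ?nabs_ge0 // ltW.
case: (ex_minnP ex) => k kP kmin.
have kle : vnorm (y - w) <= nabs q ^+ k * r.
  case: k kP kmin => [|k] kP kmin.
    by rewrite expr0 mul1r ltW //; apply: (@vdist_lt _ _ _ _ (Phi a a)); rewrite ?(vnorm_distC y).
  by rewrite leNgt; apply/negP => /kmin; rewrite ltnn.
pose t := q ^+ k; have t0 : t != 0 by rewrite expf_neq0.
pose v := t^-1 *: (y - w).
have yE : y = w + t *: v by rewrite /v scalerA divff // scale1r addrC subrK.
have := near_diffeo1 oO (@ball_cimg a) e0 Of (x := w) (v := v) (t := t) g1 n0 Ow.
rewrite -yE => /(_ Oy) h.
have -> : loc a g y - y - (loc a g w - w) = (loc a f y - y - (loc a f w - w)) -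
    ((loc a f y - loc a f w) - (loc a g y - loc a g w)).
  by apply/rowP => i'; rewrite !mxE; ring.
apply: vnormB_le; first exact: nf.2.
have -> : loc a f y - loc a f w - (loc a g y - loc a g w) =
    in_charts i i f y - in_charts i i f w - (in_charts i i g y - in_charts i i g w).
  by rewrite /loc Oy Ow.
apply: ltW; apply: lt_le_trans (h _ t0 _) _.
- by rewrite vnormZ nabsV nabsX mulrC ler_pdivrMr ?exprn_gt0 // mulrC.
- by rewrite nabsX; apply: exprn_ile1; rewrite ?nabs_ge0 // ltW.
- rewrite nabsX /eps.
  have -> : nabs q ^+ k * (c * r * nabs q) = c * (nabs q ^+ k.+1 * r).
    by rewrite exprS; ring.
  by rewrite ler_pM2l // ltW.
Qed.

(** Each of the conditions is a closed condition on one or two values of the map. *)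
Lemma near_id_closed a : closed [set g : diffeo A | near_id a g].
Proof.
move=> f clf.
have ev_near m e : 0 < e -> nbd_at a (f m) ->
    nbhs f [set g : diffeo A | vnorm (Phi a (f m) - Phi a (g m)) < e].
  move=> e0 [Df _]; have := cfun_on Df; move=> /cvg_vnormP-/(_ e e0).
  by move=> h; have h' := @eval_cont _ _ _ _ _ A m f _ h; exact: h'.
have Nf m : nbd_at a m -> nbd_at a (f m).
  move=> Nm.
  have cl : closed [set g : diffeo A | nbd_at a (g m)].
    have h := @closed_pre _ _ (fun g : diffeo A => g m) _ (@eval_cont _ _ _ _ _ A m)
      (@nbd_closed a); exact: h.
  by apply: (cl f); apply: closureS clf => g [/(_ m Nm)[]].
have car : 0 < c * rad a by exact: mulr_gt0.
split=> [m Nm|].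
  split; first exact: Nf.
  have [g [[gN _] /= fg]] := clf _ (ev_near m _ car (Nf _ Nm)).
  by rewrite -(subrKA (Phi a (g m))); apply: vnormD_le; [exact: ltW|have [] := gN m Nm].
apply: nearid_extend => [y By|y w By Bw].
  have [Ny yE] := ball_nbd By; rewrite -yE locE //.
  have [g [[gN _] /= fg]] := clf _ (ev_near _ _ car (Nf _ Ny)).
  by rewrite -(subrKA (Phi a (g (Psi a y)))); apply: vnormD_le; [exact: ltW|have [] := gN _ Ny].
have [->|yw] := eqVneq y w; first by rewrite !subrr vnorm0 mulr0.
have yw0 : 0 < c * vnorm (y - w).
  apply: mulr_gt0 => //.
  by rewrite ltNge; apply: contra yw => /vnorm0_eq0/eqP; rewrite subr_eq0.
have [Ny yE] := ball_nbd By; have [Nw wE] := ball_nbd Bw.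
have [g [[_ ng] [/= fgy fgw]]] := clf _ (filterI (ev_near _ _ yw0 (Nf _ Ny)) (ev_near _ _ yw0 (Nf _ Nw))).
have -> : loc a f y - y - (loc a f w - w) = (loc a f y - loc a g y - (loc a f w - loc a g w)) +
    (loc a g y - y - (loc a g w - w)) by apply/rowP => i; rewrite !mxE; ring.
apply: vnormD_le; last exact: ng.
rewrite -{1 2}yE -{1 2}wE !locE //; apply: vnormB_le; exact: ltW.
Qed.

Variables (p : nat) (pK : p \in [pchar K]).
Variable s : seq M.

(** The subgroup W: the diffeomorphisms that are near the identity in finitely many
    chart balls, which overlap in general. *)
Definition near_id_group : set (diffeo A) :=
  [set g : diffeo A | forall a, a \in s -> near_id a g].

Lemma near_id_subgroup : is_subgroup near_id_group.
Proof.
split.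
- have [e eE] := diffeo_id A; exists e => // a _; rewrite eE; exact: near_id_id.
- move=> f g nf ng; have [h hE] := diffeo_comp f g; exists h => // a sa.
  by rewrite hE; apply: near_id_comp; [exact: nf|exact: ng].
- move=> f nf; have [g [fK gK]] := diffeo_inverse f; exists g => // a sa.
  apply: (near_id_inverse pK (nf a sa)) => //; exact: diffeo_cont.
Qed.

Lemma near_id_group_open : (0 < n)%N -> open near_id_group.
Proof.
move=> n0; rewrite /near_id_group; elim: s => [|a l IH].
  by rewrite (_ : mkset _ = setT); [exact: openT|apply/seteqP; split].
rewrite (_ : mkset _ = [set g : diffeo A | near_id a g] `&`
  [set g : diffeo A | forall b, b \in l -> near_id b g]).
  by apply: openI => //; exact: near_id_open.
apply/seteqP; split=> [g ng|g [na nl] b]; last by rewrite inE => /orP[/eqP ->|/nl].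
by split=> [|b bl]; apply: ng; rewrite inE ?eqxx // bl orbT.
Qed.

Lemma near_id_group_closed : closed near_id_group.
Proof.
move=> f clf a sa; apply: near_id_closed; apply: closureS clf => g; exact.
Qed.

End NearIdentity.

(** * The one-parameter subgroups *)

Section Flow.
Context {R : realType} {K : nonArchFieldType R} {d : nat} {alpha : smoothness}.
Context {M : topologicalType} (A : atlas K d alpha M).
Notation V := 'rV[K]_d.
Notation vecV := (vec (@rV_tmod R K d)).
Notation r := (@smooth_rule R K alpha).
Notation n := (smooth_order alpha).
Variables (idx : M -> cidx A) (rad : M -> R) (c : R).
Local Notation Phi a := (cfun (A (idx a))).
Local Notation Psi a := (cinv (A (idx a))).
Notation ball_at := (@ball_at R K d alpha M A idx rad).
Notation nbd_at := (@nbd_at R K d alpha M A idx rad).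
Notation near_id := (@near_id R K d alpha M A idx rad c).
Notation loc := (@loc R K d alpha M A idx rad).
Hypothesis ball_cimg : forall a, ball_at a `<=` cimg (A (idx a)).
Hypotheses (c0 : 0 < c) (c1 : c < 1) (rad_gt0 : forall a, 0 < rad a).
Hypotheses (hM : hausdorff_space M) (K_lc : locally_compact [set: K]).
Variables (p : nat) (pK : p \in [pchar K]).
Notation Z := (padic p).
Notation hZ := (@padic_hausdorff p).
Notation dig := (@digits p (pchar_gt1 pK)).

(** A near-identity map is triangular over a point. *)
Lemma triangular_nearid (h : V -> V) : nearid c h -> triangular d c (X := vecV) h.
Proof.
move=> nh; pose X0 := vec (@rV_tmod R K 0).
have l1 := lin_snd X0 vecV.
have l2 : @lin R K vecV (prodo X0 vecV) (fun y => (0, y)) (fun _ w => (0, w)).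
  split => //=.
  - by apply: cont_pair => y; [exact: cvg_const|exact: cvg_id].
  - by apply: cont_pair; [move=> y; exact: cvg_const|exact: cont_snd].
  - by move=> x v; rewrite add0r.
  - by move=> x v w; rewrite add0r.
  - by move=> x t v; rewrite scaler0.
apply: (Tri_iso l1 l2 _ _ (Tri_ext (F := fun _ => h) (@Tri_id R K d c X0) (fun _ => nh))) => //.
by move=> [x y] /=; rewrite (rV0_eq x 0).
Qed.

(** The ball is clopen: smoothness is tested on the ball and on its complement. *)
Lemma loc_Br a (f : diffeo A) : near_id a f -> Br r n (X := vecV) setT (loc a f).
Proof.
move=> nf; have [b rE] := @smooth_ruleE R K alpha.
rewrite rE; apply: (Br_local (@drule_quotients R K b)); first exact: openT.
move=> y _; have [By|nB] := pselect (ball_at a y).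
  exists (ball_at a); split=> //; first exact: vball_open.
  rewrite -rE; have oB : open (ball_at a) by exact: vball_open.
  have sB : smooth alpha (ball_at a) (in_charts (idx a) (idx a) f).
    apply: in_charts_smooth => // x Bx; split; first exact: ball_cimg.
    by have [/(nf.1)[[]]] := ball_nbd ball_cimg Bx.
  by apply: Br_eq (smooth_Br oB sB) => // x Bx; rewrite /loc (Bx : _ < _).
exists (~` ball_at a); have oC : open (~` ball_at a).
  by apply: closed_openC; exact: vball_closed.
split=> //; apply: (@Br_eq _ _ _ _ vecV d _ id) => //.
  by move=> x nBx; rewrite loc_out.
exact: Cr_Br (Cr_lin (@drule_functorial R K b) n _ (lin_id vecV)).
Qed.

Variables (f : diffeo A) (s : seq M).
Hypothesis near_f : forall a, a \in s -> near_id a f.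
Hypothesis cover : forall m, exists2 a, a \in s & nbd_at a m.

Lemma local_flow a : exists gamma : Z * V -> V, a \in s ->
  (forall k x, gamma (dig k, x) = iter k (loc a f) x) /\
  Br r n (X := paro hZ vecV) setT gamma.
Proof.
have [sa|nsa] := boolP (a \in s); last by exists snd.
have [b rE] := @smooth_ruleE R K alpha; have nf := near_f sa.
have Bf := loc_Br nf; rewrite rE in Bf.
have tf := triangular_nearid nf.2.
have [gamma [gE Cg]] := triangular_family (b := b) pK (ltW c0) c1 K_lc tf (Br_Cr Bf).
by exists gamma => _; split=> //; rewrite rE; exact: Cr_Br.
Qed.

(** The flows in the chart balls agree on overlaps, as they are determined by the powers
    of f, which are dense among the p-adic exponents. *)
Lemma near_id_flow : exists G : Z * M -> M,
  [/\ continuous G, smooth_family A hZ G & forall k m, G (dig k, m) = iter k f m].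
Proof.
have [gamma gammaP] := choice local_flow.
have cover' m : exists a, a \in s /\ nbd_at a m by have [a] := cover m; exists a.
have [pk pkP] := choice cover'.
pose G (zm : Z * M) := Psi (pk zm.2) (gamma (pk zm.2) (zm.1, Phi (pk zm.2) zm.2)).
have gd a k x : a \in s -> gamma a (dig k, x) = iter k (loc a f) x.
  by move=> sa; have [-> _] := gammaP a sa.
have cg a : a \in s -> continuous (gamma a).
  by move=> sa zx; have [_ /Br_cont h] := gammaP a sa; exact: h.
have cgz a y : a \in s -> continuous (fun z : Z => gamma a (z, y)).
  move=> sa; apply: (cont_comp _ (cg a sa)).
  by apply: cont_pair => z; [exact: cvg_id|exact: cvg_const].
have gB a z y : a \in s -> ball_at a y -> ball_at a (gamma a (z, y)).
  move=> sa By; apply: contrapT => nB.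
  have oC : open (~` ball_at a) by apply: closed_openC; exact: vball_closed.
  have := cgz a y sa z _ (open_nbhs_nbhs (conj oC nB)).
  move=> /(digits_cluster (pchar_gt1 pK))[k]; apply.
  rewrite gd //; elim: k => [|k IH] //=; exact: loc_ball (near_f sa) IH.
have iterE a k m : a \in s -> nbd_at a m ->
    nbd_at a (iter k f m) /\ iter k (loc a f) (Phi a m) = Phi a (iter k f m).
  move=> sa Nm; elim: k => [|k [N1 E1]] //=; rewrite E1 locE //; split=> //.
  by have [/(_ _ N1)[]] := near_f sa.
have Gdig k m : G (dig k, m) = iter k f m.
  have [sa Na] := pkP m; have [N1 E1] := iterE _ k m sa Na.
  by rewrite /G /= gd // E1; have [_ ->] := nbd_ball N1.
have cPsi a y : a \in s -> ball_at a y -> continuous (fun z : Z => Psi a (gamma a (z, y))).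
  move=> sa By z; apply: continuous_comp; first exact: cgz.
  by apply: cinv_on; apply: ball_cimg; exact: gB.
have GE a z m : a \in s -> nbd_at a m -> G (z, m) = Psi a (gamma a (z, Phi a m)).
  move=> sa Nm; have [sb Nb] := pkP m; rewrite /G /=.
  have [Ba _] := nbd_ball Nm; have [Bb _] := nbd_ball Nb.
  apply: (@cvg_uniq Z M (fun z => Psi (pk m) (gamma (pk m) (z, Phi (pk m) m)))
    (fun z => Psi a (gamma a (z, Phi a m))) z hM).
  - exact: cPsi.
  - exact: cPsi.
  move=> N zN; have [k Nk] := digits_cluster (pchar_gt1 pK) zN; exists (dig k) => //.
  have := Gdig k m; rewrite /G /= => ->; have [N1 E1] := iterE a k m sa Nm.
  by rewrite gd // E1; have [_ ->] := nbd_ball N1.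
have GN a z m : a \in s -> nbd_at a m ->
    nbd_at a (G (z, m)) /\ Phi a (G (z, m)) = gamma a (z, Phi a m).
  move=> sa Nm; rewrite (GE a) //; have [Ba _] := nbd_ball Nm.
  exact: ball_nbd (gB a z _ sa Ba).
have cG : continuous G.
  move=> [z m]; have [sa Na] := pkP m; set a := pk m in sa Na.
  pose D := [set zm : Z * M | nbd_at a zm.2].
  have oD : open D by apply: (open_comp _ (nbd_open idx rad a)) => zm _; exact: cvg_snd.
  suff : cont_on D G by apply.
  apply: (@cont_on_eq _ _ D (fun zm => Psi a (gamma a (zm.1, Phi a zm.2)))) => //.
    by move=> [z' m'] Dm; rewrite -GE.
  apply: (cont_on_comp (E := ball_at a)).
  - by move=> [z' m'] /nbd_ball[Bm _]; exact: gB.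
  - apply: (cont_on_comp (E := setT)) => //; last by move=> zx _; exact: cg.
    apply: cont_on_pair => [zm _|]; first exact: cvg_fst.
    apply: (cont_on_comp (E := cdom (A (idx a)))) (cfun_on (C := A (idx a))).
      by move=> zm [].
    by move=> zm _; exact: cvg_snd.
  - by apply: cont_on_sub (cinv_on (C := A (idx a))); exact: ball_cimg.
exists G; split=> //; apply: family_local => // z m.
have [sa Na] := pkP m; set a := pk m in sa Na.
pose E := [set zx : Z * V | ball_at a zx.2].
have oE : open E.
  by apply: (@open_comp _ _ snd) => [zx _|]; [exact: cvg_snd|exact: vball_open].
exists (idx a), (idx a), E; split=> //.
- by have [] := Na.
- by have [] := Na.
- move=> [z' x] Bx /=; split; first exact: ball_cimg.
  by have [Nx _] := ball_nbd ball_cimg Bx; have [[]] := GN a z' _ sa Nx.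
have [_ Bg] := gammaP a sa.
have Bg' : Br r n (X := paro hZ vecV) E (gamma a) by apply: Br_sub Bg.
apply: (@Br_eq R K r n (paro hZ vecV) d E (gamma a)) => // -[z' x] Bx.
have [Nx xE] := ball_nbd ball_cimg Bx.
by have [_ E1] := GN a z' _ sa Nx; rewrite xE in E1; exact: esym E1.
Qed.

End Flow.

Section OneParameterGroup.
Context {R : realType} {K : nonArchFieldType R} {d : nat} {alpha : smoothness}.
Context {M : topologicalType} (A : atlas K d alpha M).
Notation V := 'rV[K]_d.
Hypotheses (hM : hausdorff_space M) (K_lc : locally_compact [set: K]).
Variables (p : nat) (pK : p \in [pchar K]) (pi : K).
Hypotheses (pi0 : 0 < nabs pi) (pi1 : nabs pi < 1).
Notation Z := (padic p).
Notation hZ := (@padic_hausdorff p).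
Notation dig := (@digits p (pchar_gt1 pK)).
Variables (f : diffeo A) (G : Z * M -> M).
Hypotheses (cG : continuous G) (sG : smooth_family A hZ G).
Hypothesis Gdig : forall k m, G (dig k, m) = iter k f m.

Lemma close_on_trans k (O : set V) rho eps (g0 g1 g2 : V -> V) : 0 < eps ->
  close_on alpha k O rho eps g0 g1 -> close_on alpha k O rho eps g1 g2 ->
  close_on alpha k O rho eps g0 g2.
Proof.
move=> e0; have tr (x y z : V) : ball x eps y -> ball y eps z -> ball x eps z.
  move=> /ball_vnormP-/(_ e0) xy /ball_vnormP-/(_ e0) yz; apply/ball_vnormP => //.
  exact: vdist_lt xy yz.
by case: (alpha) => m c01 c12 y yO yb; exact: tr (c01 y yO yb) (c12 y yO yb).
Qed.

(** The p-adic flow is a representation of the additive group of p-adic integers, by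
    density of the natural numbers. Composed with the homomorphism of the one-units to
    the p-adic integers it is multiplicative, and takes the value f at 1 + pi. *)
Theorem one_parameter_group : exists gx : K -> diffeo A,
  [/\ local_one_param pi 1 gx, lies_on f pi 1 gx & {within unit_ball pi 1, continuous gx}].
Proof.
have [zeta [c [zetac cD zeta_x0 zeta1 zeta_cont]]] := padic_logarithm pK pi0 pi1 K_lc.
have UE : unit_ball pi 1 = near_units pi (nabs pi).
  by apply/seteqP; split=> u; rewrite /unit_ball /near_units /= expr1; [split|case].
rewrite UE; set U1 := near_units pi (nabs pi).
have cGz z : continuous (fun m => G (z, m)).
  by apply: (cont_comp _ cG); apply: cont_pair => m; [exact: cvg_const|exact: cvg_id].
have cGm m : continuous (fun z => G (z, m)).
  by apply: (cont_comp _ cG); apply: cont_pair => z; [exact: cvg_id|exact: cvg_const].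
have GM u v m : U1 u -> U1 v -> G (zeta (u * v), m) = G (zeta u, G (zeta v, m)).
  move=> Uu Uv; have Uuv := near_units_mul pi1 Uu Uv.
  apply: hM => X Y nX nY.
  have [k1 X1] := nbhs_agreeP (cGm m _ _ nX).
  have cc : continuous (fun zz : Z * Z => G (zz.1, G (zz.2, m))).
    apply: (cont_comp _ cG); apply: cont_pair; first exact: cont_fst.
    by apply: (cont_comp _ (cGm m)); exact: cont_snd.
  have [[Y1 Y2] /= [/nbhs_agreeP[k2 Y1k] /nbhs_agreeP[k3 Y2k]] YY] := cc (zeta u, zeta v) _ nY.
  pose k := (k1 + k2 + k3)%N.
  exists (iter (c k u + c k v) f m); split.
    rewrite -Gdig; apply: X1; apply: (@agree_le p k1 k); first by rewrite /k -addnA leq_addr.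
    apply: agree_trans (zetac _ k Uuv) _; apply: digits_agree; exact: cD.
  rewrite iterD -Gdig -Gdig; apply: (YY (dig (c k u), dig (c k v))); split=> /=.
    apply: Y1k; apply: (@agree_le p k2 k); last exact: zetac.
    by rewrite /k addnAC leq_addl.
  apply: Y2k; apply: (@agree_le p k3 k); last exact: zetac.
  by rewrite /k leq_addl.
have G1 m : G (zeta 1, m) = m by rewrite zeta1 Gdig.
have sGz z : smooth_map A (fun m => G (z, m)).
  by have h := family_slice z cG sG; exact: h.
have gx_ex u : exists h : diffeo A, U1 u -> dfun h = fun m => G (zeta u, m).
  have [Uu|nU] := pselect (U1 u); last by exists f.
  have Uv := near_units_inv pi1 Uu; have u0 := one_unit_neq0 pi1 Uu.
  have hP : exists g : M -> M, [/\ cancel (fun m => G (zeta u, m)) g,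
      cancel g (fun m => G (zeta u, m)),
      continuous (fun m => G (zeta u, m)) /\ continuous g &
      smooth_map A (fun m => G (zeta u, m)) /\ smooth_map A g].
    exists (fun m => G (zeta u^-1, m)); split=> [m|m||].
    - by rewrite -GM // mulVf.
    - by rewrite -GM // divff.
    - by split; exact: cGz.
    - by split; exact: sGz.
  by exists (Diffeo hP).
have [gx gxE] := choice gx_ex.
have U11 : U1 1 by apply: (near_units_one pi0); exact: ltW.
exists gx; split.
- split=> //; first by rewrite pi0.
    by rewrite gxE //; apply/funext => m; exact: G1.
  rewrite UE => u v Uu Uv; have Uuv := near_units_mul pi1 Uu Uv; rewrite !gxE //.
  by apply/funext => m; exact: GM.
- exists (1 + pi); first by rewrite UE; exact: one_unit_x0.
  apply: diffeo_ext; rewrite gxE; last exact: one_unit_x0.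
  by apply/funext => m; rewrite zeta_x0 Gdig.
have oU : open U1.
  rewrite openE => u Uu; apply: filterS (near_nabs u pi0) => v /= uv.
  have h : nabs (v - 1) <= nabs pi.
    rewrite -(subrKA u); apply: nabsD_le; last exact: Uu.1.
    by rewrite -nabsN opprB ltW.
  by split.
have zeta_on : cont_on U1 zeta.
  move=> u Uu N /nbhs_agreeP[m mN]; have [r r0 rP] := zeta_cont u m Uu.
  have nU : nbhs u U1 by exact: open_nbhs_nbhs.
  apply: filterS2 nU (near_nabs u r0) => v Uv /= uv.
  by apply: mN; apply: rP => //; exact: ltW.
apply/within_cont_on => // u Uu.
have nU : nbhs u U1 by exact: open_nbhs_nbhs.
have FF : Filter (gx @ u) by apply: (@fmap_filter _ _ gx (nbhs u)).
apply: nbhs_diffeo => N [f0 [i [j [Q [k [rho [eps [[Q_op bQ Qi] Qj kn e0 ->]]]]]]]] [gQ gc].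
have QD : closure Q `<=` slice (family_dom G i j) (zeta u).
  move=> x Qx; split; first exact: Qi.
  have := gQ (gx u (cinv (A i) x)); rewrite gxE //; apply.
  by exists (cinv (A i) x) => //; exists x.
have := close_near K_lc (@family_dom_open _ _ _ _ _ A Z G i j cG) (sG i j) rho Q_op bQ QD kn e0.
move=> /(zeta_on u Uu) near; apply: filterS2 nU near => v Uv [QDv cv]; split.
  move=> _ [_ [x Qx <-] <-]; rewrite gxE //; have [] := QDv x Qx; exact.
apply: close_on_trans e0 gc _.
by rewrite /in_charts !gxE.
Qed.

End OneParameterGroup.

Theorem mainTheorem5 (R : realType) (K : nonArchFieldType R) (p d t : nat)
    (alpha : smoothness) (M : topologicalType) (A : atlas K d alpha M) :
  p \in [pchar K] -> locally_compact [set: K] ->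
  (1 <= t)%N -> alpha = Citer t \/ alpha = Cbrack t ->
  compact [set: M] -> hausdorff_space M ->
  exists W : set (diffeo A),
    [/\ is_subgroup W, open W, closed W &
        forall g, W g ->
          exists (pi : K) (s : nat) (gx : K -> diffeo A),
            [/\ local_one_param pi s gx, lies_on g pi s gx &
                {within unit_ball pi s, continuous gx}]].
Proof.
move=> pK K_lc t1 at_ cM hM.
have n0 : (0 < smooth_order alpha)%N by case: at_ => ->.
have [pi pi_neq0 pi1] := @small_scalar R K.
have pi0 : 0 < nabs pi by rewrite nabs_gt0.
have idx_ex m : exists i, cdom (A i) m by exact: acover.
have [idx idxP] := choice idx_ex.
have rad_ex m : exists r : R, 0 < r /\
    forall y, vnorm (cfun (A (idx m)) m - y) < r -> cimg (A (idx m)) y.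
  have im : nbhs (cfun (A (idx m)) m) (cimg (A (idx m))).
    by apply: open_nbhs_nbhs; split; [exact: cimg_open|exact: cimg_cfun].
  by have [r r0 rP] := (nbhs_vnormP _ _).1 im; exists r.
have [rad radP] := choice rad_ex.
have rad0 a : 0 < rad a by have [] := radP a.
have radimg a : ball_at idx rad a `<=` cimg (A (idx a)) by have [] := radP a.
have nbd a : [set: M] a -> nbhs a (nbd_at idx rad a).
  move=> _; apply: open_nbhs_nbhs; split; first exact: nbd_open.
  by split; [exact: idxP|rewrite /ball_at /= subrr vnorm0].
have [s [_ cover]] := compact_net cM nbd.
exists (near_id_group idx rad (nabs pi) s); split.
- exact: (near_id_subgroup radimg pi0 pi1 rad0 hM K_lc pK).
- exact: near_id_group_open.
- exact: near_id_group_closed.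
move=> g Wg; have cover' m : exists2 a, a \in s & nbd_at idx rad a m by exact: cover.
have [G [cG sG Gdig]] := near_id_flow radimg pi0 pi1 hM K_lc pK Wg cover'.
have [gx gxP] := one_parameter_group hM K_lc pi0 pi1 cG sG Gdig.
by exists pi, 1%N, gx.
Qed.
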